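(* Let $V$ be a complex Hilbert space, let $\Omega=\{z\in\mathbb C: |z|<1\}$, and let $F:\partial\Omega\to\mathrm{End}^+V$ be continuous for the norm topology on $\mathrm{End}^+V\subset\mathrm{End}\,V$. Then there is a unique continuous $P:\overline\Omega\to\mathrm{End}^+V$ that is smooth over $\Omega$ and satisfies $$P=F\ \text{ on }\partial\Omega,\qquad R^P=0\ \text{ on }\Omega.$$ Over $\Omega$ one can write $P=H^*H$ with a holomorphic $H:\Omega\to\mathrm{GL}(V)$. If $F$ takes values in a unital $C^*$-subalgebra $\mathcal A$ of $\mathrm{End}\,V$, then so will $P$, and $H$ can be taken with values in $\mathcal A$.
   Context: $\mathrm{End}\,V$ is the space of continuous linear operators on $V$ with the operator norm; $\mathrm{GL}(V)\subset\mathrm{End}\,V$ is the group of invertible elements; $\mathrm{End}^+V\subset\mathrm{End}\,V$ is the cone of positive (self-adjoint) invertible operators. Continuity, smoothness ($C^\infty$) and holomorphy of operator valued maps are understood with respect to the operator norm. For a smooth $P:\Omega\to\mathrm{End}^+V$ on an open $\Omega\subset\mathbb C$, the curvature is the $\mathrm{End}\,V$ valued $(1,1)$-form $$R^P=\overline\partial(P^{-1}\partial P)=P^{-1}\big(P_{\overline z}P^{-1}P_z-P_{z\overline z}\big)\,dz\wedge d\overline z,$$ where subscripts denote partial derivatives. *)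

(* Defs.v *)
From HB Require Import structures.
From mathcomp Require Import all_boot all_order all_algebra.
From mathcomp Require Import complex.
From mathcomp Require Import all_classical all_reals all_analysis.

Set Implicit Arguments.
Unset Strict Implicit.
Unset Printing Implicit Defensive.

Import Order.TTheory GRing.Theory Num.Theory.
Import numFieldNormedType.Exports.

Local Open Scope classical_set_scope.
Local Open Scope ring_scope.
Local Open Scope complex_scope.

HB.instance Definition _ (R : realType) := NormedModule.copy R[i] R[i]^o.

(* In [{dot V for Num.conj}] forms are linear in the first argument and
   conjugate-linear in the second one. *)
HB.mixin Record isHilbert (R : realType) V & CompleteNormedModule R[i] V := {
  inner : {dot V for @Num.conj R[i]};
  innerE : forall v : V, inner v v = `|v| ^+ 2
}.

#[short(type="hilbertType")]
HB.structure Definition Hilbert (R : realType) :=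
  {V of CompleteNormedModule R[i] V & isHilbert R V}.

Section Endomorphisms.
Context {R : realType}.
Implicit Types V : normedModType R[i].

Definition continuous_linear V : {pred V -> V} :=
  fun f => `[< linear f /\ continuous f >].
Arguments continuous_linear : clear implicits.

Fact continuous_linear_submod_closed V :
  submod_closed (continuous_linear V).
Proof.
split=> [|a f g]; rewrite !unfold_in; last move=> /asboolP[fl fc] /asboolP[gl gc].
  by apply/asboolP; split=> [a u v|]; [rewrite /= scaler0 addr0|exact: cst_continuous].
apply/asboolP; split=> [b u v|x].
  rewrite !fctE /= fl gl !scalerDr !scalerA mulrC -!addrA; congr (_ + _).
  by rewrite addrCA.
by apply: (@continuousD _ V V (fun x => a *: f x) g);
  [apply: continuousZr; exact: fc|exact: gc].
Qed.

HB.instance Definition _ V :=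
  GRing.isSubmodClosed.Build R[i] (V -> V) (continuous_linear V)
    (continuous_linear_submod_closed V).

Record endo V := Endo {
  endo_fun :> V -> V;
  endoP : endo_fun \in continuous_linear V
}.

HB.instance Definition _ V := [isSub of endo V for @endo_fun V].
HB.instance Definition _ V := [Choice of endo V by <:].
HB.instance Definition _ V := [SubChoice_isSubLmodule of endo V by <:].

Lemma endo_linear V (T : endo V) : linear T.
Proof. by have := endoP T; rewrite unfold_in => /asboolP[]. Qed.

Lemma endo_continuous V (T : endo V) : continuous T.
Proof. by have := endoP T; rewrite unfold_in => /asboolP[]. Qed.

HB.instance Definition _ V (T : endo V) :=
  GRing.isLinear.Build R[i] V V *:%R (endo_fun T) (endo_linear T).

Lemma endo_ext V (S T : endo V) : S =1 T -> S = T.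
Proof. by move=> ST; apply/val_inj/funext. Qed.

Lemma endo_addE V (S T : endo V) v : (S + T) v = S v + T v.
Proof. by []. Qed.

Lemma endo_scaleE V a (T : endo V) v : (a *: T) v = a *: T v.
Proof. by []. Qed.

Fact endo_id_subproof V : (fun v : V => v) \in continuous_linear V.
Proof. by rewrite unfold_in; apply/asboolP; split=> // x; exact: cvg_id. Qed.

Fact endo_comp_subproof V (S T : endo V) :
  (fun v => S (T v)) \in continuous_linear V.
Proof.
rewrite unfold_in; apply/asboolP; split=> [a u v|x]; first by rewrite !linearP.
by apply: (@continuous_comp _ _ _ T S); exact: endo_continuous.
Qed.

Definition endo_one V := Endo (endo_id_subproof V).
Definition endo_mul V (S T : endo V) := Endo (endo_comp_subproof S T).

Fact endo_mulA V : associative (@endo_mul V).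
Proof. by move=> S T U; exact: endo_ext. Qed.
Fact endo_mul1 V : left_id (endo_one V) (@endo_mul V).
Proof. by move=> T; exact: endo_ext. Qed.
Fact endo_mulr1 V : right_id (endo_one V) (@endo_mul V).
Proof. by move=> T; exact: endo_ext. Qed.
Fact endo_mulDl V : left_distributive (@endo_mul V) +%R.
Proof. by move=> S T U; exact: endo_ext. Qed.
Fact endo_mulDr V : right_distributive (@endo_mul V) +%R.
Proof. by move=> S T U; apply: endo_ext => v; exact: (linearD S). Qed.

HB.instance Definition _ V := GRing.Zmodule_isPzRing.Build (endo V)
  (@endo_mulA V) (@endo_mul1 V) (@endo_mulr1 V) (@endo_mulDl V) (@endo_mulDr V).

Lemma endo_mulE V (S T : endo V) v : (S * T) v = S (T v).
Proof. by []. Qed.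

Definition opnorm V (T : endo V) : R :=
  sup [set complex.Re `|T v| | v in [set v : V | `|v| <= 1]].

Let normRe V (v : V) : (complex.Re `|v|)%:C = `|v|.
Proof. by apply: RRe_real; exact: normr_real. Qed.

Let opnorm_has_sup V (T : endo V) :
  has_sup [set complex.Re `|T v| | v in [set v : V | `|v| <= 1]].
Proof.
split; first by exists (complex.Re `|T 0|), 0 => //=; rewrite normr0.
have /linear_boundedP/pinfty_ex_gt0[r r0 Tr] :=
  @continuous_linear_bounded _ _ _ 0 (T : {linear V -> V}) (@endo_continuous _ T 0).
exists (complex.Re r) => _ [v /= v1 <-].
rewrite -lecR normRe RRe_real ?gtr0_real//.
by rewrite (le_trans (Tr v))// ler_piMr// ltW.
Qed.

Lemma opnorm_ge0 V (T : endo V) : 0 <= opnorm T.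
Proof.
apply: (@le_trans _ _ (complex.Re `|T 0|)).
  by rewrite -lecR normRe; exact: normr_ge0.
by apply: ub_le_sup; [exact: (opnorm_has_sup T).2|exists 0 => //=; rewrite normr0].
Qed.

Lemma le_opnorm V (T : endo V) v : `|T v| <= (opnorm T)%:C * `|v|.
Proof.
have [->|v0] := eqVneq v 0; first by rewrite linear0 !normr0 mulr0.
have nv0 : 0 < `|v| by rewrite normr_gt0.
pose w := `|v|^-1 *: v.
have w1 : `|w| <= 1.
  by rewrite normrZ ger0_norm ?invr_ge0 ?(ltW nv0)// mulVf ?gt_eqF.
have -> : T v = `|v| *: T w.
  by rewrite -linearZ /= scalerA divff ?scale1r ?gt_eqF.
rewrite normrZ normr_id mulrC ler_wpM2r// -normRe lecR.
by apply: ub_le_sup; [exact: (opnorm_has_sup T).2|exists w].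
Qed.

Lemma opnorm_le V (T : endo V) (M : R) :
  0 <= M -> (forall v, `|T v| <= M%:C * `|v|) -> opnorm T <= M.
Proof.
move=> M0 TM; apply: ge_sup; first exact: (opnorm_has_sup T).1.
move=> _ [v /= v1 <-]; rewrite -lecR normRe (le_trans (TM v))//.
by rewrite ler_piMr// lecR.
Qed.

Fact opnormD V (S T : endo V) :
  (opnorm (S + T))%:C <= (opnorm S)%:C + (opnorm T)%:C.
Proof.
rewrite -rmorphD lecR; apply: opnorm_le; first by rewrite addr_ge0 ?opnorm_ge0.
move=> v; rewrite endo_addE (le_trans (ler_normD _ _))//.
by rewrite rmorphD mulrDl lerD ?le_opnorm.
Qed.

Let opnormZ_le V a (T : endo V) : opnorm (a *: T) <= complex.Re `|a| * opnorm T.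
Proof.
apply: opnorm_le => [|v].
  by rewrite mulr_ge0 ?opnorm_ge0// -lecR normRe; exact: normr_ge0.
rewrite endo_scaleE normrZ rmorphM.
rewrite [X in X * _ * _]RRe_real ?normr_real// -mulrA.
by rewrite ler_wpM2l// le_opnorm.
Qed.

Fact opnormZ V (a : R[i]) (T : endo V) :
  (opnorm (a *: T))%:C = `|a| * (opnorm T)%:C.
Proof.
have aR (b : R[i]) : (complex.Re `|b|)%:C = `|b| by rewrite RRe_real ?normr_real.
rewrite -aR -rmorphM; congr (_%:C); apply/eqP; rewrite eq_le opnormZ_le andTb.
have [->|a0] := eqVneq a 0; first by rewrite normr0 mul0r opnorm_ge0.
have := opnormZ_le a^-1 (a *: T); rewrite scalerA mulVf// scale1r.
have Ra0 : 0 <= complex.Re `|a| by rewrite -lecR aR; exact: normr_ge0.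
have /complexI aV : (complex.Re `|a| * complex.Re `|a^-1|)%:C = 1%:C.
  rewrite rmorphM [X in X * _]aR [X in _ * X]aR normfV divff//.
  by rewrite normr_eq0.
by move=> /(ler_wpM2l Ra0); rewrite mulrA aV mul1r.
Qed.

Fact opnorm_eq0 V (T : endo V) : (opnorm T)%:C = 0 -> T = 0.
Proof.
move=> T0; apply: endo_ext => v; apply/eqP; rewrite -normr_le0.
by have := le_opnorm T v; rewrite T0 mul0r.
Qed.

HB.instance Definition _ V := Lmodule_isNormed.Build R[i] (endo V)
  (@opnormD V) (@opnormZ V) (@opnorm_eq0 V).

Lemma endo_normE V (T : endo V) : `|T| = (opnorm T)%:C.
Proof. by []. Qed.

End Endomorphisms.

Section Operators.
Context {R : realType} {V : hilbertType R}.
Implicit Types S T : endo V.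

(* Such an [S] exists by the Riesz representation theorem. *)
Definition adjoint T : endo V :=
  get [set S : endo V | forall u v : V, inner (T u) v = inner u (S v)].

Definition invertible T := exists S, S * T = 1 /\ T * S = 1.

Definition inverse T : endo V := get [set S : endo V | S * T = 1 /\ T * S = 1].

(* On [R[i]], [0 <= x] also says that [x] is real. *)
Definition positive_invertible T :=
  [/\ adjoint T = T, forall v : V, 0 <= inner (T v) v & invertible T].

Definition unital_Cstar_subalgebra (A : set (endo V)) :=
  [/\ A 1,
      forall (a : R[i]) S T, A S -> A T -> A (a *: S + T),
      forall S T, A S -> A T -> A (S * T),
      forall T, A T -> A (adjoint T)
    & closed A].

End Operators.

Section ComplexVariable.
Context {R : realType} {W : normedModType R[i]}.
Implicit Types (f : R[i] -> W) (U : set R[i]).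

Definition real_quotient f (z w : R[i]) (h : R) : W :=
  (h^-1)%:C *: (f (z + h%:C * w) - f z).

(* Derivatives at [z] along the real line [z + R w]; the library's ['D_w f z]
   lets the increment range over the scalar field, which is complex here. *)
Definition real_derivable f (z w : R[i]) := cvg (real_quotient f z w @ 0^').
Definition real_derive (w : R[i]) f (z : R[i]) : W :=
  lim (real_quotient f z w @ 0^').

Definition partial_x f := real_derive 1 f.
Definition partial_y f := real_derive 'i f.

Fixpoint continuously_derivable (k : nat) U f : Prop :=
  (forall z, U z -> {for z, continuous f}) /\
  if k is k'.+1 then
    [/\ forall z, U z -> real_derivable f z 1 /\ real_derivable f z 'i,
        continuously_derivable k' U (partial_x f)
      & continuously_derivable k' U (partial_y f)]
  else True.

Definition smooth_on U f := forall k, continuously_derivable k U f.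

Definition holomorphic_on U f := forall z, U z -> derivable f z 1.

Definition partial_z f (z : R[i]) : W :=
  2%:R^-1 *: (partial_x f z - 'i *: partial_y f z).
Definition partial_zbar f (z : R[i]) : W :=
  2%:R^-1 *: (partial_x f z + 'i *: partial_y f z).

End ComplexVariable.

Section Curvature.
Context {R : realType} {V : hilbertType R}.

Definition unit_disc : set R[i] := [set z | `|z| < 1].
Definition closed_unit_disc : set R[i] := [set z | `|z| <= 1].
Definition unit_circle : set R[i] := [set z | `|z| = 1].

(* The coefficient of [dz /\ dzbar] in [dbar (P^-1 dP)]: the sign comes from
   [dbar (a dz) = a_zbar (dzbar /\ dz) = - a_zbar (dz /\ dzbar)]. *)
Definition curvature (P : R[i] -> endo V) (z : R[i]) : endo V :=
  - partial_zbar (fun w => inverse (P w) * partial_z P w) z.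

Definition flat_extension (F P : R[i] -> endo V) :=
  [/\ {within closed_unit_disc, continuous P},
      forall z, closed_unit_disc z -> positive_invertible (P z),
      smooth_on unit_disc P,
      forall z, unit_circle z -> P z = F z
    & forall z, unit_disc z -> curvature P z = 0].

Definition holomorphic_factor (P H : R[i] -> endo V) :=
  [/\ holomorphic_on unit_disc H,
      forall z, unit_disc z -> invertible (H z)
    & forall z, unit_disc z -> P z = adjoint (H z) * H z].

End Curvature.

(* Main.v *)
(** The flat metrics [P = G^* C G], with [G] a holomorphic polynomial that is
    invertible on the closed disc, [G 0 = 1] and [C] positive definite, solve
    the problem for boundary values that are trigonometric polynomials [F] with
    [0 < c <= F <= M]: if [T] is the Toeplitz operator of [F] then [1 - T / M]
    is a contraction, so [T x = e_0] has a solution [x], and [C = x_0^-1] and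
    the coefficients of [G] are read off [x].

    Flat metrics obey a comparison principle: [Q <= t P] on the circle implies
    [Q <= t P] on the disc.  Otherwise [s P - Q - e (1 + |z|^2)] would, for some
    [s > t] and [e > 0], be nonnegative without being strictly positive at an
    interior point; evaluating it along [z + h |-> v + h u] at [z + h], [z - h],
    [z + i h] and [z - i h], with [u = - P^-1 P_z v] chosen to annihilate the
    second order term of [P], contradicts this.  Uniqueness follows, and so does
    the uniform convergence of the solutions [P_n = G_n^* C_n G_n] attached to
    trigonometric polynomials [F_n] converging to a general [F].

    Parseval's identity turns [F_m <= (1 + e) F_n] into an estimate on the
    coefficients of [G_m G_n^-1], so the coefficients of [G_n] converge too, and
    the limit is [P = G^* C G = H^* H] with [H = C^(1/2) G].  All the
    constructions (Neumann series, square roots, convolutions with a kernel)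
    remain inside a given C*-algebra. *)

Require Import Defs.
From HB Require Import structures.
From mathcomp Require Import all_boot all_order all_algebra.
From mathcomp Require Import complex cyclic separable cyclotomic.
From mathcomp Require Import all_classical all_reals all_analysis.
From mathcomp Require Import ring lra zify.

Set Implicit Arguments.
Unset Strict Implicit.
Unset Printing Implicit Defensive.

Import Order.TTheory GRing.Theory Num.Theory.
Import numFieldNormedType.Exports.

Local Open Scope classical_set_scope.
Local Open Scope ring_scope.
Local Open Scope complex_scope.

(** Hence every estimate is uniform in the vector [v]: strictness means a lower bound by a positive
    multiple of [nm v ^+ 2], and compactness is invoked for the disc and the circle only. The term
    [1 + |z|^2] supplies that uniform margin.

    The Toeplitz equation is solved without a space of square summable sequences: the terms of the
    Neumann series have finite support, integrals over the circle become means over roots of unity,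
    exact for bounded degree, and infinite sums are truncated, using only that the coefficients of
    the solution tend to zero.

    The identity [F = G^H C G] determines [G] only up to an invertible constant on the left; the
    normalization [G 0 = 1] removes this freedom, so that the coefficients themselves can converge.
    Convergence of the factors is proved in the open disc only, while the metrics converge uniformly
    on the closed disc; boundary continuity of the limit comes from there. *)

Local Notation "T ^H" := (adjoint T) (at level 2, format "T ^H").

(** * Real-valued norms and inner products *)

Section RealNorm.
Context {R : realType} {V : normedModType R[i]}.
Implicit Types (u v w : V) (a b : R[i]).

(** The norm of a complex normed module has values in [R[i]]; passing to its real part moves all
    estimates into the ordered field [R], where [lra] and [nra] apply. *)
Definition nm (v : V) : R := complex.Re `|v|.

Lemma nmE v : (nm v)%:C = `|v|.
Proof. by rewrite RRe_real// normr_real. Qed.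

Lemma nm_ge0 v : 0 <= nm v.
Proof. by rewrite -lecR nmE normr_ge0. Qed.

Lemma nm0 : nm 0 = 0.
Proof. by rewrite /nm normr0. Qed.

Lemma nm_eq0 v : nm v = 0 -> v = 0.
Proof. by move=> v0; apply/eqP; rewrite -normr_eq0 -nmE v0. Qed.

Lemma nmD u v : nm (u + v) <= nm u + nm v.
Proof. by rewrite -lecR rmorphD/= !nmE ler_normD. Qed.

Lemma nmN v : nm (- v) = nm v.
Proof. by rewrite /nm normrN. Qed.

Lemma nmB u v : nm (u - v) <= nm u + nm v.
Proof. by rewrite (le_trans (nmD _ _))// nmN. Qed.

Lemma nmC u v : nm (u - v) = nm (v - u).
Proof. by rewrite -nmN opprB. Qed.

Lemma nm_tri u v w : nm (u - w) <= nm (u - v) + nm (v - w).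
Proof. by rewrite (le_trans _ (nmD _ _))// addrA subrK. Qed.

Lemma nm_sum (I : Type) (r : seq I) (Q : pred I) (F : I -> V) :
  nm (\sum_(i <- r | Q i) F i) <= \sum_(i <- r | Q i) nm (F i).
Proof.
elim/big_ind2 : _ => [|x a y b xa yb|//]; first by rewrite nm0.
by rewrite (le_trans (nmD _ _))// lerD.
Qed.

End RealNorm.

Section ComplexModulus.
Context {R : realType}.
Implicit Types (a b : R[i]) (x : R).

Definition cabs (a : R[i]) : R := complex.Re `|a|.

Lemma cabsE a : (cabs a)%:C = `|a|.
Proof. by rewrite RRe_real// normr_real. Qed.

Lemma cabs_ge0 a : 0 <= cabs a.
Proof. by rewrite -lecR cabsE normr_ge0. Qed.

Lemma cabsM a b : cabs (a * b) = cabs a * cabs b.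
Proof. by apply: complexI; rewrite rmorphM/= !cabsE normrM. Qed.

Lemma conjE a : Num.conj a = (complex.Re a +i* - complex.Im a).
Proof. by case: a. Qed.

Lemma conj_real x : Num.conj x%:C = x%:C :> R[i].
Proof. by rewrite conjE /= oppr0. Qed.

Lemma cabs1 : cabs 1 = 1.
Proof. by rewrite /cabs normr1. Qed.

Lemma cabs0 : cabs 0 = 0.
Proof. by rewrite /cabs normr0. Qed.

Lemma cabsX a n : cabs (a ^+ n) = cabs a ^+ n.
Proof. by apply: complexI; rewrite rmorphXn/= !cabsE normrX. Qed.

Lemma cabs_real x : cabs x%:C = `|x|.
Proof. by rewrite /cabs normc_def/= expr0n addr0 sqrtr_sqr. Qed.

Lemma cabs_pos x : 0 <= x -> cabs x%:C = x.
Proof. by move=> x0; rewrite cabs_real ger0_norm. Qed.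

Lemma cabsD a b : cabs (a + b) <= cabs a + cabs b.
Proof. by rewrite -lecR rmorphD/= !cabsE ler_normD. Qed.

Lemma cabsN a : cabs (- a) = cabs a.
Proof. by rewrite /cabs normrN. Qed.

Lemma cabsC a b : cabs (a - b) = cabs (b - a).
Proof. by rewrite -cabsN opprB. Qed.

Lemma cabs_conj a : cabs (Num.conj a) = cabs a.
Proof. by rewrite /cabs norm_conjC. Qed.

Lemma cabsi : cabs 'i = 1.
Proof. by rewrite /cabs normCi. Qed.

Lemma cabsV a : cabs a^-1 = (cabs a)^-1.
Proof. by apply: complexI; rewrite fmorphV/= !cabsE normfV. Qed.

Lemma nmZ {V : normedModType R[i]} a (v : V) : nm (a *: v) = cabs a * nm v.
Proof. by apply: complexI; rewrite rmorphM/= cabsE !nmE normrZ. Qed.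

Lemma nm_endo {V : normedModType R[i]} (T : endo V) : nm T = opnorm T.
Proof. by apply: complexI; rewrite nmE endo_normE. Qed.

End ComplexModulus.

Section RealInner.
Context {R : realType} {V : hilbertType R}.
Implicit Types (u v w : V) (a b : R[i]) (x y : R).

(** The real part loses nothing: [Im_inner] recovers the imaginary part as [ip u ('i *: v)]. *)
Definition ip u v : R := complex.Re (inner u v).

Lemma ipDl u v w : ip (u + v) w = ip u w + ip v w.
Proof. by rewrite /ip linearDl raddfD. Qed.

Lemma ipZl x u w : ip (x%:C *: u) w = x * ip u w.
Proof.
rewrite /ip linearZl_LR/=; case: (inner u w) => p q /=.
by rewrite mul0r subr0.
Qed.

Lemma innerC u v : inner u v = Num.conj (inner v u).
Proof. by have := @hermitian_subproof _ _ _ _ (@inner R V) u v; rewrite expr0 mul1r. Qed.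

Lemma ipC u v : ip u v = ip v u.
Proof. by rewrite /ip innerC conjE. Qed.

Lemma ipDr u v w : ip w (u + v) = ip w u + ip w v.
Proof. by rewrite ipC ipDl !(ipC w). Qed.

Lemma ipZr x u w : ip w (x%:C *: u) = x * ip w u.
Proof. by rewrite ipC ipZl ipC. Qed.

Lemma ip0l v : ip 0 v = 0.
Proof. by rewrite -(scale0r 0) (ipZl 0) mul0r. Qed.

Lemma ip0r v : ip v 0 = 0.
Proof. by rewrite ipC ip0l. Qed.

Lemma ipNl u v : ip (- u) v = - ip u v.
Proof. by apply/eqP; rewrite -addr_eq0 -ipDl addNr ip0l. Qed.

Lemma ipNr u v : ip u (- v) = - ip u v.
Proof. by rewrite ipC ipNl ipC. Qed.

Lemma ipBl u v w : ip (u - v) w = ip u w - ip v w.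
Proof. by rewrite ipDl ipNl. Qed.

Lemma ipBr u v w : ip w (u - v) = ip w u - ip w v.
Proof. by rewrite ipDr ipNr. Qed.

Lemma ipvv v : ip v v = nm v ^+ 2.
Proof. by rewrite /ip innerE -nmE -rmorphXn. Qed.

Lemma inner_conj_r a u v : inner u (a *: v) = Num.conj a * inner u v.
Proof. by rewrite linearZr_LR. Qed.

Lemma innerZl a u v : inner (a *: u) v = a * inner u v.
Proof. exact: linearZl_LR. Qed.

Lemma inner_suml (I : Type) (r : seq I) (Q : pred I) (F : I -> V) v :
  inner (\sum_(i <- r | Q i) F i) v = \sum_(i <- r | Q i) inner (F i) v.
Proof. exact: linear_sumlz. Qed.

Lemma inner_sumr (I : Type) (r : seq I) (Q : pred I) (F : I -> V) v :
  inner v (\sum_(i <- r | Q i) F i) = \sum_(i <- r | Q i) inner v (F i).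
Proof. exact: linear_sum. Qed.

Lemma ip_iZ u v : ip ('i *: u) ('i *: v) = ip u v.
Proof.
rewrite /ip linearZl_LR/= inner_conj_r mulrA.
by have := conjCi R[i]; move=> ->; rewrite mulrN -expr2 sqrCi opprK mul1r.
Qed.

Lemma Im_inner u v : complex.Im (inner u v) = ip u ('i *: v).
Proof.
rewrite /ip inner_conj_r conjCi -complexiE; case: (inner u v) => p q /=.
by rewrite mulNr /=; ring.
Qed.

Lemma ip_ext u v : (forall w, ip u w = ip v w) -> u = v.
Proof.
move=> uv; apply/eqP; rewrite -subr_eq0; apply/eqP; apply: nm_eq0; apply/eqP.
by rewrite -sqrf_eq0 -ipvv ipBl uv subrr.
Qed.

Lemma nm_sqD u v : nm (u + v) ^+ 2 = nm u ^+ 2 + 2 * ip u v + nm v ^+ 2.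
Proof. by rewrite -!ipvv ipDl !ipDr (ipC v u); ring. Qed.

Lemma nm_sqB u v : nm (u - v) ^+ 2 = nm u ^+ 2 - 2 * ip u v + nm v ^+ 2.
Proof. by rewrite nm_sqD ipNr nmN; ring. Qed.

Lemma ip_le u v : ip u v <= nm u * nm v.
Proof.
have [v0|v0] := eqVneq (nm v) 0; first by rewrite (nm_eq0 v0) ip0r nm0 mulr0.
have vp : 0 < nm v by rewrite lt_neqAle eq_sym v0 nm_ge0.
(* The square expands to [2 |u| |v| (|u| |v| - ip u v)]; the positive factor is cancelled below. *)
have := sqr_ge0 (nm ((nm v)%:C *: u - (nm u)%:C *: v)).
rewrite nm_sqB !nmZ ipZl ipZr !cabs_pos ?nm_ge0//.
have [u0|u0] := eqVneq (nm u) 0; first by move=> _; rewrite (nm_eq0 u0) ip0l nm0 mul0r.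
have up : 0 < nm u by rewrite lt_neqAle eq_sym u0 nm_ge0.
move=> h; rewrite -subr_ge0.
have : 0 <= (nm u * nm v) * (nm u * nm v - ip u v) by nra.
by rewrite pmulr_rge0// mulr_gt0.
Qed.

Lemma ip_norm_le u v : `|ip u v| <= nm u * nm v.
Proof.
rewrite ler_norml ip_le andbT lerNl -ipNl (le_trans (ip_le _ _))//.
by rewrite nmN.
Qed.

End RealInner.

(** * Convergence of operators *)

Section Topology.
Context {R : realType}.

Lemma nbhs_nmP (W : normedModType R[i]) (z : W) (A : set W) :
  nbhs z A <-> exists2 d : R, 0 < d & forall w, nm (w - z) < d -> A w.
Proof.
split=> [/nbhs_ballP[e /= e0 eA]|[d d0 dA]].
  have eE : (complex.Re e)%:C = e by rewrite RRe_real// gtr0_real.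
  exists (complex.Re e); first by rewrite -ltcR eE.
  move=> w wz; apply: eA; rewrite -ball_normE /ball_/= distrC -nmE -eE.
  by rewrite ltcR.
apply/nbhs_ballP; exists d%:C; first by rewrite /= ltcR.
by move=> w; rewrite -ball_normE /ball_/= distrC -nmE ltcR => /dA.
Qed.

Lemma cvg_nmP (T : Type) (F : set_system T) {FF : Filter F}
    (W : normedModType R[i]) (f : T -> W) (l : W) :
  f @ F --> l <-> forall e : R, 0 < e -> \forall t \near F, nm (f t - l) < e.
Proof.
split=> [fl e e0|fl A /nbhs_nmP[d d0 dA]].
  by apply: (fl [set w | nm (w - l) < e]); apply/nbhs_nmP; exists e.
by apply: filterS (fl _ d0) => t /dA.
Qed.

Lemma cvg_nmP_seq (W : normedModType R[i]) (u : nat -> W) (l : W) :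
  u @ \oo --> l <->
  forall e : R, 0 < e -> exists N, forall n, (N <= n)%N -> nm (u n - l) < e.
Proof.
rewrite cvg_nmP; split=> h e /h.
  by case=> N _ hN; exists N => n; exact: hN.
by case=> N hN; exists N.
Qed.

Definition ncauchy (W : normedModType R[i]) (u : nat -> W) :=
  forall e : R, 0 < e -> exists N, forall m n, (N <= m)%N -> (N <= n)%N ->
    nm (u m - u n) < e.

Lemma ncauchy_cvg (W : completeNormedModType R[i]) (u : nat -> W) :
  ncauchy u -> exists l : W, u @ \oo --> l.
Proof.
move=> uc; suff /cvg_ex : cvg (u @ \oo : set_system W) by [].
apply: cauchy_cvg; apply: cauchy_exP => e /= e0.
have eE : (complex.Re e)%:C = e by rewrite RRe_real// gtr0_real.
have [|N hN] := uc (complex.Re e); first by rewrite -ltcR eE.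
exists (u N); suff : \forall n \near \oo, ball (u N) e (u n) by [].
exists N => // n /= Nn; rewrite -ball_normE /ball_/= -nmE -eE ltcR.
exact: hN.
Qed.

Lemma cvg_unique_seq (W : normedModType R[i]) (u : nat -> W) (l m : W) :
  u @ \oo --> l -> u @ \oo --> m -> l = m.
Proof. exact: cvg_unique. Qed.

Lemma cvg_nm (D : Type) (F : set_system D) {FF : Filter F}
    (W : normedModType R[i]) (u : D -> W) (l : W) :
  u @ F --> l -> nm (u n - l) @[n --> F] --> (0 : R).
Proof.
move=> /cvg_nmP ul; apply/cvgrPdist_lt => e e0; near=> n.
rewrite sub0r normrN ger0_norm ?nm_ge0//.
by near: n; exact: ul.
Unshelve. all: by end_near. Qed.

Lemma cvg_nm_le (D : Type) (F : set_system D) {FF : Filter F}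
    (W : normedModType R[i]) (u : D -> W) (l : W) (a : D -> R) :
  (\forall n \near F, nm (u n - l) <= a n) -> a @ F --> (0 : R) ->
  u @ F --> l.
Proof.
move=> ua /cvgrPdist_lt a0; apply/cvg_nmP => e e0; near=> n.
have := near (a0 _ e0) n; rewrite sub0r normrN => h.
apply: le_lt_trans (near ua n _) _ => //.
by apply: le_lt_trans (ler_norm _) (h _).
Unshelve. all: by end_near. Qed.

Lemma cvg_nm_bound (W : normedModType R[i]) (u : nat -> W) (l : W) (M : R) :
  u @ \oo --> l -> (\forall n \near \oo, nm (u n) <= M) -> nm l <= M.
Proof.
move=> ul uM; apply/ler_addgt0Pl => e e0.
near \oo => n.
have -> : l = u n - (u n - l) by rewrite opprB addrC subrK.
rewrite (le_trans (nmB _ _))// addrC lerD//; last by near: n.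
by apply/ltW; near: n; move/cvg_nmP : ul; exact.
Unshelve. all: by end_near. Qed.

End Topology.

Section EndoNorm.
Context {R : realType} {V : normedModType R[i]}.
Implicit Types S T : endo V.

Lemma nm_app T v : nm (T v) <= nm T * nm v.
Proof. by rewrite nm_endo -lecR rmorphM/= !nmE le_opnorm. Qed.

Lemma nm_endo_le T (M : R) :
  0 <= M -> (forall v, nm (T v) <= M * nm v) -> nm T <= M.
Proof.
move=> M0 h; rewrite nm_endo opnorm_le// => v.
by rewrite -!nmE -rmorphM lecR.
Qed.

Lemma nmM S T : nm (S * T) <= nm S * nm T.
Proof.
apply: nm_endo_le => [|v]; first by rewrite mulr_ge0 ?nm_ge0.
rewrite endo_mulE (le_trans (nm_app _ _))// -mulrA ler_wpM2l ?nm_ge0//.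
exact: nm_app.
Qed.

Lemma nm_endo1 : nm (1 : endo V) <= 1.
Proof. by apply: nm_endo_le => // v; rewrite mul1r. Qed.

Lemma nm_endoX T n : nm (T ^+ n) <= nm T ^+ n.
Proof.
elim: n => [|n ih]; first by rewrite !expr0 nm_endo1.
by rewrite !exprS (le_trans (nmM _ _))// ler_wpM2l ?nm_ge0.
Qed.

Lemma endoD T u v : T (u + v) = T u + T v.
Proof. exact: linearD. Qed.

Lemma endoZ T a v : T (a *: v) = a *: T v.
Proof. exact: linearZ. Qed.

Lemma endoB T u v : T (u - v) = T u - T v.
Proof. exact: linearB. Qed.

Lemma endo_sum T (I : Type) (r : seq I) (Q : pred I) (F : I -> V) :
  T (\sum_(i <- r | Q i) F i) = \sum_(i <- r | Q i) T (F i).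
Proof. exact: linear_sum. Qed.

Lemma endo_subE S T v : (S - T) v = S v - T v.
Proof. by []. Qed.

Lemma endo_oppE T v : (- T) v = - T v.
Proof. by []. Qed.

Lemma endo_sumE (I : Type) (r : seq I) (Q : pred I) (F : I -> endo V) v :
  (\sum_(i <- r | Q i) F i) v = \sum_(i <- r | Q i) F i v.
Proof. by apply: (big_morph (fun T : endo V => T v)). Qed.

Lemma endoZl a S T : (a *: S) * T = a *: (S * T).
Proof. exact: endo_ext. Qed.

Lemma endoZr a S T : S * (a *: T) = a *: (S * T).
Proof. by apply: endo_ext => v; rewrite endo_mulE !endo_scaleE linearZ. Qed.

Lemma cvg_endo_app (u : nat -> endo V) T v :
  u @ \oo --> T -> u n v @[n --> \oo] --> T v.
Proof.
move=> uT; apply: (@cvg_nm_le _ _ _ _ _ _ _ (fun n => nm (u n - T) * nm v)).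
  by apply: nearW => n; rewrite -endo_subE nm_app.
by rewrite -(mul0r (nm v)); apply: cvgM; [exact: cvg_nm|exact: cvg_cst].
Qed.

Lemma cvg_nm_bounded (D : Type) (F : set_system D) {FF : Filter F}
    (W : normedModType R[i]) (u : D -> W) (l : W) :
  u @ F --> l -> \forall n \near F, nm (u n) <= nm l + 1.
Proof.
move=> /cvg_nmP/(_ 1 ltr01); apply: filterS => n h.
have -> : u n = l + (u n - l) by rewrite addrC subrK.
by rewrite (le_trans (nmD _ _))// lerD2l ltW.
Qed.

Lemma cvg_endoM (D : Type) (F : set_system D) {FF : Filter F}
    (u v : D -> endo V) S T :
  u @ F --> S -> v @ F --> T -> u n * v n @[n --> F] --> S * T.
Proof.
move=> uS vT.
apply: (@cvg_nm_le _ _ _ _ _ _ _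
  (fun n => (nm S + 1) * nm (v n - T) + nm (u n - S) * nm T)).
  apply: filterS (cvg_nm_bounded uS) => n un.
  have -> : u n * v n - S * T = u n * (v n - T) + (u n - S) * T.
    by rewrite mulrBr mulrBl addrA subrK.
  rewrite (le_trans (nmD _ _))// lerD// (le_trans (nmM _ _))//.
  by rewrite ler_wpM2r ?nm_ge0.
rewrite -[X in _ --> X](_ : (nm S + 1) * 0 + 0 * nm T = 0); last by ring.
by apply: cvgD; apply: cvgM; (exact: cvg_cst || exact: cvg_nm).
Qed.

Lemma bounded_endo (f : V -> V) (M : R) :
  linear f -> (forall v, nm (f v) <= M * nm v) -> exists T : endo V, T =1 f.
Proof.
move=> flin fM.
have fc : continuous f.
  pose fl : {linear V -> V} := HB.pack f (GRing.isLinear.Build _ _ _ _ f flin).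
  apply: (@bounded_linear_continuous _ _ _ fl).
  apply/linear_boundedP; near=> r => v.
  rewrite -nmE (@le_trans _ _ (`|M|%:C * (nm v)%:C))//; last first.
    rewrite nmE ler_wpM2r//; near: r; apply: nbhs_pinfty_ge.
    by rewrite realE lecR normr_ge0.
  rewrite -rmorphM lecR (le_trans (fM _))// ler_wpM2r ?nm_ge0//.
  exact: ler_norm.
have fP : f \in @continuous_linear R V by rewrite unfold_in; apply/asboolP; split.
by exists (Endo fP).
Unshelve. all: by end_near. Qed.

End EndoNorm.

Section EndoComplete.
Context {R : realType} {V : completeNormedModType R[i]}.

(** The pointwise limit is linear and bounded, and the Cauchy estimate, being proportional to
    [nm v], survives the limit; this upgrades pointwise convergence to convergence in norm. *)
Lemma endo_complete (u : nat -> endo V) :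
  ncauchy u -> exists T : endo V, u @ \oo --> T.
Proof.
move=> uc.
have uv v : exists w : V, u n v @[n --> \oo] --> w.
  apply: ncauchy_cvg => e e0.
  have [|N hN] := uc (e / (nm v + 1)).
    by rewrite divr_gt0// ltr_wpDl ?nm_ge0.
  exists N => m n Nm Nn; rewrite -endo_subE (le_lt_trans (nm_app _ _))//.
  have v1 : 0 < nm v + 1 by rewrite ltr_wpDl ?nm_ge0.
  have := hN _ _ Nm Nn; rewrite ltr_pdivlMr// => h.
  by rewrite (le_lt_trans _ h)// ler_wpM2l ?nm_ge0// lerDl.
have [f fP] := choice uv.
have flin : linear f.
  move=> a x y.
  have h : (fun n => u n (a *: x + y)) @ \oo --> a *: f x + f y.
    have -> : (fun n => u n (a *: x + y)) = (fun n => a *: u n x + u n y).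
      by apply/funext => n; rewrite linearP.
    by apply: cvgD => //; apply: cvgZr.
  exact: cvg_unique_seq (fP _) h.
have [N0 hN0] := uc 1 ltr01.
have fb e N : 0 <= e ->
    (forall m n, (N <= m)%N -> (N <= n)%N -> nm (u m - u n) <= e) ->
    forall v n, (N <= n)%N -> nm (f v - u n v) <= e * nm v.
  move=> e0 hN v n Nn; apply: (@cvg_nm_bound _ _ (fun m => u m v - u n v)).
    by apply: cvgB => //; exact: cvg_cst.
  exists N => // m /= Nm; rewrite -endo_subE (le_trans (nm_app _ _))//.
  by rewrite ler_wpM2r ?nm_ge0// hN.
have [|T TE] := @bounded_endo _ _ f (1 + nm (u N0)) flin.
  move=> v; have -> : f v = (f v - u N0 v) + u N0 v by rewrite subrK.
  rewrite (le_trans (nmD _ _))// mulrDl lerD ?nm_app//.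
  by apply: (fb _ N0) => // m n Nm Nn; exact/ltW/hN0.
exists T; apply/cvg_nmP_seq => e e0.
have e20 : 0 < e / 2 by rewrite divr_gt0.
have [N hN] := uc _ e20; exists N => n Nn.
apply: (@le_lt_trans _ _ (e / 2)); last by rewrite ltr_pdivrMr// ltr_pMr ?ltr1n.
apply: nm_endo_le => [|v]; first exact: ltW.
have -> : (u n - T) v = - (f v - u n v) by rewrite endo_subE TE opprB.
rewrite nmN; apply: (fb _ N) => // [|m k Nm Nk]; first exact: ltW.
exact/ltW/hN.
Qed.

End EndoComplete.

(** * Adjoints *)

Section Sequences.
Context {R : realType}.

Lemma expr_lt_cvg0 (q C : R) : 0 <= q < 1 -> C * q ^+ n @[n --> \oo] --> (0 : R).
Proof.
move=> /andP[q0 q1]; rewrite -(mulr0 C); apply: cvgM; first exact: cvg_cst.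
by apply: cvg_expr; rewrite ger0_norm.
Qed.

Lemma geometric_ncauchy (W : normedModType R[i]) (u : nat -> W) (q C : R) :
  0 <= q < 1 -> (forall n, nm (u n.+1 - u n) <= C * q ^+ n) ->
  (forall m n, nm (u (n + m)%N - u n) <= C / (1 - q) * q ^+ n) /\ ncauchy u.
Proof.
move=> q01 hu; have /andP[q0 q1] := q01.
have C0 : 0 <= C by have := le_trans (nm_ge0 _) (hu 0%N); rewrite expr0 mulr1.
have q10 : 0 < 1 - q by rewrite subr_gt0.
(* Keeping the exact partial geometric sum, with its factor [1 - q ^+ m], is what lets the induction
   close. *)
have h m n : nm (u (n + m)%N - u n) <= C / (1 - q) * q ^+ n * (1 - q ^+ m).
  elim: m => [|m ih]; first by rewrite addn0 !subrr nm0 mulr0.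
  rewrite addnS; apply: le_trans (nm_tri _ (u (n + m)%N) _) _.
  apply: le_trans (lerD (hu _) ih) _; rewrite exprD exprS.
  suff -> : C * (q ^+ n * q ^+ m) + C / (1 - q) * q ^+ n * (1 - q ^+ m)
    = C / (1 - q) * q ^+ n * (1 - q * q ^+ m) by [].
  by field; rewrite gt_eqF.
have h' m n : nm (u (n + m)%N - u n) <= C / (1 - q) * q ^+ n.
  apply: le_trans (h _ _) _; rewrite ler_piMr//.
    by rewrite !mulr_ge0 ?invr_ge0 ?exprn_ge0// ltW.
  by rewrite lerBlDr lerDl exprn_ge0.
split=> // e e0.
have /cvgrPdist_lt/(_ _ e0)[N _ hN] := expr_lt_cvg0 (C / (1 - q)) q01.
have hN2 n : (N <= n)%N -> C / (1 - q) * q ^+ n < e.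
  move=> /hN; rewrite /= sub0r normrN; exact: le_lt_trans (ler_norm _).
exists N => m n Nm Nn.
case: (leqP m n) => [mn|/ltnW nm'].
  by rewrite nmC -(subnKC mn) (le_lt_trans (h' _ _))// hN2.
by rewrite -(subnKC nm') (le_lt_trans (h' _ _))// hN2.
Qed.

End Sequences.

Section Adjoint.
Context {R : realType} {V : hilbertType R}.
Implicit Types (S T : endo V) (u v w : V).

Lemma ip_conj (a : R[i]) u v : ip u (a *: v) = ip (Num.conj a *: u) v.
Proof. by rewrite /ip inner_conj_r linearZl_LR. Qed.

Lemma cvg_ipl (x : nat -> V) u v :
  x @ \oo --> u -> ip (x n) v @[n --> \oo] --> ip u v.
Proof.
move=> /cvg_nm xu; apply/cvgrPdist_le => e e0.
have e1 : 0 < e / (nm v + 1) by rewrite divr_gt0// ltr_wpDl ?nm_ge0.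
move/cvgrPdist_lt : xu => /(_ _ e1); apply: filterS => n.
rewrite sub0r normrN ger0_norm ?nm_ge0// => h.
rewrite -ipBl (le_trans (ip_norm_le _ _))// nmC.
have v1 : 0 < nm v + 1 by rewrite ltr_wpDl ?nm_ge0.
have v2 := nm_ge0 v; move: h; rewrite ltr_pdivlMr// => /ltW; apply: le_trans.
by rewrite ler_wpM2l ?nm_ge0// lerDl.
Qed.

Lemma cvg_ipr (x : nat -> V) u v :
  x @ \oo --> u -> ip v (x n) @[n --> \oo] --> ip v u.
Proof.
move=> xu; rewrite ipC (_ : (fun n => _) = fun n => ip (x n) v).
  exact: cvg_ipl.
by apply/funext => n; rewrite ipC.
Qed.

(* The representing vector minimises [w |-> |w|^2 - 2 <T w, v>]. *)
Lemma riesz T v : exists w, forall u, ip (T u) v = ip u w.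
Proof.
pose J w := nm w ^+ 2 - 2 * ip (T w) v.
pose K := nm T * nm v.
have K0 : 0 <= K by rewrite mulr_ge0 ?nm_ge0.
have JK w : - K ^+ 2 <= J w.
  have : ip (T w) v <= nm w * K.
    rewrite (le_trans (ip_le _ _))// mulrA (mulrC (nm w)) ler_wpM2r ?nm_ge0//.
    exact: nm_app.
  by rewrite /J; have := sqr_ge0 (nm w - K); nra.
have Jinf : has_inf (range J).
  by split; [exists (J 0), 0|exists (- K ^+ 2) => _ [w _ <-]].
pose m := inf (range J).
have mJ w : m <= J w by apply: (ge_inf Jinf.2); exists w.
have /choice[x xP] n : exists w, J w < m + n.+1%:R^-1.
  have n0 : (0 : R) < n.+1%:R^-1 by rewrite invr_gt0.
  by have [_ [w _ <-] h] := inf_adherent n0 Jinf; exists w.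
(* Parallelogram law at the midpoint of [a] and [b]: almost minimizers are close to each other, so a
   minimizing sequence is Cauchy. *)
have Jpar a b : nm (a - b) ^+ 2 <= 2 * (J a + J b - 2 * m).
  have := mJ ((2^-1)%:C *: (a + b)); rewrite /J endoZ endoD ipZl ipDl.
  rewrite nmZ cabs_pos// exprMn nm_sqD => h.
  rewrite nm_sqB; move: h; set A := nm a ^+ 2; set B := nm b ^+ 2; lra.
have Jt w u t : J (w + t%:C *: u) =
    J w + 2 * t * (ip u w - ip (T u) v) + t ^+ 2 * nm u ^+ 2.
  rewrite /J endoD endoZ ipDl ipZl nm_sqD ipZr nmZ (ipC w) exprMn.
  by rewrite cabs_real real_normK ?num_real//; ring.
have xc : ncauchy x.
  move=> e e0.
  have e20 : 0 < e ^+ 2 / 4 by rewrite divr_gt0 ?exprn_gt0.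
  have /cvgrPdist_lt/(_ _ e20)[N _ hN] := @cvg_harmonic R.
  exists N => p q Np Nq; rewrite -(@ltr_pXn2r _ 2%N) ?nnegrE ?nm_ge0 ?(ltW e0)//.
  rewrite (le_lt_trans (Jpar _ _))//.
  have := hN _ Np; have := hN _ Nq; rewrite /= !sub0r !normrN.
  rewrite !ger0_norm ?invr_ge0// /harmonic/=.
  have := xP p; have := xP q.
  by move: (p.+1%:R^-1) (q.+1%:R^-1) (J _) (J _) => A B C D; lra.
have [w xw] := ncauchy_cvg xc.
exists w => u; apply/eqP; rewrite eq_sym -subr_eq0 -sqrf_eq0 eq_le sqr_ge0 andbT.
have L0 : 0 < nm u ^+ 2 + 1 by rewrite ltr_wpDl ?sqr_ge0.
have dn n : (ip u (x n) - ip (T u) v) ^+ 2 <= (nm u ^+ 2 + 1) * n.+1%:R^-1.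
  set d := ip u (x n) - ip (T u) v; set L := nm u ^+ 2 + 1.
  (* Nearly optimal step along [u]: it lowers [J] by at least [d ^+ 2 / L], which cannot exceed the
     gap [n.+1%:R^-1] to the infimum. The summand 1 in [L] covers [u = 0]. *)
  have := mJ (x n + (- d / L)%:C *: u); rewrite Jt -/d => h.
  have := xP n => hn; rewrite mulrC -ler_pdivrMr//.
  have -> : d ^+ 2 / L = - (2 * (- d / L) * d + (- d / L) ^+ 2 * L).
    by field; rewrite gt_eqF.
  have : 0 <= (- d / L) ^+ 2 by exact: sqr_ge0.
  by move: h hn; rewrite /L; move: (- d / L) n.+1%:R^-1 (J _) => t A B; lra.
have l1 : (ip u (x n) - ip (T u) v) ^+ 2 @[n --> \oo] -->
    (ip u w - ip (T u) v) ^+ 2.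
  have h : (ip u (x n) - ip (T u) v) @[n --> \oo] --> (ip u w - ip (T u) v).
    by apply: cvgB; [exact: cvg_ipr|exact: cvg_cst].
  by rewrite expr2; under eq_fun do rewrite expr2; exact: cvgM.
have l2 : (nm u ^+ 2 + 1) * n.+1%:R^-1 @[n --> \oo] --> (0 : R).
  rewrite -(mulr0 (nm u ^+ 2 + 1)); apply: cvgM; first exact: cvg_cst.
  exact: cvg_harmonic.
by apply: ler_cvg_to l1 l2 _; apply: nearW.
Qed.

Lemma adjoint_exists T : exists S : endo V, forall u v, ip (T u) v = ip u (S v).
Proof.
have [f fP] := choice (riesz T).
have flin : linear f.
  move=> a x y; apply: ip_ext => w.
  by rewrite [LHS]ipC [RHS]ipC -fP !ipDr !ip_conj -endoZ !fP.
have [|S SE] := @bounded_endo _ _ f (nm T) flin.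
  move=> v; have [->|fv0] := eqVneq (nm (f v)) 0.
    by rewrite mulr_ge0 ?nm_ge0.
  have fvp : 0 < nm (f v) by rewrite lt_neqAle eq_sym fv0 nm_ge0.
  rewrite -(ler_pM2l fvp) -expr2 -ipvv -fP (le_trans (ip_le _ _))//.
  rewrite mulrA ler_wpM2r ?nm_ge0// mulrC; exact: nm_app.
by exists S => u v; rewrite SE fP.
Qed.

(** Applying the real identity to ['i *: v] gives the imaginary parts. *)
Lemma ip_inner T S : (forall u v, ip (T u) v = ip u (S v)) ->
  forall u v, inner (T u) v = inner u (S v).
Proof.
move=> h u v; apply/eqP; rewrite eq_complex.
have := h u v; rewrite /ip => ->; rewrite eqxx/= !Im_inner h endoZ.
exact: eqxx.
Qed.

Lemma adjP T u v : ip (T u) v = ip u (T^H v).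
Proof.
have [S SP] := adjoint_exists T.
have := @getPex _ [set S : endo V | forall u v, inner (T u) v = inner u (S v)].
move=> /(_ (ex_intro _ S (ip_inner SP))) /(_ u v).
by rewrite /ip /adjoint => ->.
Qed.

Lemma adjE T S : (forall u v, ip (T u) v = ip u (S v)) -> T^H = S.
Proof.
move=> h; apply: endo_ext => v; apply: ip_ext => w.
by rewrite ipC -adjP h ipC.
Qed.

Lemma adjPr T u v : ip u (T v) = ip (T^H u) v.
Proof. by rewrite ipC adjP ipC. Qed.

Lemma adjK T : T^H^H = T.
Proof. by apply: adjE => u v; rewrite adjPr. Qed.

Lemma adjD S T : (S + T)^H = S^H + T^H.
Proof. by apply: adjE => u v; rewrite ipDl ipDr !adjP. Qed.

Lemma adj0 : (0 : endo V)^H = 0.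
Proof. by apply: adjE => u v; rewrite ip0l ip0r. Qed.

Lemma adj1 : (1 : endo V)^H = 1.
Proof. exact: adjE. Qed.

Lemma adjN T : (- T)^H = - T^H.
Proof. by apply: adjE => u v; rewrite ipNl ipNr adjP. Qed.

Lemma adjB S T : (S - T)^H = S^H - T^H.
Proof. by rewrite adjD adjN. Qed.

Lemma adjZ (a : R[i]) T : (a *: T)^H = Num.conj a *: T^H.
Proof.
apply: adjE => u v; rewrite !endo_scaleE ip_conj conjCK -adjP.
by rewrite endoZ.
Qed.

Lemma adjM S T : (S * T)^H = T^H * S^H.
Proof. by apply: adjE => u v; rewrite !endo_mulE !adjP. Qed.

Lemma adj_sum (I : Type) (r : seq I) (Q : pred I) (F : I -> endo V) :
  (\sum_(i <- r | Q i) F i)^H = \sum_(i <- r | Q i) (F i)^H.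
Proof. by apply: (big_morph (@adjoint R V)) => [? ?|]; rewrite ?adjD ?adj0. Qed.

Lemma nm_adj_le T : nm T^H <= nm T.
Proof.
apply: nm_endo_le => [|v]; first exact: nm_ge0.
have [->|fv0] := eqVneq (nm (T^H v)) 0; first by rewrite mulr_ge0 ?nm_ge0.
have fvp : 0 < nm (T^H v) by rewrite lt_neqAle eq_sym fv0 nm_ge0.
rewrite -(ler_pM2l fvp) -expr2 -ipvv -adjP (le_trans (ip_le _ _))//.
rewrite mulrA ler_wpM2r ?nm_ge0// mulrC; exact: nm_app.
Qed.

Lemma nm_adj T : nm T^H = nm T.
Proof. by apply/le_anti; rewrite nm_adj_le -{1}(adjK T) nm_adj_le. Qed.

Lemma cvg_adj (D : Type) (F : set_system D) {FF : Filter F} (u : D -> endo V) T :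
  u @ F --> T -> (u n)^H @[n --> F] --> T^H.
Proof.
move=> /cvg_nm uT; apply: (cvg_nm_le _ uT).
by apply: nearW => n; rewrite -adjB nm_adj.
Qed.

End Adjoint.

(** * Subalgebras, inverses and positive operators *)

Section Subalgebra.
Context {R : realType} {V : hilbertType R}.
Variable A : set (endo V).
Hypothesis AP : unital_Cstar_subalgebra A.
Implicit Types S T : endo V.

Lemma salg1 : A 1. Proof. by case: AP. Qed.

Lemma salg0 : A 0.
Proof.
case: AP => A1 AL _ _ _; rewrite -[X in A X](subrr 1) -scaleN1r addrC.
exact: AL.
Qed.

Lemma salgD S T : A S -> A T -> A (S + T).
Proof. by move=> AS AT; rewrite -(scale1r S); case: AP => _ AL _ _ _; exact: AL. Qed.

Lemma salgZ a T : A T -> A (a *: T).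
Proof.
move=> AT; rewrite -[_ *: _]addr0; case: AP => _ AL _ _ _; apply: AL => //.
exact: salg0.
Qed.

Lemma salgN T : A T -> A (- T).
Proof. by move=> AT; rewrite -scaleN1r; exact: salgZ. Qed.

Lemma salgB S T : A S -> A T -> A (S - T).
Proof. by move=> AS AT; apply: salgD => //; exact: salgN. Qed.

Lemma salgM S T : A S -> A T -> A (S * T).
Proof. by case: AP => _ _ AM _ _; exact: AM. Qed.

Lemma salg_adj T : A T -> A T^H.
Proof. by case: AP => _ _ _ AA _; exact: AA. Qed.

Lemma salg_sum (I : Type) (r : seq I) (Q : pred I) (F : I -> endo V) :
  (forall i, Q i -> A (F i)) -> A (\sum_(i <- r | Q i) F i).
Proof.
by move=> AF; elim/big_ind : _ => //; [exact: salg0|exact: salgD].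
Qed.

Lemma salg_lim (u : nat -> endo V) T :
  u @ \oo --> T -> (forall n, A (u n)) -> A T.
Proof.
case: AP => _ _ _ _ Acl uT Au.
by apply: (@closed_cvg _ _ _ _ u A Acl _ T uT); exact: nearW.
Qed.

End Subalgebra.

Section Inverse.
Context {R : realType} {V : hilbertType R}.
Implicit Types S T E : endo V.

Lemma inverseP T : invertible T -> inverse T * T = 1 /\ T * inverse T = 1.
Proof. by move=> /getPex. Qed.

Lemma inverse_uniq S T : S * T = 1 -> T * S = 1 -> inverse T = S.
Proof.
move=> ST TS; have [iT _] : inverse T * T = 1 /\ T * inverse T = 1.
  by apply: inverseP; exists S.
by rewrite -[LHS]mulr1 -TS mulrA iT mul1r.
Qed.

Lemma invertible_lr S S' T : S * T = 1 -> T * S' = 1 -> invertible T.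
Proof.
move=> ST TS; exists S; split=> //.
by have -> : S = S' by rewrite -[S]mulr1 -TS mulrA ST mul1r.
Qed.

Lemma invertibleM S T : invertible S -> invertible T -> invertible (S * T).
Proof.
move=> [S' [SS1 SS2]] [T' [TT1 TT2]]; exists (T' * S'); split.
  by rewrite mulrA -(mulrA T') SS1 mulr1 TT1.
by rewrite mulrA -(mulrA S) TT2 mulr1 SS2.
Qed.

(** The inverse is the norm limit of sums of powers of [E], so a closed subalgebra containing [E]
    contains it. Here and below the clause over [A] comes after the witness, so that one witness
    serves every subalgebra. *)
Lemma neumann E (q : R) : nm E <= q -> q < 1 ->
  exists L : endo V, [/\ L * (1 - E) = 1, (1 - E) * L = 1
    & forall A, unital_Cstar_subalgebra A -> A E -> A L].
Proof.
move=> Eq q1; have q0 : 0 <= q := le_trans (nm_ge0 _) Eq.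
have q01 : 0 <= q < 1 by rewrite q0.
pose u n := \sum_(k < n) E ^+ k.
have nE n : nm (E ^+ n) <= 1 * q ^+ n.
  by rewrite mul1r (le_trans (nm_endoX _ _))// lerXn2r ?nnegrE ?nm_ge0.
have uS n : nm (u n.+1 - u n) <= 1 * q ^+ n.
  by rewrite /u big_ord_recr/= addrAC subrr add0r.
have [_ /endo_complete[L uL]] := geometric_ncauchy q01 uS.
have E0 : E ^+ n @[n --> \oo] --> (0 : endo V).
  apply: (cvg_nm_le _ (expr_lt_cvg0 1 q01)); apply: nearW => n.
  by rewrite subr0.
have uE n : u n * (1 - E) = 1 - E ^+ n.
  elim: n => [|n ih]; first by rewrite /u big_ord0 mul0r expr0 subrr.
  rewrite /u big_ord_recr/= mulrDl -/(u n) ih mulrBr mulr1 -exprSr.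
  by rewrite addrA subrK.
have Eu n : (1 - E) * u n = 1 - E ^+ n.
  elim: n => [|n ih]; first by rewrite /u big_ord0 mulr0 expr0 subrr.
  rewrite /u big_ord_recr/= mulrDr -/(u n) ih mulrBl mul1r -exprS.
  by rewrite addrA subrK.
have l1 : 1 - E ^+ n @[n --> \oo] --> (1 - 0 : endo V).
  by apply: cvgB => //; exact: cvg_cst.
rewrite subr0 in l1.
exists L; split.
- apply: cvg_unique_seq l1; rewrite -(funext uE).
  by apply: cvg_endoM => //; exact: cvg_cst.
- apply: cvg_unique_seq l1; rewrite -(funext Eu).
  by apply: cvg_endoM => //; exact: cvg_cst.
- move=> A AP AE; apply: (salg_lim AP uL) => n; apply: (salg_sum AP) => k _.
  elim: (val k) => [|m ih]; first by rewrite expr0; exact: salg1.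
  by rewrite exprS; exact: salgM.
Qed.

End Inverse.

(** * Quadratic forms, positive definite operators and their square roots *)

Section Positive.
Context {R : realType} {V : hilbertType R}.
Implicit Types (S T C : endo V) (u v : V) (c q : R).

Definition qf T v : R := ip (T v) v.

Definition bounded_below c T := forall v, c * nm v ^+ 2 <= qf T v.

(** The constant [c] is uniform in [v]; pointwise strict positivity would not imply invertibility in
    infinite dimensions. [posdefP] matches this with [positive_invertible]. *)
Definition posdef T := T^H = T /\ exists2 c : R, 0 < c & bounded_below c T.

Lemma qfD S T v : qf (S + T) v = qf S v + qf T v.
Proof. by rewrite /qf ipDl. Qed.

Lemma qfN T v : qf (- T) v = - qf T v.
Proof. by rewrite /qf ipNl. Qed.

Lemma qfB S T v : qf (S - T) v = qf S v - qf T v.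
Proof. by rewrite qfD qfN. Qed.

Lemma qfZ c T v : qf (c%:C *: T) v = c * qf T v.
Proof. by rewrite /qf endo_scaleE ipZl. Qed.

Lemma qf1 v : qf 1 v = nm v ^+ 2.
Proof. exact: ipvv. Qed.

Lemma qf_conj S T v : qf (S^H * T * S) v = qf T (S v).
Proof. by rewrite /qf -mulrA endo_mulE ipC -adjP ipC. Qed.

Lemma qf_norm_le T v : `|qf T v| <= nm T * nm v ^+ 2.
Proof.
rewrite (le_trans (ip_norm_le _ _))// expr2 mulrA ler_wpM2r ?nm_ge0//.
exact: nm_app.
Qed.

Lemma qf_le T v : qf T v <= nm T * nm v ^+ 2.
Proof. exact: le_trans (ler_norm _) (qf_norm_le _ _). Qed.

Lemma cvg_qf (u : nat -> endo V) T v :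
  u @ \oo --> T -> qf (u n) v @[n --> \oo] --> qf T v.
Proof. by move=> uT; apply: cvg_ipl; exact: cvg_endo_app. Qed.

Lemma inner_real T v : T^H = T -> inner (T v) v = (qf T v)%:C.
Proof.
move=> TT; apply/eqP; rewrite eq_complex; apply/andP; split; first exact: eqxx.
apply/eqP; rewrite Im_inner /=.
have iv : ip (T v) ('i *: v) = - ip (T v) ('i *: v).
  rewrite -{2}(ip_iZ (T v)) scalerA -expr2 sqrCi scaleN1r ipNr opprK.
  by rewrite -endoZ adjP TT ipC.
lra.
Qed.

Lemma qf_ext S T : S^H = S -> T^H = T -> (forall v, qf S v = qf T v) -> S = T.
Proof.
move=> SS TT ST; apply/eqP; rewrite -subr_eq0; apply/eqP.
pose D := S - T; have DD : D^H = D by rewrite adjB SS TT.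
have D0 v : qf D v = 0 by rewrite qfB ST subrr.
apply: endo_ext => u; apply: ip_ext => v; rewrite ip0l.
have := D0 (u + v); rewrite /qf endoD ipDl !ipDr.
have := D0 u; have := D0 v; rewrite /qf => -> ->.
have -> : ip (D v) u = ip (D u) v by rewrite adjP DD ipC.
move=> h.
suff : ip (D u) v = 0 by [].
lra.
Qed.

(* The Cauchy-Schwarz inequality for the form of [T], in additive shape. *)
Lemma form_le T u v c : T^H = T -> (forall v, 0 <= qf T v) -> 0 < c ->
  2 * ip (T u) v <= c * qf T u + qf T v / c.
Proof.
move=> TT T0 c0; have := T0 (c%:C *: u - v).
rewrite /qf endoB endoZ ipBl !ipBr !ipZl !ipZr.
have -> : ip (T v) u = ip (T u) v by rewrite adjP TT ipC.
set a := ip (T u) u; set b := ip (T v) v; set d := ip (T u) v => h.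
have -> : c * a + b / c = (c ^+ 2 * a + b) / c by field; rewrite gt_eqF.
rewrite ler_pdivlMr//; nra.
Qed.

(** Cauchy-Schwarz for the form of [T] at the pair [v], [T v] with weight [q]; the bound
    [qf T (T v) <= q |T v|^2] absorbs half of the left side. *)
Lemma nm_app_le T q v : T^H = T -> (forall v, 0 <= qf T v) ->
  (forall v, qf T v <= q * nm v ^+ 2) -> 0 < q ->
  nm (T v) ^+ 2 <= q * qf T v.
Proof.
move=> TT T0 Tq q0; have := form_le v (T v) TT T0 q0.
rewrite ipvv => h; have := Tq (T v); rewrite -ler_pdivrMl// mulrC => h2.
by lra.
Qed.

Lemma nm_pos_le T q : T^H = T -> (forall v, 0 <= qf T v) ->
  (forall v, qf T v <= q * nm v ^+ 2) -> 0 <= q -> nm T <= q.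
Proof.
(* [nm_app_le] divides by its constant, while [q] may be 0 here. *)
move=> TT T0 Tq q0; apply/ler_addgt0Pl => e e0.
have e1 : 0 < e + q by rewrite ltr_pwDl.
have Te v : qf T v <= (e + q) * nm v ^+ 2.
  by rewrite (le_trans (Tq v))// ler_wpM2r ?sqr_ge0// lerDr ltW.
have e2 := ltW e1; apply: nm_endo_le => [//|v].
rewrite -(@ler_pXn2r _ 2%N) ?nnegrE ?mulr_ge0 ?nm_ge0//.
rewrite (le_trans (nm_app_le v TT T0 Te e1))// exprMn expr2 -mulrA.
by rewrite ler_wpM2l.
Qed.

Lemma posdef_gt0 C v : posdef C -> 0 <= qf C v.
Proof.
move=> [_ [c c0 cC]]; rewrite (le_trans _ (cC v))// mulr_ge0 ?sqr_ge0//.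
exact: ltW.
Qed.

(* [C / M = 1 - E] with [|E| <= 1 - c / M] for [M > |C|]. *)
Lemma posdef_contraction C c : C^H = C -> 0 < c -> bounded_below c C ->
  exists (M : R) (E : endo V) (q : R), [/\ 0 < M, C = M%:C *: (1 - E), E^H = E, 0 <= q < 1 & nm E <= q] /\
    forall A, unital_Cstar_subalgebra A -> A C -> A E.
Proof.
move=> CC c0 cC; pose M := nm C + c.
have M0 : 0 < M by rewrite ltr_wpDl ?nm_ge0.
pose E := 1 - M^-1%:C *: C.
have EH : E^H = E by rewrite adjB adj1 adjZ CC conj_real.
have cM1 : c / M <= 1 by rewrite ler_pdivrMr// mul1r /M lerDr nm_ge0.
exists M, E, (1 - c / M); split; [split=> //|].
- rewrite /E opprB addrC subrK scalerA -rmorphM mulfV ?gt_eqF// scale1r.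
  by [].
- by rewrite subr_ge0 cM1/= ltrBlDr ltrDl divr_gt0.
- apply: nm_pos_le => // [v|v|]; last by rewrite subr_ge0.
    rewrite /E qfB qf1 qfZ subr_ge0 ler_pdivrMl//.
    rewrite (le_trans (qf_le _ _))// ler_wpM2r ?sqr_ge0// /M lerDl.
    exact: ltW.
  rewrite /E qfB qf1 qfZ mulrBl mul1r lerD2l lerN2 mulrAC mulrC.
  by rewrite ler_wpM2l ?invr_ge0// ltW.
move=> A AP AC; apply: (salgB AP); first exact: salg1.
exact: salgZ.
Qed.

Lemma posdef_inverse C : posdef C -> invertible C /\
  forall A, unital_Cstar_subalgebra A -> A C -> A (inverse C).
Proof.
move=> [CC [c c0 cC]].
have [M [E [q [[M0 CE EH /andP[q0 q1] Eq] EA]]]] := posdef_contraction CC c0 cC.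
have [L [L1 L2 LA]] := neumann Eq q1.
have MM : M%:C * M^-1%:C = 1 :> R[i] by rewrite -rmorphM mulfV ?gt_eqF.
have h1 : (M^-1%:C *: L) * C = 1.
  by rewrite CE endoZl endoZr scalerA mulrC MM scale1r.
have h2 : C * (M^-1%:C *: L) = 1.
  by rewrite CE endoZl endoZr scalerA MM scale1r.
split; first by exists (M^-1%:C *: L).
move=> A AP AC; rewrite (inverse_uniq h1 h2); apply: (salgZ AP).
by apply: LA => //; exact: EA.
Qed.

Lemma posdef_invertible C : posdef C -> invertible C.
Proof. by move=> /posdef_inverse[]. Qed.

Lemma inverse_adj C : invertible C -> C^H = C -> (inverse C)^H = inverse C.
Proof.
move=> /inverseP[h1 h2] CC; apply/esym/inverse_uniq.
  by rewrite -{2}CC -adjM h2 adj1.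
by rewrite -{1}CC -adjM h1 adj1.
Qed.

(** The uniform constant comes from [|v| <= |T^-1| |T v|] and [|T v|^2 <= |T| <T v, v>]; conversely,
    boundedness below yields an inverse by a Neumann series. *)
Lemma posdefP T : positive_invertible T <-> posdef T.
Proof.
split=> [[TT T0 Tinv]|[TT [c c0 cT]]]; last first.
  have pT : posdef T by split=> //; exists c.
  split=> // [v|]; last exact: posdef_invertible.
  by rewrite inner_real// ler0c posdef_gt0.
split=> //.
have T0' v : 0 <= qf T v by have := T0 v; rewrite inner_real// ler0c.
have [Ti1 Ti2] := inverseP Tinv.
pose K := nm (inverse T) + 1; pose L := nm T + 1.
have K0 : 0 < K by rewrite ltr_wpDl ?nm_ge0.
have L0 : 0 < L by rewrite ltr_wpDl ?nm_ge0.
exists (K ^+ 2 * L)^-1; first by rewrite invr_gt0 mulr_gt0 ?exprn_gt0.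
move=> v; rewrite ler_pdivrMl ?mulr_gt0 ?exprn_gt0// -mulrA.
apply: (@le_trans _ _ (K ^+ 2 * nm (T v) ^+ 2)).
  rewrite -exprMn lerXn2r ?nnegrE ?nm_ge0 ?mulr_ge0 ?nm_ge0 ?(ltW K0)//.
  have {1}-> : v = (inverse T * T) v by rewrite Ti1.
  rewrite endo_mulE (le_trans (nm_app _ _))// ler_wpM2r ?nm_ge0//.
  by rewrite /K lerDl.
rewrite ler_wpM2l ?sqr_ge0//; apply: nm_app_le => // w.
rewrite (le_trans (qf_le _ _))// ler_wpM2r ?sqr_ge0// /L lerDl//.
Qed.

(** This is [nm_app_le] at the vector [C^-1 v]. *)
Lemma qf_inverse_ge C q v : posdef C -> (forall v, qf C v <= q * nm v ^+ 2) ->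
  0 < q -> q^-1 * nm v ^+ 2 <= qf (inverse C) v.
Proof.
move=> pC Cq q0; have [i1 i2] := inverseP (posdef_invertible pC).
have := nm_app_le (inverse C v) pC.1 (fun v => posdef_gt0 v pC) Cq q0.
have Cv : C (inverse C v) = v by rewrite -endo_mulE i2.
by rewrite /qf Cv ler_pdivrMl// (ipC v).
Qed.

Lemma posdef_inverse_posdef C : posdef C -> posdef (inverse C).
Proof.
move=> pC; have L0 : 0 < nm C + 1 by rewrite ltr_wpDl ?nm_ge0.
split; first exact: inverse_adj (posdef_invertible pC) pC.1.
exists (nm C + 1)^-1; first by rewrite invr_gt0.
move=> v; apply: qf_inverse_ge => // w.
by rewrite (le_trans (qf_le _ _))// ler_wpM2r ?sqr_ge0// lerDl.
Qed.

(* [1 - E = (1 - y) ^ 2] for the fixed point [y] of [y |-> (E + y ^ 2) / 2],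
   a contraction of the ball of radius [q]. *)
Lemma posdef_sqrt C : posdef C -> exists S : endo V, [/\ S^H = S, S * S = C, invertible S &
  forall A, unital_Cstar_subalgebra A -> A C -> A S].
Proof.
move=> pC; have [CC [c c0 cC]] := pC.
have [M [E [q [[M0 CE EH /andP[q0 q1] Eq] EA]]]] := posdef_contraction CC c0 cC.
pose f y := 2^-1%:C *: (E + y * y); pose y n := iter n f 0.
have n2 (T : endo V) : nm (2^-1%:C *: T) = 2^-1 * nm T.
  by rewrite nmZ cabs_pos.
have yq n : nm (y n) <= q.
  elim: n => [|n ih]; first by rewrite nm0.
  rewrite /= n2 ler_pdivrMl//.
  rewrite (le_trans (nmD _ _))//.
  have := nmM (y n) (y n); have := nm_ge0 (y n); rewrite -/(y n).
  by move: (nm _) (nm (y n * y n)) Eq ih => a b; nra.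
have yc n : nm (y n.+1 - y n) <= q * q ^+ n.
  elim: n => [|n ih].
    by rewrite expr0 mulr1/= subr0 n2 mulr0 addr0; have := nm_ge0 E; lra.
  have -> : y n.+2 - y n.+1 =
      2^-1%:C *: (y n.+1 * (y n.+1 - y n) + (y n.+1 - y n) * y n).
    rewrite [in LHS]/y iterS [X in _ - X]iterS -/(y n) -/(y n.+1) -scalerBr.
    congr (_ *: _); rewrite opprD addrACA subrr add0r mulrBr mulrBl.
    by rewrite addrA subrK.
  rewrite n2 ler_pdivrMl//.
  have -> : 2 * (q * q ^+ n.+1) = q * (q * q ^+ n) + q * q ^+ n * q.
    by rewrite exprS; ring.
  rewrite (le_trans (nmD _ _))// lerD// (le_trans (nmM _ _))//.
    by rewrite ler_pM ?nm_ge0.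
  by rewrite ler_pM ?nm_ge0.
have q01 : 0 <= q < 1 by rewrite q0.
have [_ /endo_complete[Y yY]] := geometric_ncauchy q01 yc.
have YE : Y = f Y.
  apply: (@cvg_unique_seq _ _ (fun n => y n.+1)).
    by rewrite (cvg_shiftS y).
  rewrite /f; apply: cvgZr; apply: cvgD; first exact: cvg_cst.
  exact: cvg_endoM.
have yH n : (y n)^H = y n.
  elim: n => [|n ih]; first by rewrite /= adj0.
  by rewrite [y n.+1]iterS -/(y n) /f adjZ adjD adjM ih EH conj_real.
have YH : Y^H = Y.
  have h : y @ \oo --> Y^H by rewrite -{1}(funext yH); exact: cvg_adj.
  exact: cvg_unique_seq h yY.
have YA A : unital_Cstar_subalgebra A -> A C -> A Y.
  move=> AP AC; apply: (salg_lim AP yY); elim=> [|n ih]; first exact: salg0.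
  apply: (salgZ AP); apply: (salgD AP); first exact: EA.
  exact: salgM.
have YY : (1 - Y) * (1 - Y) = 1 - E.
  have : Y + Y = E + Y * Y.
    rewrite {1 2}YE /f -scalerDl -rmorphD/=.
    by rewrite -[X in X%:C](_ : 1 = _) ?scale1r//; lra.
  move=> h; rewrite mulrBl mul1r mulrBr mulr1 opprB addrA.
  rewrite -[RHS](_ : 1 - (Y + Y) + Y * Y = _); first by rewrite opprD !addrA addrAC.
  by rewrite h opprD addrA subrK.
have sM : (Num.sqrt M)%:C * (Num.sqrt M)%:C = M%:C :> R[i].
  by rewrite -rmorphM -expr2 sqr_sqrtr// ltW.
pose S := (Num.sqrt M)%:C *: (1 - Y).
have SS : S * S = C by rewrite /S endoZl endoZr scalerA sM YY CE.
have [D [DC CD]] := posdef_invertible pC.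
exists S; split=> //.
- by rewrite /S adjZ adjB adj1 YH conj_real.
- by apply: (@invertible_lr _ _ (D * S) (S * D)); rewrite ?mulrA -?mulrA ?SS// mulrA SS.
- move=> A AP AC; apply: (salgZ AP); apply: (salgB AP); first exact: salg1.
  exact: YA.
Qed.

End Positive.

(** * Operator polynomials and Parseval's identity *)

Section RootsOfUnity.
Context {R : realType}.

(** [X^N - 1] splits over [R[i]] and is separable in characteristic 0; its [N] distinct roots must
    include a primitive one. Means over the powers of such a root replace integrals over the
    circle. *)
Lemma prim_root_exists (N : nat) : (0 < N)%N -> exists w : R[i], N.-primitive_root w.
Proof.
move=> N0.
pose p : {poly R[i]} := 'X^N - 1.
have [r Dp] := closed_field_poly_normal p.
rewrite (monicP _) ?monicXnsubC// scale1r in Dp.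
have rN1 : all N.-unity_root r by apply/allP => z; rewrite -root_prod_XsubC -Dp.
have szr : (N <= size r)%N.
  by rewrite -ltnS -(size_prod_XsubC _ id) -Dp size_XnsubC.
have ur : uniq r.
  by rewrite -separable_prod_XsubC -Dp separable_Xn_sub_1 // pnatr_eq0 -lt0n.
by have /hasP[z _ zN] := has_prim_root N0 rN1 ur szr; exists z.
Qed.

Lemma unit_mod_conj (w : R[i]) : cabs w = 1 -> w * Num.conj w = 1.
Proof.
move=> w1; have := normCK w; rewrite -cabsE w1 expr1n => <-.
by [].
Qed.

Lemma unit_mod_conjX (w : R[i]) (a b : nat) : cabs w = 1 ->
  w ^+ (a + b) * Num.conj w ^+ b = w ^+ a.
Proof.
by move=> w1; rewrite exprD -mulrA -exprMn unit_mod_conj// expr1n mulr1.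
Qed.

Lemma prim_root_cabs (N : nat) (w : R[i]) : N.-primitive_root w -> cabs w = 1.
Proof.
move=> wN; have N0 := prim_order_gt0 wN.
have : cabs w ^+ N = 1 by rewrite -cabsX prim_expr_order// cabs1.
move=> /eqP; rewrite pexpr_eq1 ?cabs_ge0//; first by move=> /eqP.
Qed.

Lemma root_mean_aux (N : nat) (w : R[i]) (a : nat) : N.-primitive_root w ->
  (0 < a < N)%N -> \sum_(s < N) (w ^+ s) ^+ a = 0.
Proof.
move=> wN /andP[a0 aN].
have wa : w ^+ a - 1 != 0.
  rewrite subr_eq0 -(prim_order_dvd wN); apply/negP => /dvdn_leq.
  by move=> /(_ a0); rewrite leqNgt aN.
apply: (mulfI wa); rewrite mulr0.
under eq_bigr do rewrite exprAC.
have wNa : w ^+ a ^+ N = 1.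
  by rewrite -exprM mulnC exprM (prim_expr_order wN) expr1n.
by rewrite -subrX1 wNa subrr.
Qed.

(** Orthogonality of characters. The bounds on [a] and [b] exclude aliasing: exponents congruent
    modulo [N] are then equal. *)
Lemma root_mean (N : nat) (w : R[i]) (a b : nat) : N.-primitive_root w ->
  (a < N)%N -> (b < N)%N ->
  \sum_(s < N) (w ^+ s) ^+ a * Num.conj (w ^+ s) ^+ b = (a == b)%:R * N%:R.
Proof.
move=> wN aN bN; have w1 := prim_root_cabs wN.
have ws s : cabs (w ^+ s) = 1 by rewrite cabsX w1 expr1n.
case: (ltngtP a b) => [ab|ba|->]; last first.
- rewrite (eq_bigr (fun=> 1)) => [|s _]; last first.
    by rewrite -exprMn unit_mod_conj ?expr1n.
  by rewrite sumr_const card_ord mul1r.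
- rewrite mul0r -[RHS](root_mean_aux (a := a - b) wN).
    apply: eq_bigr => s _; rewrite -(unit_mod_conjX (a - b) b)//.
    by rewrite subnK// ltnW.
  by rewrite subn_gt0 ba/= (leq_ltn_trans (leq_subr _ _)).
- have h : \sum_(s < N) (w ^+ s) ^+ (b - a) = 0.
    by apply: root_mean_aux => //; rewrite subn_gt0 ab/= (leq_ltn_trans (leq_subr _ _)).
  rewrite mul0r; transitivity (Num.conj (\sum_(s < N) (w ^+ s) ^+ (b - a))).
    rewrite rmorph_sum/=; apply: eq_bigr => s _.
    rewrite -{1}(subnK (ltnW ab)) exprD mulrCA -exprMn unit_mod_conj//.
    by rewrite expr1n mulr1 [RHS]rmorphXn.
  by rewrite h rmorph0.
Qed.

End RootsOfUnity.

Section SumRanges.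
Variables (W : nmodType) (F : nat -> W).

Lemma sum_ord_geq (k L : nat) : (k <= L)%N ->
  \sum_(i < L | (k <= i)%N) F i = \sum_(j < L - k) F (j + k)%N.
Proof.
move=> kL; rewrite -(big_mkord (fun i => (k <= i)%N)) (big_cat_nat (leq0n k) kL)/=.
rewrite [X in X + _ = _]big_nat_cond [X in X + _ = _]big1 ?add0r; last first.
  by move=> i /andP[ik ki]; exfalso; lia.
rewrite -{1}[k]add0n big_addn big_mkord big_mkcond.
by apply: eq_bigr => j _; rewrite leq_addl.
Qed.

Lemma sum_ord_leq (k L : nat) : (k < L)%N ->
  \sum_(i < L | (i <= k)%N) F i = \sum_(i < k.+1) F i.
Proof.
move=> kL; rewrite -(big_mkord (fun i => (i <= k)%N)).
rewrite (big_cat_nat (leq0n k.+1) kL)/=.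
rewrite [X in _ + X = _]big_nat_cond [X in _ + X = _]big1 ?addr0; last first.
  by move=> i /andP[ik ki]; exfalso; lia.
rewrite big_mkord big_mkcond.
by apply: eq_bigr => j _; rewrite -ltnS ltn_ord.
Qed.

End SumRanges.

Section Convolution.
Context {R : realType} {V : hilbertType R}.
Implicit Types (a b c x : nat -> endo V) (p : nat -> V) (z w : R[i]).

(** The argument [n] counts coefficients: a polynomial of degree at most [d] is evaluated by
    [peval a d.+1]. *)
Definition peval a n z : endo V := \sum_(j < n) z ^+ j *: a j.

Definition veval p n z : V := \sum_(k < n) z ^+ k *: p k.

Definition conv a b (i : nat) : endo V := \sum_(k < i.+1) a (i - k)%N * b k.

Definition vconv a p (i : nat) : V := \sum_(k < i.+1) a (i - k)%N (p k).

Definition delta : nat -> endo V := fun k => if k is 0%N then 1 else 0.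

Lemma peval_app a n z v : peval a n z v = veval (fun k => a k v) n z.
Proof. by rewrite /peval endo_sumE. Qed.

Lemma conv_app a b i v : conv a b i v = vconv a (fun k => b k v) i.
Proof. by rewrite /conv endo_sumE. Qed.

Lemma veval_ext p q n z : (forall k, (k < n)%N -> p k = q k) ->
  veval p n z = veval q n z.
Proof. by move=> pq; apply: eq_bigr => k _; rewrite pq. Qed.

Lemma veval_widen p m n z : (m <= n)%N -> (forall k, (m <= k)%N -> p k = 0) ->
  veval p n z = veval p m z.
Proof.
move=> mn p0; rewrite /veval -(subnKC mn) big_split_ord/= [X in _ + X]big1 ?addr0//.
by move=> i _; rewrite p0 ?scaler0// leq_addr.
Qed.

Lemma vconv_ext a p q i : (forall k, (k <= i)%N -> p k = q k) ->
  vconv a p i = vconv a q i.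
Proof. by move=> pq; apply: eq_bigr => k _; rewrite pq// -ltnS. Qed.

Lemma vconv_support a p m n i : (forall k, (m <= k)%N -> a k = 0) ->
  (forall k, (n <= k)%N -> p k = 0) -> (m + n <= i.+1)%N -> vconv a p i = 0.
Proof.
move=> a0 p0 mni; apply: big1 => k _.
have [nk|kn] := leqP n k; first by rewrite p0// linear0.
by rewrite a0//; lia.
Qed.

Lemma peval_veval a p m n z : (forall k, (m <= k)%N -> a k = 0) ->
  (forall k, (n <= k)%N -> p k = 0) ->
  peval a m z (veval p n z) = veval (vconv a p) (m + n) z.
Proof.
move=> a0 p0; set L := (m + n)%N.
rewrite -(@veval_widen p n L)// ?leq_addl// /veval endo_sum.
transitivity (\sum_(k < L) \sum_(i < L | (k <= i)%N) z ^+ i *: a (i - k)%N (p k)).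
  apply: eq_bigr => k _; rewrite endoZ.
  have [nk|kn] := leqP n k.
    by rewrite p0// linear0 scaler0 big1// => i _; rewrite linear0 scaler0.
  rewrite peval_app /veval scaler_sumr.
  have kL : (k <= L)%N by exact: ltnW.
  rewrite (sum_ord_geq (fun i => z ^+ i *: a (i - k)%N (p k)) kL).
  have mLk : (m <= L - k)%N by rewrite -addnBA ?leq_addr// ltnW.
  rewrite -(subnKC mLk) big_split_ord/= [X in _ = _ + X]big1 ?addr0.
    by apply: eq_bigr => j _; rewrite addnK scalerA -exprD addnC.
  by move=> j _; rewrite addnK a0 ?scaler0// leq_addr.
rewrite (exchange_big_dep predT)//=; apply: eq_bigr => i _.
rewrite /vconv scaler_sumr.
exact: (sum_ord_leq (fun k => z ^+ i *: a (i - k)%N (p k)) (ltn_ord i)).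
Qed.

Lemma peval_conv a b m n z : (forall k, (m <= k)%N -> a k = 0) ->
  (forall k, (n <= k)%N -> b k = 0) ->
  peval a m z * peval b n z = peval (conv a b) (m + n) z.
Proof.
move=> a0 b0; apply: endo_ext => v; rewrite endo_mulE !peval_app.
rewrite -peval_app peval_veval//; last by move=> k /b0 ->.
by apply: veval_ext => k _; rewrite conv_app.
Qed.

Lemma convA a b c : conv a (conv b c) = conv (conv a b) c.
Proof.
apply/funext => i; rewrite /conv.
under eq_bigr do rewrite mulr_sumr.
under [RHS]eq_bigr do rewrite mulr_suml.
pose F k l := a (i - k)%N * (b (k - l)%N * c l).
transitivity (\sum_(k < i.+1) \sum_(l < i.+1 | (l <= k)%N) F k l).
  apply: eq_bigr => k _.
  by rewrite (sum_ord_leq (fun l => F k l) (ltn_ord k)).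
rewrite (exchange_big_dep predT)//=; apply: eq_bigr => l _.
have li : (l <= i.+1)%N by exact: ltnW.
rewrite (sum_ord_geq (fun k => F k l) li) subSn; last by rewrite -ltnS.
apply: eq_bigr => k _.
by rewrite /F mulrA addnK addnC subnDA.
Qed.

Lemma conv_delta_r a : conv a delta = a.
Proof.
apply/funext => i; rewrite /conv big_ord_recl/= subn0 mulr1 big1 ?addr0//.
by move=> k _; rewrite mulr0.
Qed.

Lemma conv_delta_l a : conv delta a = a.
Proof.
apply/funext => i; rewrite /conv big_ord_recr/= subnn mul1r big1 ?add0r//.
move=> k _; have : (0 < i - k)%N by rewrite subn_gt0.
by case: (i - k)%N => // m _; rewrite mul0r.
Qed.

(** The defect [e = b a - 1] satisfies [a e = (a b) a - a = 0], and a series with constant term 1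
    can be cancelled on the left, coefficient by coefficient. *)
Lemma conv_unit_comm a b : a 0%N = 1 -> conv a b = delta -> conv b a = delta.
Proof.
move=> a0 ab; pose e i := conv b a i - delta i.
have ae : conv a e = fun=> 0.
  have -> : conv a e = fun i => conv a (conv b a) i - conv a delta i.
    apply/funext => i; rewrite /conv -sumrB; apply: eq_bigr => k _.
    by rewrite -mulrBr.
  by rewrite convA ab conv_delta_l conv_delta_r; apply/funext => i; rewrite subrr.
have e0 i : e i = 0.
  elim/ltn_ind: i => i ih; have := congr1 (fun f => f i) ae.
  rewrite /conv big_ord_recr/= subnn a0 mul1r big1 ?add0r// => k _.
  by rewrite ih ?mulr0.
by apply/funext => i; apply/eqP; rewrite -subr_eq0; apply/eqP; exact: e0.
Qed.

(** Discrete form of Parseval's identity: the mean over [N]-th roots of unity is exact as soon as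
    [N] is at least the number of coefficients. *)
Lemma parseval (N n : nat) w p q : N.-primitive_root w -> (n <= N)%N ->
  \sum_(s < N) ip (veval p n (w ^+ s)) (veval q n (w ^+ s)) =
  N%:R * \sum_(k < n) ip (p k) (q k).
Proof.
move=> wN nN.
have h : \sum_(s < N) inner (veval p n (w ^+ s)) (veval q n (w ^+ s)) =
  N%:R * \sum_(k < n) inner (p k) (q k).
  transitivity (\sum_(s < N) \sum_(k < n) \sum_(l < n)
      (w ^+ s) ^+ k * Num.conj (w ^+ s) ^+ l * inner (p k) (q l)).
    apply: eq_bigr => s _; rewrite inner_suml; apply: eq_bigr => k _.
    rewrite inner_sumr; apply: eq_bigr => l _.
    by rewrite innerZl inner_conj_r rmorphXn mulrA.
  rewrite exchange_big mulr_sumr; apply: eq_bigr => k _ /=.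
  rewrite exchange_big/= (bigD1 k)//= -mulr_suml root_mean ?eqxx ?mul1r//;
    try exact: leq_trans (ltn_ord _) nN.
  rewrite [X in _ + X]big1 ?addr0// => l lk.
  rewrite -mulr_suml (root_mean wN); try exact: leq_trans (ltn_ord _) nN.
  by rewrite eq_sym (inj_eq val_inj) (negPf lk) !mul0r.
have ReS (I : Type) (r : seq I) (Q : pred I) (f : I -> R[i]) :
    complex.Re (\sum_(i <- r | Q i) f i) = \sum_(i <- r | Q i) complex.Re (f i).
  by apply: (big_morph (@complex.Re R)) => // -[? ?] [? ?].
transitivity (complex.Re (N%:R * \sum_(k < n) inner (p k) (q k))).
  by rewrite -h; apply: esym; exact: ReS.
have -> : N%:R = (N%:R : R)%:C :> R[i] by rewrite rmorph_nat.
have -> : \sum_(k < n) ip (p k) (q k) = complex.Re (\sum_(k < n) inner (p k) (q k)).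
  by apply: esym; exact: ReS.
by case: (\sum_(k < n) _) => x y /=; rewrite mul0r subr0.
Qed.

Lemma parseval_nm (N n : nat) w p : N.-primitive_root w -> (n <= N)%N ->
  \sum_(s < N) nm (veval p n (w ^+ s)) ^+ 2 = N%:R * \sum_(k < n) nm (p k) ^+ 2.
Proof.
move=> wN nN; under eq_bigr do rewrite -ipvv.
by rewrite (parseval _ _ wN nN); congr (_ * _); apply: eq_bigr => k _; rewrite ipvv.
Qed.

End Convolution.

(** * Toeplitz operators *)

(* [lia] after discarding the hypotheses that are not about natural numbers. *)
Ltac natlia :=
  repeat match goal with
  | H : ?T |- _ => lazymatch T with
    | is_true (leq _ _) => fail
    | is_true (andb _ _) => fail
    | is_true (@eq_op _ _ _) => fail
    | nat => fail
    | @eq _ _ _ => fail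
    | ordinal _ => fail
    | Finite.sort _ => fail
    | _ => clear H
    end
  end; lia.

Lemma cvg_seq_sum {R : realType} (W : normedModType R[i]) (n : nat)
    (F : nat -> nat -> W) (l : nat -> W) :
  (forall k, F k @ \oo --> l k) ->
  \sum_(k < n) F k j @[j --> \oo] --> \sum_(k < n) l k.
Proof.
move=> Fl; elim: n => [|n ih].
  rewrite big_ord0 (_ : (fun j => _) = fun=> 0); first exact: cvg_cst.
  by apply/funext => j; rewrite big_ord0.
rewrite big_ord_recr/= (_ : (fun j => _) = fun j => \sum_(k < n) F k j + F n j).
  exact: cvgD.
by apply/funext => j; rewrite big_ord_recr.
Qed.

Section Toeplitz.
Context {R : realType} {V : hilbertType R}.
Variables (phi : nat -> endo V) (d : nat) (c M : R).

(** A Laurent polynomial stored with shifted indices: since [Num.conj w] is the inverse of [w] on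
    the circle, [phi j] is the coefficient of [w ^ (j - d)]. *)
Definition trig_poly (w : R[i]) : endo V := Num.conj w ^+ d *: peval phi d.*2.+1 w.

Hypothesis phi0 : forall j, (d.*2 < j)%N -> phi j = 0.
Hypothesis phiH : forall j, (j <= d.*2)%N -> (phi (d.*2 - j)%N)^H = phi j.
Hypothesis symF : forall w, cabs w = 1 -> (trig_poly w)^H = trig_poly w.
Hypothesis Fge : forall w, cabs w = 1 -> bounded_below c (trig_poly w).
Hypothesis Fle : forall w, cabs w = 1 ->
  forall v, qf (trig_poly w) v <= M * nm v ^+ 2.
Hypotheses (c0 : 0 < c) (cM : c < M).

Let M0 : 0 < M := lt_trans c0 cM.
Let q := 1 - c / M.

Let q01 : 0 <= q < 1.
Proof.
rewrite /q subr_ge0 ltrBlDr ltrDl divr_gt0// andbT.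
by rewrite ler_pdivrMr// mul1r ltW.
Qed.

(** Shifted coefficients of the symbol [1 - F / M], whose norm on the circle is at most [q] because
    [c <= F <= M]. *)
Let beta (j : nat) : endo V := (if j == d then 1 else 0) - M^-1%:C *: phi j.

Let beta0 j : (d.*2 < j)%N -> beta j = 0.
Proof.
move=> dj; rewrite /beta phi0// scaler0 subr0 ifF//; apply/negbTE; natlia.
Qed.

(** Because of the shift, entry [j] of the Toeplitz product with [F] is [conv phi x (j + d)]; this
    is the action of [1 - T / M] on entry [j]. *)
Let conv_beta (x : nat -> endo V) j :
  conv beta x (j + d) = x j - M^-1%:C *: conv phi x (j + d).
Proof.
rewrite /conv /beta; under eq_bigr do rewrite mulrBl endoZl.
rewrite sumrB -scaler_sumr; congr (_ - _).
have jd : (j < (j + d).+1)%N by rewrite ltnS leq_addr.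
rewrite (bigD1 (Ordinal jd))//= addKn eqxx mul1r big1 ?addr0// => k kj.
rewrite ifF ?mul0r//; apply/negbTE; apply: contraNneq kj => kd.
by apply/eqP/val_inj => /=; have := ltn_ord k; natlia.
Qed.

Let nm_beta w : cabs w = 1 -> nm (peval beta d.*2.+1 w) <= q.
Proof.
move=> w1; have -> : peval beta d.*2.+1 w =
    w ^+ d *: (1 - M^-1%:C *: trig_poly w).
  rewrite /peval /beta; under eq_bigr do rewrite scalerBr.
  rewrite sumrB scalerBr; congr (_ - _).
    have dd : (d < d.*2.+1)%N by natlia.
    rewrite (bigD1 (Ordinal dd))//= eqxx big1 ?addr0// => i id.
    by rewrite ifF ?scaler0//; apply/negbTE; apply: contraNneq id => id; apply/eqP/val_inj.
  have e : w ^+ d * (M^-1%:C * Num.conj w ^+ d) = M^-1%:C.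
    by rewrite mulrCA -exprMn unit_mod_conj// expr1n mulr1.
  rewrite /trig_poly !scalerA -mulrA e scaler_sumr; apply: eq_bigr => j _.
  by rewrite scalerA mulrC -scalerA.
rewrite nmZ cabsX w1 expr1n mul1r; apply: nm_pos_le.
- by rewrite adjB adj1 adjZ symF// conj_real.
- move=> v; rewrite qfB qf1 qfZ subr_ge0 ler_pdivrMl//; exact: Fle.
- move=> v; rewrite qfB qf1 qfZ /q mulrBl mul1r lerD2l lerN2 mulrAC mulrC.
  by rewrite ler_wpM2l ?invr_ge0 ?(ltW M0)//; exact: Fge.
- by case/andP: q01.
Qed.

(** A Toeplitz operator compresses a multiplication operator. Restoring the discarded coefficients
    only enlarges the left side; Parseval, used in both directions, then reduces the claim to the
    pointwise bound [nm_beta]. *)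
Let beta_contr (p : nat -> V) n J : (forall k, (n <= k)%N -> p k = 0) ->
  \sum_(j < J) nm (vconv beta p (j + d)) ^+ 2 <=
  q ^+ 2 * \sum_(k < n) nm (p k) ^+ 2.
Proof.
move=> p0; pose L := (d.*2.+1 + n)%N.
have L0 : (0 < L)%N by rewrite /L.
have [w wL] := @prim_root_exists R _ L0.
have r0 : 0 < L%:R :> R by rewrite ltr0n.
have w1 s : cabs (w ^+ s) = 1 by rewrite cabsX (prim_root_cabs wL) expr1n.
apply: (@le_trans _ _ (\sum_(i < L) nm (vconv beta p i) ^+ 2)).
  pose G i := nm (vconv beta p i) ^+ 2.
  have GL i : (L <= i)%N -> G i = 0.
    move=> Li; rewrite /G (@vconv_support _ _ beta p d.*2.+1 n)//.
      by rewrite nm0 expr0n.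
    by rewrite -/L ltnW.
  apply: (@le_trans _ _ (\sum_(i < d + J) G i)).
    rewrite big_split_ord/= ler_wpDl//.
      by apply: sumr_ge0 => i _; exact: sqr_ge0.
    by apply: ler_sum => j _; rewrite /G addnC.
  apply: (@le_trans _ _ (\sum_(i < L + (d + J)) G i)).
    rewrite (addnC L) [X in _ <= X]big_split_ord/= lerDl.
    by apply: sumr_ge0 => i _; exact: sqr_ge0.
  rewrite big_split_ord/= [X in _ + X]big1 ?addr0// => i _.
  by rewrite GL// leq_addr.
rewrite -(ler_pM2l r0).
rewrite -(parseval_nm _ wL)// mulrCA -(parseval_nm _ wL) ?leq_addl//.
rewrite mulr_sumr; apply: ler_sum => s _.
rewrite -(peval_veval _ beta0 p0) -exprMn.
have q0 : 0 <= q by case/andP: q01.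
rewrite lerXn2r ?nnegrE ?mulr_ge0 ?nm_ge0//.
rewrite (le_trans (nm_app _ _))// ler_wpM2r ?nm_ge0// nm_beta//.
Qed.

(** The terms [(1 - T / M)^l (e_0 / M)] of the Neumann series for [T^-1 e_0]. Each one has finite
    support, growing by [d] per step. *)
Let D l : nat -> endo V :=
  iter l (fun x j => conv beta x (j + d)) (fun k => M^-1%:C *: delta k).

Let D0 l k : (l * d < k)%N -> D l k = 0.
Proof.
elim: l k => [|l ih] k lk; first by case: k lk => //= k _; rewrite scaler0.
rewrite /D iterS -/(D l) /conv; apply: endo_ext => v.
rewrite conv_app (@vconv_support _ _ beta _ d.*2.+1 (l * d).+1)//.
  by move=> j lj; rewrite ih.
by rewrite mulSn in lk; natlia.
Qed.

Let nm_D l k : nm (D l k) <= M^-1 * q ^+ l.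
Proof.
have q0 : 0 <= q by case/andP: q01.
have Mi : 0 <= M^-1 by rewrite invr_ge0 ltW.
have h v J : \sum_(j < J) nm (D l j v) ^+ 2 <= (M^-1 * q ^+ l * nm v) ^+ 2.
  elim: l J => [|l ih] J.
    case: J => [|J]; first by rewrite big_ord0 sqr_ge0.
    rewrite big_ord_recl big1 => [|i _]; last first.
      by rewrite /= scaler0 nm0 expr0n.
    rewrite addr0 (_ : D 0 _ v = M^-1%:C *: v)//.
    by rewrite nmZ cabs_pos// expr0 mulr1.
  have -> : (M^-1 * q ^+ l.+1 * nm v) ^+ 2 = q ^+ 2 * (M^-1 * q ^+ l * nm v) ^+ 2.
    by rewrite (exprS q l); ring.
  apply: le_trans (ler_wpM2l (sqr_ge0 q) (ih (l * d).+1)).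
  have := @beta_contr (fun k => D l k v) (l * d).+1 J.
  move=> /(_ (fun k lk => congr1 (fun T : endo V => T v) (D0 lk))).
  by apply: le_trans; apply: ler_sum => j _; rewrite /D iterS -/(D l) conv_app.
apply: nm_endo_le => [|v]; first by rewrite mulr_ge0 ?exprn_ge0.
rewrite -(@ler_pXn2r _ 2%N) ?nnegrE ?nm_ge0 ?mulr_ge0 ?nm_ge0 ?exprn_ge0//.
apply: le_trans (h v k.+1); rewrite big_ord_recr/= lerDr.
by apply: sumr_ge0 => i _; exact: sqr_ge0.
Qed.

(** The only decay kept from the Neumann series: it makes the finitely many boundary terms of a
    truncation small. *)
Definition null_seq (x : nat -> endo V) :=
  forall e : R, 0 < e -> exists N, forall n, (N <= n)%N -> nm (x n) < e.

Lemma toeplitz_solution : exists x : nat -> endo V,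
  [/\ forall j, conv phi x (j + d) = delta j, null_seq x &
    forall A, unital_Cstar_subalgebra A -> (forall j, A (phi j)) ->
      forall j, A (x j)].
Proof.
pose u j L := \sum_(l < L) D l j.
pose C := M^-1 / (1 - q).
have uS j L : nm (u j L.+1 - u j L) <= M^-1 * q ^+ L.
  by rewrite /u big_ord_recr/= addrAC subrr add0r nm_D.
have /choice[x xP] j : exists y : endo V,
    u j @ \oo --> y /\ forall L, nm (y - u j L) <= C * q ^+ L.
  have [h /endo_complete[y uy]] := geometric_ncauchy q01 (uS j).
  exists y; split=> // L.
  apply: (@cvg_nm_bound _ _ (fun n => u j n - u j L)).
    by apply: cvgB => //; exact: cvg_cst.
  by exists L => // n /= Ln; rewrite -(subnKC Ln); exact: h.
have xfix j : x j = M^-1%:C *: delta j + conv beta x (j + d).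
  have h1 : (fun L => u j L.+1) @ \oo --> x j.
    by rewrite (cvg_shiftS (u j)); exact: (xP j).1.
  have h2 : (fun L => M^-1%:C *: delta j +
      \sum_(k < (j + d).+1) beta (j + d - k)%N * u k L) @ \oo -->
      M^-1%:C *: delta j + conv beta x (j + d).
    apply: cvgD; first exact: cvg_cst.
    rewrite /conv.
    apply: (cvg_seq_sum _ (F := fun k L => beta (j + d - k)%N * u k L)
      (l := fun k => beta (j + d - k)%N * x k)) => k.
    by apply: cvg_endoM; [exact: cvg_cst|exact: (xP k).1].
  suff h3 : (fun L => u j L.+1) = (fun L => M^-1%:C *: delta j +
      \sum_(k < (j + d).+1) beta (j + d - k)%N * u k L).
    by rewrite h3 in h1; exact: cvg_unique_seq h1 h2.
  apply/funext => L; rewrite /u big_ord_recl; congr (_ + _).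
  under [RHS]eq_bigr do rewrite mulr_sumr.
  by rewrite exchange_big.
exists x; split.
- move=> j; have := xfix j; rewrite conv_beta addrCA -{1}[x j]addr0.
  move=> /addrI/esym/eqP; rewrite subr_eq0 => /eqP h; apply/esym.
  have MM : M%:C * M^-1%:C = 1 :> R[i] by rewrite -rmorphM mulfV ?gt_eqF.
  have := congr1 (fun T => M%:C *: T) h.
  by rewrite /= !scalerA MM !scale1r.
(* Beyond index [L * d] the first [L] terms of the series vanish, so such entries are bounded by the
   tail [C * q ^+ L]. *)
- move=> e e0.
  have /cvgrPdist_lt/(_ _ e0)[L _ hL] := expr_lt_cvg0 C q01.
  exists (L * d).+1 => n Ln.
  have := hL _ (leqnn L); rewrite /= sub0r normrN => h.
  have := (xP n).2 L; rewrite /u big1 ?subr0.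
    by move=> h'; rewrite (le_lt_trans h')// (le_lt_trans (ler_norm _) h).
  move=> l _; apply: D0; apply: leq_ltn_trans Ln.
  by rewrite leq_mul2r (ltnW (ltn_ord l)) orbT.
- move=> A AP Aphi j; apply: (salg_lim AP (xP j).1) => L.
  apply: (salg_sum AP) => l _; elim: (val l) j => [|k ih] j.
    by apply: (salgZ AP); case: j => //=; [exact: salg1|move=> _; exact: salg0].
  rewrite /D iterS; apply: (salg_sum AP) => m _; apply: (salgM AP); last exact: ih.
  apply: (salgB AP); last exact: salgZ.
  by case: ifP => _; [exact: salg1|exact: salg0].
Qed.

Variable x : nat -> endo V.
Hypothesis xT : forall j, conv phi x (j + d) = delta j.
Hypothesis xnull : null_seq x.

(** Since [(1 - T / M) x = x - e_0 / M], contractivity gives [|x v - e_0 v / M|^2 <= |x v|^2];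
    expanding the entry at 0 leaves [|v|^2 / M^2 <= (2 / M) <x_0 v, v>]. The infinite sums are
    truncated, which costs [d] boundary terms. *)
Lemma toeplitz_head_ge v : (M *+ 2)^-1 * nm v ^+ 2 <= ip (x 0%N v) v.
Proof.
pose s n := \sum_(k < n) nm (x k v) ^+ 2.
have h n : s n.+1 - 2 / M * ip (x 0%N v) v + nm v ^+ 2 / M ^+ 2 <= q ^+ 2 * s (n.+1 + d)%N.
  pose p k := if (k < n.+1 + d)%N then x k v else 0.
  have pz k : (n.+1 + d <= k)%N -> p k = 0 by rewrite /p leqNgt => /negbTE ->.
  have := beta_contr n.+1 pz.
  have -> : \sum_(k < n.+1 + d) nm (p k) ^+ 2 = s (n.+1 + d)%N.
    by apply: eq_bigr => k _; rewrite /p ltn_ord.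
  suff -> : \sum_(j < n.+1) nm (vconv beta p (j + d)) ^+ 2 =
      s n.+1 - 2 / M * ip (x 0%N v) v + nm v ^+ 2 / M ^+ 2 by [].
  have bp j : (j < n.+1)%N -> vconv beta p (j + d) = x j v - M^-1%:C *: delta j v.
    move=> jn; rewrite (@vconv_ext _ _ _ _ (fun k => x k v)) -?conv_app; last first.
      move=> k kj; rewrite /p ifT//; natlia.
    by rewrite conv_beta xT.
  rewrite big_ord_recl/= bp// /s big_ord_recl/=.
  under eq_bigr => i _ do rewrite bp /bump ?leq0n ?add1n ?ltnS ?ltn_ord//= scaler0 subr0.
  rewrite nm_sqB ipZr nmZ cabs_pos ?invr_ge0 ?(ltW M0)//.
  have -> : \sum_(i < n) nm (x (bump 0 i) v) ^+ 2 = \sum_(i < n) nm (x i.+1 v) ^+ 2.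
    by [].
  by move: (\sum_(i < n) _) => S; field; exact: lt0r_neq0 M0.
have key : nm v ^+ 2 / M ^+ 2 <= 2 / M * ip (x 0%N v) v.
  apply/ler_addgt0Pl => e e0.
  pose K := d%:R * nm v ^+ 2 + 1.
  have K0 : 0 < K.
    by rewrite ltr_wpDl// mulr_ge0 ?sqr_ge0 ?ler0n.
  (* Capping at 1 gives [a ^+ 2 <= a], so the squared boundary terms are linear in [a]. *)
  pose a := Num.min 1 (e / K).
  have a0 : 0 < a by rewrite lt_min ltr01 divr_gt0.
  have [N hN] := xnull a0.
  have sD : s (N.+1 + d)%N - s N.+1 <= e.
    rewrite /s big_split_ord/= addrAC subrr add0r.
    apply: (@le_trans _ _ (\sum_(i < d) (a * nm v ^+ 2))).
      apply: ler_sum => i _.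
      apply: (@le_trans _ _ ((a * nm v) ^+ 2)).
        rewrite lerXn2r ?nnegrE ?mulr_ge0 ?nm_ge0 ?(ltW a0)//.
        rewrite (le_trans (nm_app _ _))// ler_wpM2r ?nm_ge0// ltW// hN//.
        by rewrite /=; natlia.
      rewrite exprMn ler_wpM2r ?sqr_ge0// expr2 ler_piMl ?(ltW a0)//.
      by rewrite /a ge_min lexx.
    rewrite sumr_const card_ord -mulr_natl mulrCA.
    apply: (@le_trans _ _ (e / K * K)); last by rewrite divfK ?gt_eqF.
    apply: ler_pM; [exact: ltW|by rewrite mulr_ge0 ?sqr_ge0 ?ler0n| |].
      by rewrite /a ge_min lexx orbT.
    by rewrite /K lerDl.
  have := h N; have s0 : 0 <= s (N.+1 + d)%N by apply: sumr_ge0 => i _; exact: sqr_ge0.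
  have q1 : q ^+ 2 <= 1 by case/andP: q01 => ? ?; rewrite expr_le1// ltW.
  have : q ^+ 2 * s (N.+1 + d)%N <= s (N.+1 + d)%N by rewrite ler_piMl.
  move: sD; move: (s _) (s _) (ip _ _) (q ^+ 2 * _) => A B C E.
  by move: (2 / M * C) (nm v ^+ 2 / M ^+ 2) => G H; lra.
have -> : (M *+ 2)^-1 * nm v ^+ 2 = M / 2 * (nm v ^+ 2 / M ^+ 2).
  by rewrite -mulr_natr; field; rewrite gt_eqF.
have -> : ip (x 0%N v) v = M / 2 * (2 / M * ip (x 0%N v) v).
  by field; rewrite gt_eqF.
by rewrite ler_wpM2l// divr_ge0// ltW.
Qed.

(** The entry of the Toeplitz matrix in row [k] and column [l]; the guard keeps truncated
    subtraction from producing [phi 0] where the entry is zero. *)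
Let tf k l : endo V := if (l <= k + d)%N then phi (k + d - l)%N else 0.

Let tfH k l : (tf k l)^H = tf l k.
Proof.
rewrite /tf; case: (leqP l (k + d)) => lk; case: (leqP k (l + d)) => kl.
- rewrite -(phiH (j := l + d - k)); last by natlia.
  by congr ((phi _)^H); natlia.
- by rewrite phi0 ?adj0//; natlia.
- by rewrite adj0 phi0//; natlia.
- by rewrite adj0.
Qed.

Let conv_tf (y : nat -> endo V) k L : (k + d < L)%N ->
  conv phi y (k + d) = \sum_(l < L) tf k l * y l.
Proof.
move=> kL; rewrite -(subnKC kL) big_split_ord/= [X in _ + X]big1 ?addr0.
  by apply: eq_bigr => l _; rewrite /tf -ltnS ltn_ord.
by move=> l _; rewrite /tf ifF ?mul0r//; apply/negbTE; natlia.
Qed.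

(* Symmetry of the Toeplitz operator [T] on null sequences, [<x, T y> = <T x, y>]:
   the truncated sums differ by boundary terms. *)
Lemma toeplitz_pairing (y : nat -> endo V) m : null_seq y ->
  (forall k, (m < k)%N -> conv phi y (k + d) = 0) ->
  \sum_(k < m.+1) (x k)^H * conv phi y (k + d) = y 0%N.
Proof.
move=> ynull y0.
pose a k l := (x k)^H * tf k l * y l.
pose K := \sum_(j < d.*2.+1) nm (phi j).
have K0 : 0 <= K by apply: sumr_ge0 => j _; exact: nm_ge0.
have phiK j : nm (phi j) <= K.
  have [dj|jd] := ltnP d.*2 j; first by rewrite phi0// nm0.
  have jd' : (j < d.*2.+1)%N by [].
  rewrite /K (bigD1 (Ordinal jd'))//= lerDl.
  by apply: sumr_ge0 => i _; exact: nm_ge0.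
have tfK k l : nm (tf k l) <= K by rewrite /tf; case: ifP => _ //; rewrite nm0.
apply/eqP; rewrite -subr_eq0; apply/eqP; apply: nm_eq0; apply/le_anti.
rewrite nm_ge0 andbT; apply/ler_addgt0Pl => e e0; rewrite addr0.
pose L := (d * d)%:R * (2 * K) + 1.
have L0 : 0 < L by rewrite ltr_wpDl// !mulr_ge0 ?ler0n.
pose b := Num.min 1 (e / L).
have b0 : 0 < b by rewrite lt_min ltr01 divr_gt0.
have [N1 h1] := xnull b0; have [N2 h2] := ynull _ b0.
have [n [n' [nE nN]]] : exists n n', n = (m.+1 + n')%N /\ (N1 + N2 + d <= n)%N.
  by exists (m.+1 + (N1 + N2 + d))%N, (N1 + N2 + d)%N; split=> //; natlia.
have -> : \sum_(k < m.+1) (x k)^H * conv phi y (k + d) =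
    \sum_(k < n) \sum_(l < n + d) a k l.
  rewrite nE [RHS]big_split_ord/= [X in _ = _ + X]big1 ?addr0.
    apply: eq_bigr => k _; rewrite (conv_tf _ (L := (m.+1 + n' + d)%N)).
      by rewrite mulr_sumr; apply: eq_bigr => l _; rewrite mulrA.
    by have := ltn_ord k; natlia.
  move=> k _; under eq_bigr do rewrite /a -mulrA.
  rewrite -mulr_sumr -conv_tf ?y0 ?mulr0//; first by natlia.
  by have := ltn_ord k; natlia.
(* [T x = e_0] selects [y 0]; expanding [T x] and using that the matrix is Hermitian gives the same
   double sum with indices exchanged. *)
have -> : y 0%N = \sum_(k < n) \sum_(l < n + d) a l k.
  transitivity (\sum_(k < n) (conv phi x (k + d))^H * y k).
    rewrite nE addSn big_ord_recl/= xT adj1 mul1r big1 ?addr0// => k _.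
    by rewrite xT /bump/= adj0 mul0r.
  apply: eq_bigr => k _; rewrite (conv_tf _ (L := (n + d)%N)); last first.
    by rewrite ltn_add2r.
  rewrite adj_sum mulr_suml; apply: eq_bigr => l _.
  by rewrite adjM tfH.
rewrite -sumrB.
have -> : \sum_(k < n) (\sum_(l < n + d) a k l - \sum_(l < n + d) a l k) =
    \sum_(k < n) \sum_(j < d) (a k (n + j)%N - a (n + j)%N k).
  under eq_bigr do rewrite !big_split_ord/= opprD addrACA.
  rewrite big_split/= sumrB [X in _ - X + _]exchange_big/= subrr add0r.
  by apply: eq_bigr => k _; rewrite sumrB.
have nd : n = ((n - d) + d)%N by natlia.
pose f k := \sum_(j < d) (a k (n + j)%N - a (n + j)%N k).
(* The matrix has bandwidth [d], so only the last [d] rows meet columns of index at least [n]; at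
   most [d * d] pairs remain, as counted in [L]. *)
have -> : \sum_(k < n) \sum_(j < d) (a k (n + j)%N - a (n + j)%N k) =
    \sum_(k < d) f (n - d + k)%N.
  transitivity (\sum_(k < n - d + d) f k); first by rewrite -nd.
  rewrite big_split_ord/= big1 ?add0r// => k _; apply: big1 => j _.
  rewrite /a /tf ifF; last by apply/negbTE; have := ltn_ord k; natlia.
  rewrite ifT; last by have := ltn_ord k; natlia.
  by rewrite phi0 ?mulr0 ?mul0r ?subrr//; have := ltn_ord k; natlia.
apply: le_trans (nm_sum _ _ _) _.
have ab k l : (N1 + N2 <= k)%N -> (N1 + N2 <= l)%N -> nm (a k l) <= K * b.
  move=> Nk Nl; rewrite /a (le_trans (nmM _ _))//.
  apply: (@le_trans _ _ (K * b)) => //.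
  apply: ler_pM; rewrite ?nm_ge0//.
    rewrite (le_trans (nmM _ _))// nm_adj -[X in _ <= X]mul1r.
    apply: ler_pM; rewrite ?nm_ge0//.
    apply: (@le_trans _ _ b); first by rewrite ltW// h1//; natlia.
    by rewrite /b ge_min lexx.
  by rewrite ltW// h2//; natlia.
apply: (@le_trans _ _ (\sum_(k < d) \sum_(j < d) (2 * K * b))).
  apply: ler_sum => k _; apply: le_trans (nm_sum _ _ _) _.
  apply: ler_sum => j _; apply: le_trans (nmB _ _) _.
  rewrite -mulrA mulr_natl mulr2n lerD// ab//=; natlia.
rewrite !sumr_const !card_ord -mulrnA -[X in X <= _]mulr_natl mulrA.
apply: (@le_trans _ _ (L * (e / L))); last by rewrite mulrC divfK ?gt_eqF.
apply: ler_pM; [by rewrite !mulr_ge0 ?ler0n|exact: ltW| |].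
  by rewrite /L lerDl.
by rewrite /b ge_min lexx orbT.
Qed.

(** With [X] the series of [x], the product [F X] has constant term 1 and otherwise only negative
    powers, so its adjoint on the circle is a polynomial [G] of degree at most [d]. The index
    [d - i] is the power [-i] of [F X]. *)
Definition analytic_part (i : nat) : endo V :=
  if (i <= d)%N then (conv phi x (d - i)%N)^H else 0.

(** Formally [G X = X^H F X] is both analytic and self-adjoint, hence constant. Coefficient [m] is
    obtained by pairing [x] with its shift by [m], on which the Toeplitz operator vanishes beyond
    index [m]. *)
Lemma toeplitz_factor m : conv analytic_part x m =
  if m is 0%N then (x 0%N)^H else 0.
Proof.
pose y l := if (m <= l)%N then x (l - m)%N else 0.
have ynull : null_seq y.
  move=> e e0; have [N hN] := xnull e0; exists (N + m)%N => n Nn.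
  by rewrite /y ifT ?hN//; natlia.
have convy i : conv phi y i = if (m <= i)%N then conv phi x (i - m)%N else 0.
  case: leqP => mi; last first.
    apply: big1 => k _; rewrite /y ifF ?mulr0//.
    by apply/negbTE; have := ltn_ord k; natlia.
  rewrite /conv -(subnKC (leqW mi)) big_split_ord/= big1 ?add0r.
    rewrite subSn//; apply: eq_bigr => k _; rewrite /y leq_addr addKn.
    by congr (phi _ * _); natlia.
  by move=> k _; rewrite /y ifF ?mulr0//; apply/negbTE; have := ltn_ord k; natlia.
have h : \sum_(k < m.+1) (x k)^H * conv phi y (k + d) = y 0%N.
  apply: toeplitz_pairing => // k mk; rewrite convy ifT; last by natlia.
  have -> : (k + d - m)%N = ((k - m) + d)%N by natlia.
  by rewrite xT; case: (k - m)%N (subn_gt0 m k); rewrite mk.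
have -> : conv analytic_part x m = (y 0%N)^H.
  rewrite -h adj_sum; apply: eq_bigr => k _; rewrite adjM adjK; congr (_ * _).
  rewrite convy /analytic_part; have km : (k <= m)%N by rewrite -ltnS.
  have -> : (m - k <= d)%N = (m <= k + d)%N by natlia.
  by case: ifP => mkd; rewrite ?adj0//; congr ((conv phi x _)^H); natlia.
by rewrite /y; case: m {y ynull convy h} => //= m; rewrite adj0.
Qed.

End Toeplitz.

(** * Factorization of trigonometric polynomials *)

Section Truncation.
Context {R : realType} {V : hilbertType R}.
Implicit Types (g h : nat -> endo V) (d K : nat).

Definition trunc K h : nat -> endo V := fun k => if (k < K)%N then h k else 0.

Lemma trunc_ge K h k : (K <= k)%N -> trunc K h k = 0.
Proof. by rewrite /trunc leqNgt => /negbTE ->. Qed.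

Lemma conv_trunc_lt g h K i : (i < K)%N -> conv g (trunc K h) i = conv g h i.
Proof.
move=> iK; apply: eq_bigr => k _; rewrite /trunc ifT//.
by rewrite (leq_trans (ltn_ord k)).
Qed.

(** The coefficients of [h] merely tend to zero, so its series need not converge on the circle.
    Truncating it spoils [g h = 1] only at indices from [K] to [K + d], and there by little. *)
Lemma conv_trunc_tail g h d : (forall j, (d < j)%N -> g j = 0) ->
  conv g h = delta -> null_seq h -> forall e : R, 0 < e ->
  exists K0, forall K i, (K0 < K)%N -> (K <= i)%N ->
    nm (conv g (trunc K h) i) <= e.
Proof.
move=> g0 gh hnull e e0.
pose G := \sum_(j < d.+1) nm (g j).
have gG j : nm (g j) <= G.
  have G0 : 0 <= G by apply: sumr_ge0 => i _; exact: nm_ge0.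
  have [dj|jd] := ltnP d j; first by rewrite g0// nm0.
  have jd' : (j < d.+1)%N by [].
  rewrite /G (bigD1 (Ordinal jd'))//= lerDl.
  by apply: sumr_ge0 => i _; exact: nm_ge0.
pose L := d.+1%:R * G + 1.
have L0 : 0 < L.
  by rewrite ltr_wpDl// mulr_ge0 ?ler0n// (le_trans (nm_ge0 _) (gG 0%N)).
have [N hN] := hnull _ (divr_gt0 e0 L0).
exists N => K i NK Ki.
have [di|id] := ltnP (K + d) i.
  rewrite (_ : conv _ _ _ = 0) ?nm0 ?(ltW e0)//; apply: endo_ext => v.
  rewrite conv_app (@vconv_support _ _ g _ d.+1 K)//; last by natlia.
  by move=> k /trunc_ge ->.
(* The full convolution vanishes at [i], so the truncated one is minus the omitted part, which has
   at most [d.+1] terms. *)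
have -> : conv g (trunc K h) i =
    - \sum_(j < i.+1 - K) g (i - (K + j))%N * h (K + j)%N.
  apply/eqP; rewrite -addr_eq0; apply/eqP.
  have ghi : conv g h i = 0 by rewrite gh; case: (i) Ki NK => //; case: (K).
  rewrite -[RHS]ghi.
  have Ki' : i.+1 = (K + (i.+1 - K))%N by natlia.
  have spl (f : nat -> endo V) : \sum_(k < i.+1) f k =
      \sum_(k < K) f k + \sum_(j < i.+1 - K) f (K + j)%N.
    transitivity (\sum_(k < K + (i.+1 - K)) f k); first by rewrite -Ki'.
    by rewrite big_split_ord.
  rewrite /conv (spl (fun k => g (i - k)%N * h k)).
  rewrite (spl (fun k => g (i - k)%N * trunc K h k)); congr (_ + _).
  rewrite [X in _ + X]big1 ?addr0 => [|j _].
    by apply: eq_bigr => k _; rewrite /trunc ltn_ord.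
  by rewrite trunc_ge ?mulr0// leq_addr.
rewrite nmN (le_trans (nm_sum _ _ _))//.
apply: (@le_trans _ _ (\sum_(j < i.+1 - K) (G * (e / L)))).
  apply: ler_sum => j _; rewrite (le_trans (nmM _ _))//.
  by apply: ler_pM; rewrite ?nm_ge0// ltW// hN//; natlia.
rewrite sumr_const card_ord -[X in X <= _]mulr_natl mulrA.
apply: (@le_trans _ _ (L * (e / L))); last by rewrite mulrC divfK ?gt_eqF.
have G0 : 0 <= G := le_trans (nm_ge0 _) (gG 0%N).
rewrite ler_wpM2r ?divr_ge0 ?(ltW e0) ?(ltW L0)//.
apply: (@le_trans _ _ (d.+1%:R * G)); last by rewrite /L lerDl.
by rewrite ler_wpM2r// ler_nat; natlia.
Qed.

(** On the closed disc the product with a long truncation of [h] is [1 - E] with [|E| <= 1/2], which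
    a Neumann series inverts. *)
Lemma peval_right_inverse g h d z : (forall j, (d < j)%N -> g j = 0) ->
  conv g h = delta -> null_seq h -> cabs z <= 1 ->
  exists S, peval g d.+1 z * S = 1.
Proof.
move=> g0 gh hnull z1.
(* The [d.+1] spoiled coefficients then add up to at most [1/2]. *)
pose e : R := (d.+1%:R * 2)^-1.
have e0 : 0 < e by rewrite invr_gt0 mulr_gt0 ?ltr0n.
have [K0 hK] := conv_trunc_tail g0 gh hnull e0.
pose K := K0.+1; have := hK K _ (ltnSn K0) => {}hK.
pose E := 1 - peval g d.+1 z * peval (trunc K h) K z.
have nE : nm E <= 2^-1.
  rewrite /E (peval_conv _ g0); last by move=> k; exact: trunc_ge.
  rewrite /peval addnC big_split_ord/= [X in 1 - (X + _)](_ : _ = 1); last first.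
    rewrite /K big_ord_recl expr0 scale1r conv_trunc_lt// gh big1 ?addr0// => k _.
    by rewrite conv_trunc_lt ?gh ?scaler0// ltnS ltn_ord.
  rewrite opprD addrA subrr add0r nmN (le_trans (nm_sum _ _ _))//.
  apply: (@le_trans _ _ (\sum_(j < d.+1) e)).
    apply: ler_sum => j _; rewrite nmZ cabsX -[X in _ <= X]mul1r.
    apply: ler_pM; rewrite ?exprn_ge0 ?cabs_ge0 ?nm_ge0 ?hK ?leq_addr//.
    by rewrite exprn_ile1 ?cabs_ge0.
  rewrite sumr_const card_ord -[X in X <= _]mulr_natl /e.
  have d0 : (d.+1%:R : R) != 0 by rewrite pnatr_eq0.
  by move: d.+1%:R d0 => r r0; rewrite le_eqVlt; apply/orP; left; apply/eqP; field.
have h21 : (2^-1 : R) < 1 by rewrite invf_lt1// ltr1n.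
have [L [_ L2 _]] := neumann nE h21.
exists (peval (trunc K h) K z * L); rewrite mulrA.
by rewrite -[X in X * L](subKr 1).
Qed.

Lemma peval_adj g n z :
  (peval g n z)^H = peval (fun k => (g k)^H) n (Num.conj z).
Proof.
rewrite /peval adj_sum; apply: eq_bigr => k _.
by rewrite adjZ rmorphXn.
Qed.

Lemma conv_adj g h i : (conv h g i)^H = conv (fun k => (g k)^H) (fun k => (h k)^H) i.
Proof.
rewrite /conv adj_sum (reindex_inj rev_ord_inj)/=; apply: eq_bigr => k _.
rewrite adjM subSS; congr (_ * (h _)^H).
by rewrite subKn// -ltnS.
Qed.

(** A left inverse is the adjoint of a right inverse for the polynomial with adjoint coefficients at
    [Num.conj z]. *)
Lemma peval_invertible g h d z : (forall j, (d < j)%N -> g j = 0) ->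
  conv g h = delta -> conv h g = delta -> null_seq h -> cabs z <= 1 ->
  invertible (peval g d.+1 z).
Proof.
move=> g0 gh hg hnull z1.
have [S PS] := peval_right_inverse g0 gh hnull z1.
have [||||S' PS'] := @peval_right_inverse (fun k => (g k)^H) (fun k => (h k)^H) d (Num.conj z).
- by move=> j dj; rewrite g0// adj0.
- apply/funext => i; rewrite -conv_adj hg; case: i => [|i] /=; rewrite ?adj1 ?adj0//.
- by move=> e /hnull[N hN]; exists N => n Nn; rewrite nm_adj hN.
- by rewrite cabs_conj.
apply: (@invertible_lr _ _ S'^H S) => //.
by rewrite -[peval _ _ _]adjK peval_adj -adjM PS' adj1.
Qed.

End Truncation.

(** * Spectral factors and Parseval comparison of two of them *)

Section Spectral.
Context {R : realType} {V : hilbertType R}.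
Implicit Types (F : R[i] -> endo V) (C : endo V) (g h : nat -> endo V) (d : nat).

(* [F = G^* C G] on the circle for the polynomial [G] with coefficients [g],
   whose inverse has the power series coefficients [h]. *)
Definition spectral F d C g h :=
  [/\ posdef C, g 0%N = 1 & forall j, (d < j)%N -> g j = 0] /\
  [/\ conv g h = delta, conv h g = delta, null_seq h
    & forall w, cabs w = 1 -> F w = (peval g d.+1 w)^H * C * peval g d.+1 w].

Lemma peval_widen g m n z : (m <= n)%N -> (forall k, (m <= k)%N -> g k = 0) ->
  peval g n z = peval g m z.
Proof.
move=> mn g0; apply: endo_ext => v; rewrite !peval_app; apply: veval_widen => //.
by move=> k /g0 ->.
Qed.

Lemma spectral_exists (phi : nat -> endo V) d (c M : R) :
  (forall j, (d.*2 < j)%N -> phi j = 0) ->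
  (forall j, (j <= d.*2)%N -> (phi (d.*2 - j)%N)^H = phi j) ->
  (forall w, cabs w = 1 -> (trig_poly phi d w)^H = trig_poly phi d w) ->
  (forall w, cabs w = 1 -> bounded_below c (trig_poly phi d w)) ->
  (forall w, cabs w = 1 -> forall v, qf (trig_poly phi d w) v <= M * nm v ^+ 2) ->
  0 < c -> c < M ->
  exists C g h, spectral (trig_poly phi d) d C g h /\
    forall A, unital_Cstar_subalgebra A -> (forall j, A (phi j)) ->
      A C /\ forall j, A (g j).
Proof.
move=> phi0 phiH symF Fge Fle c0 cM.
have [x [xT xnull xA]] := toeplitz_solution phi0 symF Fge Fle c0 cM.
pose g := analytic_part phi d x.
have gx := toeplitz_factor phi0 phiH c0 cM xT xnull.
have g00 : g 0%N = 1.
  by rewrite /g /analytic_part leq0n subn0 -{1}[d]add0n xT adj1.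
have x0H : (x 0%N)^H = x 0%N.
  by rewrite -(gx 0%N) /conv big_ord1 subn0 -/g g00 mul1r.
have px : posdef (x 0%N).
  split=> //; exists (M *+ 2)^-1; last exact: (toeplitz_head_ge phi0 symF Fge Fle c0 cM).
  by rewrite invr_gt0 pmulrn_lgt0// (lt_trans c0).
have [xi1 xi2] := inverseP (posdef_invertible px).
pose C := inverse (x 0%N); pose h k := x k * C.
have gd j : (d < j)%N -> g j = 0.
  by move=> dj; rewrite /g /analytic_part ifF//; apply/negbTE; rewrite -ltnNge.
have convC a i : conv a h i = conv a x i * C.
  by rewrite /conv mulr_suml; apply: eq_bigr => k _; rewrite mulrA.
have gh : conv g h = delta.
  apply/funext => i; rewrite convC gx; case: i => [|i] /=; last by rewrite mul0r.
  by rewrite x0H.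
have hg : conv h g = delta by exact: conv_unit_comm.
have CH : C^H = C by apply: inverse_adj => //; exact: posdef_invertible.
exists C, g, h; split; last first.
  move=> A AP Aphi; have Ax := xA A AP Aphi; split.
    by apply: (posdef_inverse px).2.
  move=> j; rewrite /g /analytic_part; case: ifP => _; last exact: salg0.
  apply: (salg_adj AP); apply: (salg_sum AP) => k _; exact: salgM.
split; first by split=> //; exact: posdef_inverse_posdef.
split=> //.
  move=> e e0; have C1 : 0 < nm C + 1 by rewrite ltr_wpDl ?nm_ge0.
  have [N hN] := xnull _ (divr_gt0 e0 C1); exists N => n /hN.
  rewrite ltr_pdivlMr// => hn; rewrite (le_lt_trans (nmM _ _))//.
  by rewrite (le_lt_trans _ hn)// ler_wpM2l ?nm_ge0// lerDl.
move=> w w1.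
(* Shifted coefficients of [F G^-1], with [h] the series of [G^-1 = X x_0^-1]. They turn out to be
   those of [G^H C], and multiplying by [g] on the right gives the factorization. *)
pose psi := conv phi h.
have psi0 j : (d < j)%N -> psi j = 0.
  move=> dj; rewrite /psi convC -(subnK (ltnW dj)) xT.
  by case: (j - d)%N (subn_gt0 d j) => [|k]; rewrite ?dj ?mul0r.
have psiE j : (j <= d)%N -> psi j = (g (d - j)%N)^H * C.
  by move=> jd; rewrite /psi convC /g /analytic_part leq_subr adjK subKn.
have phiE : phi = conv psi g.
  by rewrite /psi -convA hg conv_delta_r.
have -> : trig_poly phi d w = Num.conj w ^+ d *: (peval psi d.+1 w * peval g d.+1 w).
  rewrite /trig_poly peval_conv// -phiE; congr (_ *: _).
  by apply/esym/peval_widen => //; natlia.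
rewrite -endoZl; congr (_ * _).
rewrite /peval scaler_sumr adj_sum mulr_suml (reindex_inj rev_ord_inj)/=.
apply: eq_bigr => k _; have kd : (k <= d)%N by rewrite -ltnS.
rewrite subSS psiE ?leq_subr// subKn// adjZ endoZl scalerA rmorphXn; congr (_ *: _).
rewrite -{1}(subnKC kd) exprD -mulrA -exprMn mulrC.
by rewrite (mulrC (Num.conj w)) unit_mod_conj// expr1n mul1r.
Qed.

Lemma spectral_const (c : R) : 0 < c ->
  spectral (fun=> c%:C *: (1 : endo V)) 0 (c%:C *: (1 : endo V)) delta delta.
Proof.
move=> c0; split; first (split=> //; last by case).
  split; first by rewrite adjZ adj1 conj_real.
  by exists c => // v; rewrite qfZ qf1.
split; rewrite ?conv_delta_l//.
  by move=> e e0; exists 1%N => -[|n] //= _; rewrite nm0.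
move=> w _; rewrite /peval big_ord1 expr0 scale1r adj1.
by rewrite mul1r mulr1.
Qed.

Lemma spectral_parseval F d C g h (p : nat -> V) K N w : spectral F d C g h ->
  (forall k, (K <= k)%N -> p k = 0) -> N.-primitive_root w -> (d.+1 + K <= N)%N ->
  \sum_(s < N) qf (F (w ^+ s)) (veval p K (w ^+ s)) =
  N%:R * \sum_(i < d.+1 + K) qf C (vconv g p i).
Proof.
move=> [[pC g1 g0] [gh hg hnull FE]] p0 wN LN.
rewrite /qf -(parseval (fun i => C (vconv g p i)) (vconv g p) wN LN).
apply: eq_bigr => s _; rewrite FE; last by rewrite cabsX (prim_root_cabs wN) expr1n.
rewrite -/(qf _ _) qf_conj /qf (peval_veval _ g0 p0); congr ip.
by rewrite /veval endo_sum; apply: eq_bigr => i _; rewrite endoZ.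
Qed.

(** Integrate [F1 <= t F2] against [p = G2^-1 v]: the left side is the sum over all coefficients of
    [G1 G2^-1 v], the right side collapses to [t <C2 v, v>]. In the proof [p] is truncated at [K]
    and the resulting tail on the right is made small. *)
Lemma spectral_compare F1 d1 C1 g1 h1 F2 d2 C2 g2 h2 (t : R) :
  spectral F1 d1 C1 g1 h1 -> spectral F2 d2 C2 g2 h2 -> 0 <= t ->
  (forall w, cabs w = 1 -> forall v, qf (F1 w) v <= t * qf (F2 w) v) ->
  forall J v, \sum_(j < J) qf C1 (conv g1 h2 j v) <= t * qf C2 v.
Proof.
move=> s1 s2 t0 F12 J v.
have [[pC1 _ _] _] := s1; have [[pC2 _ g20] [gh2 _ hnull _]] := s2.
apply/ler_addgt0Pl => e e0.
pose B := t * (d2.+1%:R * nm C2 * nm v ^+ 2) + 1.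
have tB : 0 <= t * (d2.+1%:R * nm C2 * nm v ^+ 2).
  by rewrite !mulr_ge0 ?ler0n ?nm_ge0 ?sqr_ge0.
have B0 : 0 < B by rewrite ltr_wpDl.
pose b := Num.min 1 (e / B).
have b0 : 0 < b by rewrite lt_min ltr01 divr_gt0.
have [K0 hK] := conv_trunc_tail g20 gh2 hnull b0.
pose K := (K0 + J).+1.
have K0K : (K0 < K)%N by rewrite /K ltnS leq_addr.
have JK : (J <= K)%N by rewrite /K; natlia.
pose p k := trunc K h2 k v.
have p0 k : (K <= k)%N -> p k = 0 by move=> /trunc_ge; rewrite /p => ->.
have pE g i : vconv g p i = conv g (trunc K h2) i v by rewrite conv_app.
pose N := ((d1.+1 + K) + (d2.+1 + K))%N.
have N0 : (0 < N)%N by rewrite /N addSn.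
have [w wN] := @prim_root_exists R _ N0.
have L1 : (d1.+1 + K <= N)%N by rewrite /N leq_addr.
have L2 : (d2.+1 + K <= N)%N by rewrite /N leq_addl.
have Nr : 0 < N%:R :> R by rewrite ltr0n.
have C1ge u : 0 <= qf C1 u by exact: posdef_gt0.
apply: (@le_trans _ _ (\sum_(i < d1.+1 + K) qf C1 (vconv g1 p i))).
  have -> : (d1.+1 + K)%N = (J + (d1.+1 + K - J))%N by natlia.
  rewrite big_split_ord/= ler_wpDr ?sumr_ge0//.
  apply: ler_sum => i _; rewrite pE conv_trunc_lt//.
  exact: leq_trans (ltn_ord i) JK.
apply: (@le_trans _ _ (t * \sum_(i < d2.+1 + K) qf C2 (vconv g2 p i))).
  rewrite -(ler_pM2l Nr) mulrCA -(spectral_parseval s1 p0 wN L1).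
  rewrite -(spectral_parseval s2 p0 wN L2) mulr_sumr.
  apply: ler_sum => s _; apply: F12.
  by rewrite cabsX (prim_root_cabs wN) expr1n.
have -> : \sum_(i < d2.+1 + K) qf C2 (vconv g2 p i) =
    qf C2 v + \sum_(j < d2.+1) qf C2 (vconv g2 p (K + j)).
  rewrite (addnC d2.+1) big_split_ord/=; congr (_ + _).
  rewrite /K big_ord_recl pE conv_trunc_lt// gh2 big1 ?addr0// => i _.
  by rewrite pE conv_trunc_lt ?gh2 /qf ?ip0r// ltnS ltn_ord.
rewrite mulrDr addrC lerD2r.
apply: (@le_trans _ _ (t * (\sum_(j < d2.+1) (nm C2 * (b * nm v ^+ 2))))).
  rewrite ler_wpM2l//; apply: ler_sum => j _; rewrite (le_trans (qf_le _ _))//.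
  rewrite ler_wpM2l ?nm_ge0// pE.
  apply: (@le_trans _ _ ((b * nm v) ^+ 2)).
    rewrite lerXn2r ?nnegrE ?mulr_ge0 ?nm_ge0 ?(ltW b0)//.
    by rewrite (le_trans (nm_app _ _))// ler_wpM2r ?nm_ge0// hK// leq_addr.
  rewrite exprMn ler_wpM2r ?sqr_ge0// expr2 ler_piMl ?(ltW b0)//.
  by rewrite /b ge_min lexx.
rewrite sumr_const card_ord -[X in t * X]mulr_natl.
have -> : t * (d2.+1%:R * (nm C2 * (b * nm v ^+ 2))) =
    (t * (d2.+1%:R * nm C2 * nm v ^+ 2)) * b by ring.
apply: (@le_trans _ _ (B * (e / B))); last by rewrite mulrC divfK ?gt_eqF.
apply: ler_pM => //; [exact: ltW| |].
  by rewrite /B lerDl.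
by rewrite /b ge_min lexx orbT.
Qed.

End Spectral.

(** * Approximation by trigonometric polynomials *)

(** Absorbs a linear factor into a slightly larger geometric rate. *)
Lemma natmul_expr_le {R : realType} (s t : R) (n : nat) : 0 < s -> s < t ->
  n%:R * s ^+ n <= s / (t - s) * t ^+ n.
Proof.
move=> s0 st; have ts : 0 < t - s by rewrite subr_gt0.
elim: n => [|n ih]; first by rewrite mul0r expr0 mulr1 divr_ge0// ltW.
have sn : s ^+ n <= t ^+ n by rewrite lerXn2r ?nnegrE ?ltW// (lt_trans s0).
rewrite -natr1 mulrDl mul1r !exprS.
have -> : n%:R * (s * s ^+ n) = s * (n%:R * s ^+ n) by ring.
have -> : s / (t - s) * (t * t ^+ n) = s * (s / (t - s) * t ^+ n) + s * t ^+ n.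
  by field; rewrite gt_eqF.
by rewrite lerD// ler_wpM2l// ltW.
Qed.

(** Bounds the normalizing constant of the kernel [|1 + u|^(2n)], whose maximum is [4^n]; it shows
    that each normalized weight is at most 1. *)
Lemma central_bin_ge n : (4 ^ n <= n.*2.+1 * 'C(n.*2, n))%N.
Proof.
elim: n => [|n ih]; first by [].
have h1 : (n.+1 * 'C(n.+1.*2, n.+1) = n.+1.*2 * 'C(n.*2.+1, n))%N.
  by rewrite doubleS -mul_bin_diag.
have h2 : (n.+1 * 'C(n.*2.+1, n) = n.*2.+1 * 'C(n.*2, n))%N.
  by rewrite (mul_bin_down n.*2.+1 n) (_ : (n.*2.+1 - n)%N = n.+1)//; lia.
move: h1 h2 ih; rewrite expnS -(@leq_pmul2l n.+1)//.
move: ('C(n.+1.*2, n.+1)) ('C(n.*2.+1, n)) ('C(n.*2, n)) (4 ^ n)%N => a b c e; nia.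
Qed.

Section Approximation.
Context {R : realType} {V : hilbertType R}.
Variable F : R[i] -> endo V.
Hypothesis FH : forall w, cabs w = 1 -> (F w)^H = F w.
Variable M : R.
Hypothesis FM : forall w, cabs w = 1 -> nm (F w) <= M.
Hypothesis Funif : forall e : R, 0 < e -> exists2 a : R, 0 < a &
  forall z w, cabs z = 1 -> cabs w = 1 -> cabs (z - w) < a -> nm (F z - F w) < e.

Section Kernel.
Variables (n : nat) (om : R[i]).
Let N := n.*2.+1.
Hypothesis omN : N.-primitive_root om.

Let rt (k : nat) := om ^+ k.
(** The constant coefficient of [|1 + u|^(2n)] on the circle is the central binomial coefficient, so
    this factor gives the [N] sample points total weight 1. *)
Let cn : R := (N%:R * ('C(n.*2, n))%:R)^-1.

(* Discrete convolution of [F] with the kernel [|1 + u| ^ 2n]. *)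
Definition kernel_coef (j : nat) : endo V :=
  (cn * ('C(n.*2, j))%:R)%:C *:
    \sum_(k < N) (Num.conj (rt k) ^+ j * rt k ^+ n) *: F (rt k).

Let rt1 k : cabs (rt k) = 1.
Proof. by rewrite /rt cabsX (prim_root_cabs omN) expr1n. Qed.

Lemma kernel_coef0 j : (n.*2 < j)%N -> kernel_coef j = 0.
Proof. by move=> nj; rewrite /kernel_coef bin_small// mulr0 scale0r. Qed.

Lemma kernel_coefH j : (j <= n.*2)%N -> (kernel_coef (n.*2 - j)%N)^H = kernel_coef j.
Proof.
move=> jn; rewrite /kernel_coef adjZ conj_real bin_sub//; congr (_ *: _).
rewrite adj_sum; apply: eq_bigr => k _; rewrite adjZ FH//; congr (_ *: _).
move: (rt k) (unit_mod_conj (rt1 k)) => z zz.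
have z0 : z != 0.
  by apply/eqP => z0; move/eqP: zz; rewrite z0 mul0r eq_sym oner_eq0.
have z'0 : Num.conj z != 0 by rewrite conjC_eq0.
rewrite rmorphM !rmorphXn/= conjCK.
apply: (@mulfI _ (Num.conj z ^+ n * z ^+ j)); first by rewrite mulf_neq0 ?expf_neq0.
transitivity ((z * Num.conj z) ^+ n * (z * Num.conj z) ^+ n).
  have -> : Num.conj z ^+ n * z ^+ j * (z ^+ (n.*2 - j) * Num.conj z ^+ n) =
      z ^+ j * z ^+ (n.*2 - j) * (Num.conj z ^+ n * Num.conj z ^+ n) by ring.
  by rewrite -exprD subnKC// -addnn !exprD !exprMn; ring.
transitivity ((z * Num.conj z) ^+ n * (z * Num.conj z) ^+ j).
  by rewrite zz !expr1n.
by rewrite !exprMn; ring.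
Qed.

Definition kernel_val (w : R[i]) (k : nat) : R :=
  cn * cabs (1 + w * Num.conj (rt k)) ^+ n.*2.

Lemma kernel_val_ge0 w k : 0 <= kernel_val w k.
Proof.
by rewrite mulr_ge0 ?exprn_ge0 ?cabs_ge0// invr_ge0 mulr_ge0 ?ler0n.
Qed.

Let kernel_valE w k : cabs w = 1 -> (kernel_val w k)%:C =
  Num.conj w ^+ n * \sum_(j < n.*2.+1) w ^+ j *
    ((cn * ('C(n.*2, j))%:R)%:C * (Num.conj (rt k) ^+ j * rt k ^+ n)).
Proof.
move=> w1; pose u := w * Num.conj (rt k).
have u1 : cabs u = 1 by rewrite cabsM cabs_conj w1 rt1 mulr1.
rewrite /kernel_val rmorphM/= -/u.
have -> : (cabs (1 + u) ^+ n.*2)%:C = Num.conj u ^+ n * (1 + u) ^+ n.*2.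
  (* For [|u| = 1] this turns the kernel into a shifted power of [1 + u], to which the binomial
     theorem applies. *)
  have h : Num.conj u * (1 + u) ^+ 2 = (cabs (1 + u) ^+ 2)%:C.
    rewrite rmorphXn/= cabsE normCK rmorphD rmorph1 expr2 mulrCA; congr (_ * _).
    by rewrite mulrDr mulr1 mulrC unit_mod_conj// addrC.
  by rewrite -mul2n !exprM rmorphXn/= -h exprMn.
rewrite addrC exprD1n !mulr_sumr; apply: eq_bigr => j _.
have -> : (cn * ('C(n.*2, j))%:R)%:C = cn%:C * ('C(n.*2, j))%:R :> R[i].
  by rewrite rmorphM rmorph_nat.
rewrite -mulr_natr.
by rewrite /u rmorphM/= conjCK !exprMn; ring.
Qed.

Lemma kernel_polyE w : cabs w = 1 ->
  trig_poly kernel_coef n w = \sum_(k < N) (kernel_val w k)%:C *: F (rt k).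
Proof.
move=> w1; rewrite /trig_poly /peval /kernel_coef scaler_sumr.
under eq_bigr do rewrite !scaler_sumr.
rewrite exchange_big/=; apply: eq_bigr => k _.
under eq_bigr do rewrite !scalerA.
rewrite -scaler_suml kernel_valE// mulr_sumr; congr (_ *: _).
by apply: eq_bigr => j _; rewrite !mulrA.
Qed.

Lemma kernel_mass w : cabs w = 1 -> \sum_(k < N) kernel_val w k = 1.
Proof.
move=> w1; apply: complexI; rewrite rmorph_sum/=.
have C0 : (0 < 'C(n.*2, n))%N by rewrite bin_gt0; lia.
under eq_bigr do rewrite kernel_valE// mulr_sumr.
rewrite exchange_big/=.
have nn : (n < n.*2.+1)%N by lia.
rewrite (bigD1 (Ordinal nn))//= [X in _ + X]big1 ?addr0 => [|j jn].
  rewrite (eq_bigr (fun=> N%:R^-1)) => [|k _].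
    by rewrite sumr_const card_ord -[LHS]mulr_natl mulfV// pnatr_eq0.
  rewrite -exprMn (mulrC (Num.conj (rt k))) unit_mod_conj// expr1n mulr1.
  rewrite mulrA -exprMn (mulrC (Num.conj w)) unit_mod_conj// expr1n mul1r.
  have -> : cn * ('C(n.*2, n))%:R = N%:R^-1.
    by rewrite /cn; field; rewrite !pnatr_eq0 -!lt0n C0.
  by rewrite fmorphV/= rmorph_nat.
rewrite -mulr_sumr -mulr_sumr -mulr_sumr.
have -> : \sum_(k < N) Num.conj (rt k) ^+ j * rt k ^+ n = 0; last by rewrite !mulr0.
under eq_bigr do rewrite mulrC.
rewrite (root_mean (a := n) (b := j) omN)//.
have -> : (n == j) = false.
  by apply/negbTE; apply: contraNneq jn => jn; apply/eqP/val_inj.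
by rewrite mul0r.
Qed.

Lemma kernel_far w k (a : R) : cabs w = 1 -> 0 <= a <= 1 -> a <= cabs (rt k - w) ->
  kernel_val w k <= (1 - a ^+ 2 / 4) ^+ n.
Proof.
move=> w1 /andP[a0 a1] aw.
pose u := w * Num.conj (rt k).
have u1 : cabs u = 1 by rewrite cabsM cabs_conj w1 rt1 mulr1.
have u2 : cabs (1 - u) = cabs (rt k - w).
  have -> : rt k - w = (1 - u) * rt k.
    rewrite mulrBl mul1r /u -mulrA (mulrC (Num.conj _)) unit_mod_conj//.
    by rewrite mulr1.
  by rewrite cabsM rt1 mulr1.
have par : cabs (1 + u) ^+ 2 = 4 - cabs (1 - u) ^+ 2.
  have sq (y : R[i]) : (cabs y ^+ 2)%:C = y * Num.conj y.
    by rewrite rmorphXn/= cabsE normCK.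
  have uv := unit_mod_conj u1.
  have c1 : Num.conj (1 - u) = 1 - Num.conj u by rewrite rmorphB rmorph1.
  have c2 : Num.conj (1 + u) = 1 + Num.conj u by rewrite rmorphD rmorph1.
  have e4 : (4 : R)%:C = 4 :> R[i] by rewrite rmorph_nat.
  apply: complexI; rewrite sq c2 [RHS](rmorphB (real_complex R)) [X in X - _]e4.
  rewrite [X in _ - X]sq c1.
  by move: (Num.conj u) uv => v uv; ring: uv.
rewrite /kernel_val -/u -mul2n exprM par u2.
have C0 : (0 < 'C(n.*2, n))%N by rewrite bin_gt0; lia.
have r0 : 0 < N%:R * ('C(n.*2, n))%:R :> R by rewrite mulr_gt0 ?ltr0n.
rewrite /cn mulrC ler_pdivrMr//.
have b4 : 0 <= 4 - cabs (rt k - w) ^+ 2 by rewrite -u2 -par sqr_ge0.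
apply: (@le_trans _ _ ((4 - a ^+ 2) ^+ n)).
  rewrite lerXn2r ?nnegrE//; first by nra.
  by rewrite lerD2l lerN2 lerXn2r ?nnegrE ?cabs_ge0.
have -> : 4 - a ^+ 2 = (1 - a ^+ 2 / 4) * 4 by field.
rewrite exprMn ler_wpM2l ?exprn_ge0//; first by nra.
by rewrite -natrX -natrM ler_nat central_bin_ge.
Qed.

End Kernel.

Lemma trig_approx (e : R) : 0 < e -> exists n (phi : nat -> endo V),
  [/\ forall j, (n.*2 < j)%N -> phi j = 0,
      forall j, (j <= n.*2)%N -> (phi (n.*2 - j)%N)^H = phi j,
      forall w, cabs w = 1 -> (trig_poly phi n w)^H = trig_poly phi n w,
      forall w, cabs w = 1 -> nm (trig_poly phi n w - F w) <= e
    & forall A, unital_Cstar_subalgebra A -> (forall w, cabs w = 1 -> A (F w)) ->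
        forall j, A (phi j)].
Proof.
move=> e0; have e20 : 0 < e / 2 by rewrite divr_gt0.
have [a' a'0 ha'] := Funif e20.
pose a := Num.min 1 a'.
have a0 : 0 < a by rewrite lt_min ltr01.
have a1 : a <= 1 by rewrite ge_min lexx.
have aa' : a <= a' by rewrite ge_min lexx orbT.
pose s := 1 - a ^+ 2 / 4.
have a2 : 0 < a ^+ 2 by rewrite exprn_gt0.
have a21 : a ^+ 2 <= 1 by rewrite expr_le1// ltW.
have s0 : 0 < s by rewrite /s; lra.
have s1 : s < 1 by rewrite /s; lra.
(* There are [2n + 1] nodes, so the far ones contribute a multiple of [n * s ^+ n]; a rate strictly
   between [s] and 1 absorbs the factor [n]. *)
pose t := (1 + s) / 2.
have st : s < t by rewrite /t; lra.
have t01 : 0 <= t < 1 by rewrite /t; apply/andP; split; lra.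
have M0 : 0 <= M by rewrite (le_trans (nm_ge0 _) (FM cabs1)).
pose K := (2 * M) * (2 * (s / (t - s)) + 1).
have /cvgrPdist_lt/(_ _ e20)[n _ hn] := expr_lt_cvg0 K t01.
have {}hn : K * t ^+ n < e / 2.
  have := hn n (leqnn n); rewrite /= sub0r normrN; exact: le_lt_trans (ler_norm _).
have N0 : (0 < n.*2.+1)%N by [].
have [om omN] := @prim_root_exists R _ N0.
have rt1 k : cabs (om ^+ k) = 1 by rewrite cabsX (prim_root_cabs omN) expr1n.
exists n, (kernel_coef n om); split.
- exact: kernel_coef0.
- exact: kernel_coefH.
- move=> w w1; rewrite kernel_polyE// adj_sum; apply: eq_bigr => k _.
  by rewrite adjZ conj_real FH.
- move=> w w1; rewrite kernel_polyE//.
  have mass := kernel_mass omN w1.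
  have -> : F w = \sum_(k < n.*2.+1) (kernel_val n om w k)%:C *: F w.
    by rewrite -scaler_suml -rmorph_sum mass scale1r.
  rewrite -sumrB (le_trans (nm_sum _ _ _))//.
  apply: (@le_trans _ _ (\sum_(k < n.*2.+1) (kernel_val n om w k * (e / 2) + 2 * M * s ^+ n))).
    apply: ler_sum => k _; rewrite -scalerBr nmZ cabs_pos; last exact: kernel_val_ge0.
    have kv0 := kernel_val_ge0 n om w k.
    have [near|far] := ltP (cabs (om ^+ k - w)) a.
      rewrite ler_wpDr ?mulr_ge0 ?exprn_ge0 ?(ltW s0)// ler_wpM2l// ltW// ha'//.
      exact: lt_le_trans aa'.
    rewrite ler_wpDl//; first exact: mulr_ge0 (ltW e20).
    have a01 : 0 <= a <= 1 by rewrite (ltW a0).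
    rewrite mulrC; apply: ler_pM; rewrite ?nm_ge0//.
      rewrite (le_trans (nmB _ _))// mulr_natl mulr2n lerD ?FM//.
    exact: kernel_far.
  rewrite big_split/= -mulr_suml mass mul1r sumr_const card_ord.
  have sn := @natmul_expr_le R s t n s0 st.
  have /andP[t0 _] := t01.
  have stn : s ^+ n <= t ^+ n by rewrite lerXn2r ?nnegrE ?(ltW s0)// ltW.
  have : 2 * M * s ^+ n *+ n.*2.+1 <= K * t ^+ n.
    rewrite -[X in X <= _]mulr_natl -mul2n -natr1 natrM /K.
    have -> : (2 * n%:R + 1) * (2 * M * s ^+ n) =
        2 * M * (2 * (n%:R * s ^+ n) + s ^+ n) by ring.
    rewrite -[X in _ <= X]mulrA ler_wpM2l ?mulr_ge0// [X in _ <= X]mulrDl mul1r lerD//.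
    by rewrite -[X in _ <= X]mulrA ler_wpM2l.
  by move: (2 * M * s ^+ n *+ n.*2.+1) (K * t ^+ n) hn => X Y; lra.
- move=> A AP AF j; apply: (salgZ AP); apply: (salg_sum AP) => k _.
  by apply: (salgZ AP); apply: AF.
Qed.

End Approximation.

(** * Continuous functions on the disc and the circle *)

Section DiscCompactness.
Context {R : realType}.
Implicit Types (z w : R[i]) (K : set R[i]).

Lemma cabs_nm z : cabs z = nm (z : R[i]).
Proof. by []. Qed.

Lemma cabs_Re_Im z : cabs z <= `|complex.Re z| + `|complex.Im z|.
Proof.
rewrite {1}(complexE z) (le_trans (cabsD _ _))// cabsM cabs_real cabs_real.
by rewrite complexiE cabsi mul1r.
Qed.

Lemma Re_le_cabs z : `|complex.Re z| <= cabs z.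
Proof. by rewrite -lecR cabsE normc_ge_Re. Qed.

Lemma Im_le_cabs z : `|complex.Im z| <= cabs z.
Proof.
have := Re_le_cabs (z * 'i); rewrite -{1}complexiE ReiNIm normrN cabsM cabsi.
by rewrite mulr1.
Qed.

Lemma closed_discP z : closed_unit_disc z <-> cabs z <= 1.
Proof. by rewrite /closed_unit_disc/= -cabsE (_ : 1 = 1%:C)// lecR. Qed.

Lemma unit_discP z : unit_disc z <-> cabs z < 1.
Proof. by rewrite /unit_disc/= -cabsE (_ : 1 = 1%:C)// ltcR. Qed.

Lemma unit_circleP z : unit_circle z <-> cabs z = 1.
Proof.
rewrite /unit_circle/= -cabsE (_ : 1 = 1%:C)//.
by split=> [/complexI//|->].
Qed.

Lemma unit_disc_closed z : unit_disc z -> closed_unit_disc z.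
Proof. by move=> /unit_discP z1; apply/closed_discP; exact: ltW. Qed.

Lemma closed_disc_compact : compact (@closed_unit_disc R).
Proof.
pose f (p : R * R) : R[i] := p.1 +i* p.2.
pose S : set (R * R) := `[-1, 1]%classic `*` `[-1, 1]%classic.
have fc : continuous f.
  move=> [a b]; apply/cvg_nmP => e e0.
  have e20 : 0 < e / 2 by rewrite divr_gt0.
  have h1 : \forall x \near nbhs a, `|x - a| < e / 2.
    by have /cvgrPdist_lt/(_ _ e20) := @cvg_id _ (nbhs a); apply: filterS => x; rewrite distrC.
  have h2 : \forall x \near nbhs b, `|x - b| < e / 2.
    by have /cvgrPdist_lt/(_ _ e20) := @cvg_id _ (nbhs b); apply: filterS => x; rewrite distrC.
  exists ([set x | `|x - a| < e / 2], [set x | `|x - b| < e / 2]) => //.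
  move=> [x y] /= [xa yb]; apply: le_lt_trans (cabs_Re_Im (f (x, y) - f (a, b))) _ => /=.
  by rewrite [ltRHS](splitr e) ltrD.
have cS : compact (f @` S).
  apply: continuous_compact; first by apply: continuous_subspaceT => x; exact: fc.
  by apply: compact_setX; exact: segment_compact.
apply: (subclosed_compact _ cS).
  have -> : @closed_unit_disc R = ~` [set z | 1 < cabs z].
    by apply/seteqP; split=> z /=; [move/closed_discP|move=> h; apply/closed_discP; move: h];
      rewrite leNgt => /negP.
  apply: open_closedC; rewrite openE => z /= z1; apply/nbhs_nmP.
  exists (cabs z - 1); first by rewrite subr_gt0.
  move=> w; rewrite -cabs_nm cabsC => h /=.
  have := cabsD (z - w) w; rewrite subrK; lra.
move=> z /closed_discP z1; exists (complex.Re z, complex.Im z); last by case: z {z1}.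
by split=> /=; rewrite in_itv/= -ler_norml (le_trans _ z1)// ?Re_le_cabs ?Im_le_cabs.
Qed.

Lemma unit_circle_compact : compact (@unit_circle R).
Proof.
apply: (subclosed_compact _ closed_disc_compact); last first.
  by move=> z; rewrite /unit_circle /closed_unit_disc/= => ->.
have -> : @unit_circle R = ~` [set z | cabs z != 1].
  apply/seteqP; split=> z /=; first by move/unit_circleP=> ->; rewrite eqxx.
  by move=> /negP; rewrite negbK => /eqP h; apply/unit_circleP.
apply: open_closedC; rewrite openE => z /= z1; apply/nbhs_nmP.
exists `|cabs z - 1|; first by rewrite normr_gt0 subr_eq0.
move=> w; rewrite -cabs_nm => h /=; apply: contraTneq h => w1.
rewrite -leNgt -w1 ler_norml; apply/andP; split.
  by have := cabsD (w - z) z; rewrite subrK; lra.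
by have := cabsD (z - w) w; rewrite subrK cabsC; lra.
Qed.

(** Boundedness, uniform positivity and uniform continuity all follow from this one compactness
    argument: local constants for a property that persists when [a] decreases can be replaced by a
    global one. *)
Lemma compact_local K (Q : R -> R[i] -> Prop) : compact K ->
  (forall a b z, a <= b -> Q b z -> Q a z) ->
  (forall z, K z -> exists a r : R, [/\ 0 < a, 0 < r &
     forall w, K w -> cabs (w - z) < r -> Q a w]) ->
  exists2 a : R, 0 < a & forall z, K z -> Q a z.
Proof.
move=> /compact_near_coveringP/near_covering_withinP cK Qmon Qloc.
have : \forall a \near (0 : R)^'+, K `<=` Q a.
  apply: (cK R ((0 : R)^'+) Q) => z Kz.
  have [a [r [a0 r0 h]]] := Qloc z Kz.
  exists ([set w | cabs (w - z) < r], [set b | b < a]).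
    by split; [apply/nbhs_nmP; exists r|exact: nbhs_right_lt].
  by move=> [w b] /= [wz ba] Kw; apply: Qmon (h _ Kw wz); exact: ltW.
move=> h; have h2 : \forall a \near (0 : R)^'+, 0 < a /\ K `<=` Q a.
  by near=> a; split; near: a => //; exact: nbhs_right_gt.
by have [a [a0 Ka]] := filter_ex h2; exists a.
Unshelve. all: by end_near. Qed.

Section ContinuousOnCompact.
Context {V : hilbertType R}.
Implicit Types P : R[i] -> endo V.

Lemma within_continuousP K P : {within K, continuous P} <->
  forall z, K z -> forall e : R, 0 < e -> exists2 a : R, 0 < a &
    forall w, K w -> cabs (w - z) < a -> nm (P w - P z) < e.
Proof.
rewrite subspace_continuousP; split=> h z Kz.
  move=> e e0; have /cvg_nmP/(_ _ e0) := h z Kz.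
  by move=> /nbhs_nmP[a a0 ha]; exists a => // w Kw wz; exact: ha.
apply/cvg_nmP => e e0; have [a a0 ha] := h z Kz e e0.
by apply/nbhs_nmP; exists a => // w wz Kw; exact: ha.
Qed.

Lemma compact_bounded K P : compact K -> {within K, continuous P} ->
  exists2 M : R, 0 < M & forall z, K z -> nm (P z) <= M.
Proof.
move=> cK /within_continuousP Pc.
(* Here [a] is the reciprocal of the bound, which makes the property persist when [a] decreases. *)
have [||a a0 ha] := @compact_local K (fun a z => a * nm (P z) <= 1) cK.
- by move=> a b z ab; apply: le_trans; rewrite ler_wpM2r ?nm_ge0.
- move=> z Kz; have [r r0 hr] := Pc z Kz 1 ltr01.
  have P1 : 0 < nm (P z) + 1 by rewrite ltr_wpDl ?nm_ge0.
  exists (nm (P z) + 1)^-1, r; split; rewrite ?invr_gt0// => w Kw wz.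
  rewrite ler_pdivrMl// mulr1 -[P w](subrK (P z)) addrC.
  by rewrite (le_trans (nmD _ _))// lerD2l ltW// hr.
exists a^-1; first by rewrite invr_gt0.
by move=> z /ha; rewrite -ler_pdivlMl// mulr1.
Qed.

Lemma compact_bounded_below K P : compact K -> {within K, continuous P} ->
  (forall z, K z -> exists2 c : R, 0 < c & bounded_below c (P z)) ->
  exists2 c : R, 0 < c & forall z, K z -> bounded_below c (P z).
Proof.
move=> cK /within_continuousP Pc Pb.
apply: (compact_local cK) => [a b z ab h v|z Kz].
  by apply: le_trans (h v); rewrite ler_wpM2r ?sqr_ge0.
have [c c0 hc] := Pb z Kz.
have c20 : 0 < c / 2 by rewrite divr_gt0.
have [r r0 hr] := Pc z Kz _ c20.
exists (c / 2), r; split=> // w Kw wz v.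
have -> : qf (P w) v = qf (P z) v + qf (P w - P z) v by rewrite qfB addrC subrK.
have h1 : `|qf (P w - P z) v| <= c / 2 * nm v ^+ 2.
  apply: le_trans (qf_norm_le _ _) _.
  by rewrite ler_wpM2r ?sqr_ge0// ltW// hr.
have := hc v; move: h1; rewrite ler_norml => /andP[+ _].
move: (qf _ _) (qf _ _) (nm v ^+ 2) => A B D; lra.
Qed.

Lemma compact_uniform K P : compact K -> {within K, continuous P} ->
  forall e : R, 0 < e -> exists2 a : R, 0 < a & forall z w, K z -> K w ->
    cabs (z - w) < a -> nm (P z - P w) < e.
Proof.
move=> cK /within_continuousP Pc e e0.
have e20 : 0 < e / 2 by rewrite divr_gt0.
pose Q a z := forall w, K w -> cabs (z - w) < a -> nm (P z - P w) < e.
have [||a a0 ha] := @compact_local K Q cK.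
- by move=> a b z ab h w Kw wz; apply: h => //; exact: lt_le_trans ab.
- move=> z Kz; have [r r0 hr] := Pc z Kz _ e20.
  exists (r / 2), (r / 2); split; rewrite ?divr_gt0// => w Kw wz w' Kw' ww'.
  have h1 : nm (P w - P z) < e / 2.
    by apply: hr => //; apply: lt_le_trans wz _; lra.
  have h2 : nm (P w' - P z) < e / 2.
    apply: hr => //.
    have := cabsD (w' - w) (w - z); rewrite addrA subrK.
    by move: wz ww'; rewrite [cabs (w - w')]cabsC; lra.
  apply: le_lt_trans (nm_tri _ (P z) _) _.
  by rewrite [ltRHS](splitr e); apply: ltrD; [exact: h1|rewrite nmC].
by exists a => // z w Kz Kw; exact: ha.
Qed.

End ContinuousOnCompact.

End DiscCompactness.

(** * Directional derivatives *)

Lemma endoN {R : realType} {V : normedModType R[i]} (T : endo V) v :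
  T (- v) = - T v.
Proof. exact: linearN. Qed.

(* Decides equalities of real linear combinations of products of operators by
   evaluating the form [(v, w) |-> ip (T v) w]. *)
Ltac endo_ring :=
  apply: endo_ext => ?; apply: ip_ext => ?;
  do 5! rewrite ?endo_subE ?endo_addE ?endo_oppE ?endo_scaleE ?endo_mulE
    ?endoB ?endoD ?endoN ?endoZ;
  rewrite !(ipDl, ipBl, ipNl, ipZl); (ring || field).

Section RealDerivatives.
Context {R : realType} {V : hilbertType R}.
Implicit Types (P Q : R[i] -> endo V) (z w : R[i]) (L : endo V) (h : R).

Definition has_rd P z w L := forall e : R, 0 < e -> exists2 a : R, 0 < a &
  forall h, `|h| < a -> nm (P (z + h%:C * w) - P z - h%:C *: L) <= e * `|h|.

Lemma has_rd_cvg P z w L : has_rd P z w L <-> real_quotient P z w @ 0^' --> L.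
Proof.
split=> [PL|PL].
  apply/cvg_nmP => e e0; have e20 : 0 < e / 2 by rewrite divr_gt0.
  have [a a0 ha] := PL _ e20.
  have : \forall h \near (0 : R)^', h != 0 by exact: nbhs_dnbhs_neq.
  have : \forall h \near (0 : R)^', `|h| < a.
    by apply: dnbhs0_lt.
  apply: filterS2 => h hlt h0; rewrite /real_quotient.
  have hC : h%:C != 0 :> R[i] by rewrite (inj_eq (@complexI R)).
  rewrite -[L in _ - L](@scalerK _ _ h%:C)// -fmorphV/= -scalerBr nmZ.
  rewrite cabs_real normrV ?unitfE// mulrC ltr_pdivrMr ?normr_gt0//.
  apply: le_lt_trans (ha h hlt) _; rewrite ltr_pM2r ?normr_gt0//; lra.
move=> e e0; move/cvg_nmP : PL => /(_ _ e0) /nbhs_ballP[a /= a0 ha].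
exists a => // h hlt; have [->|h0] := eqVneq h 0.
  by rewrite mul0r addr0 subrr scale0r subr0 nm0 normr0 mulr0.
have := ha h; rewrite /ball/= sub0r normrN => /(_ hlt h0).
rewrite /real_quotient => /ltW hle.
have hC : h%:C != 0 :> R[i] by rewrite (inj_eq (@complexI R)).
have -> : P (z + h%:C * w) - P z - h%:C *: L =
    h%:C *: (h^-1%:C *: (P (z + h%:C * w) - P z) - L).
  by rewrite scalerBr fmorphV/= scalerA mulfV// scale1r.
by rewrite nmZ cabs_real mulrC ler_wpM2r.
Qed.

Lemma real_derive_has P z w : real_derivable P z w -> has_rd P z w (real_derive w P z).
Proof. by move=> Pd; apply/has_rd_cvg. Qed.

Lemma has_rd_derivable P z w L : has_rd P z w L -> real_derivable P z w.
Proof. by move=> /has_rd_cvg PL; apply/cvg_ex; exists L. Qed.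

Lemma has_rd_derive P z w L : has_rd P z w L -> real_derive w P z = L.
Proof. by move=> /has_rd_cvg PL; apply: cvg_lim. Qed.

Lemma has_rd_uniq P z w L L' : has_rd P z w L -> has_rd P z w L' -> L = L'.
Proof. by move=> /has_rd_derive <- /has_rd_derive. Qed.

Lemma has_rd_ext P Q z w L (a : R) : 0 < a ->
  (forall h, `|h| < a -> P (z + h%:C * w) = Q (z + h%:C * w)) ->
  has_rd P z w L -> has_rd Q z w L.
Proof.
move=> a0 PQ PL e e0; have [b b0 hb] := PL e e0.
exists (Num.min a b); first by rewrite lt_min a0.
move=> h; rewrite lt_min => /andP[ha hb'].
have := PQ 0; rewrite normr0 => /(_ a0); rewrite mul0r addr0 => <-.
by rewrite -PQ// hb.
Qed.

Lemma has_rd_cst T z w : has_rd (fun=> T) z w 0.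
Proof.
move=> e e0; exists 1 => // h _; rewrite subrr scaler0 subr0 nm0.
by rewrite mulr_ge0// ltW.
Qed.

Lemma has_rdD P Q z w K L : has_rd P z w K -> has_rd Q z w L ->
  has_rd (fun x => P x + Q x) z w (K + L).
Proof.
move=> PK QL e e0; have e20 : 0 < e / 2 by rewrite divr_gt0.
have [a a0 ha] := PK _ e20; have [b b0 hb] := QL _ e20.
exists (Num.min a b); first by rewrite lt_min a0.
move=> h; rewrite lt_min => /andP[h1 h2].
have -> x : P x + Q x - (P z + Q z) - h%:C *: (K + L) =
    (P x - P z - h%:C *: K) + (Q x - Q z - h%:C *: L) by endo_ring.
have -> : e * `|h| = e / 2 * `|h| + e / 2 * `|h| by field.
rewrite (le_trans (nmD _ _))// lerD//.
  exact: ha.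
exact: hb.
Qed.

Lemma has_rdZ (c : R[i]) P z w L : has_rd P z w L ->
  has_rd (fun x => c *: P x) z w (c *: L).
Proof.
move=> PL e e0; have c1 : 0 < cabs c + 1 by rewrite ltr_wpDl ?cabs_ge0.
have [a a0 ha] := PL _ (divr_gt0 e0 c1); exists a => // h /ha.
have -> x : c *: P x - c *: P z - h%:C *: (c *: L) = c *: (P x - P z - h%:C *: L).
  by rewrite !scalerBr !scalerA (mulrC c h%:C).
rewrite nmZ => le1.
apply: (@le_trans _ _ ((cabs c + 1) * (e / (cabs c + 1) * `|h|))).
  by apply: ler_pM; rewrite ?cabs_ge0 ?nm_ge0// lerDl.
by rewrite mulrA mulrC [X in _ * X]mulrC divfK ?gt_eqF// mulrC.
Qed.

Lemma has_rdN P z w L : has_rd P z w L -> has_rd (fun x => - P x) z w (- L).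
Proof.
by move=> /(has_rdZ (-1)); rewrite scaleN1r; under eq_fun do rewrite scaleN1r.
Qed.

Lemma has_rd_adj P z w L : has_rd P z w L -> has_rd (fun x => (P x)^H) z w L^H.
Proof.
move=> PL e e0; have [a a0 ha] := PL e e0; exists a => // h /ha.
by rewrite -nm_adj !adjB adjZ conj_real.
Qed.

Lemma has_rd_lip P z w L : has_rd P z w L -> exists2 a : R, 0 < a &
  forall h, `|h| < a -> nm (P (z + h%:C * w) - P z) <= (nm L + 1) * `|h|.
Proof.
move=> /(_ 1 ltr01)[a a0 ha]; exists a => // h /ha h1.
rewrite -[X in nm X](subrK (h%:C *: L)) (le_trans (nmD _ _))//.
by rewrite nmZ cabs_real mulrDl addrC lerD// mulrC.
Qed.

Lemma has_rdM P Q z w K L : has_rd P z w K -> has_rd Q z w L ->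
  has_rd (fun x => P x * Q x) z w (K * Q z + P z * L).
Proof.
move=> PK QL e e0.
pose A := nm (Q z) + 1; pose B := nm (P z) + 1; pose C := (nm K + 1) * (nm L + 1) + 1.
have A0 : 0 < A by rewrite ltr_wpDl ?nm_ge0.
have B0 : 0 < B by rewrite ltr_wpDl ?nm_ge0.
have C0 : 0 < C by rewrite ltr_wpDl// mulr_ge0 ?addr_ge0 ?nm_ge0.
have e30 : 0 < e / 3 by rewrite divr_gt0.
have [a1 a10 h1] := PK _ (divr_gt0 e30 A0).
have [a2 a20 h2] := QL _ (divr_gt0 e30 B0).
have [a3 a30 h3] := has_rd_lip QL.
have D0 : 0 < nm L + 1 by rewrite ltr_wpDl ?nm_ge0.
pose a := Num.min (Num.min a1 a2) (Num.min a3 (Num.min (e / 3 / C) (nm L + 1)^-1)).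
have a0 : 0 < a by rewrite !lt_min a10 a20 a30 !divr_gt0 ?invr_gt0.
exists a => // h; rewrite /a !lt_min => /andP[/andP[l1 l2] /and3P[l3 l4 l5]].
have {}h3 := h3 _ l3; have {}h1 := h1 _ l1; have {}h2 := h2 _ l2.
move: h1 h2 h3; set x := z + h%:C * w => h1 h2 h3.
have -> : P x * Q x - P z * Q z - h%:C *: (K * Q z + P z * L) =
  (P x - P z - h%:C *: K) * Q x + P z * (Q x - Q z - h%:C *: L) +
  h%:C *: (K * (Q x - Q z)) by endo_ring.
have hn := normr_ge0 h.
have QxA : nm (Q x) <= A.
  rewrite -[Q x](subrK (Q z)) addrC (le_trans (nmD _ _))// lerD2l.
  by rewrite (le_trans h3)// mulrC -ler_pdivlMr// mul1r ltW.
have -> : e * `|h| = e / 3 * `|h| + e / 3 * `|h| + `|h| * (e / 3) by field.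
rewrite (le_trans (nmD _ _))// lerD//; last first.
  rewrite nmZ cabs_real ler_wpM2l// (le_trans (nmM _ _))//.
  apply: (@le_trans _ _ (C * (e / 3 / C))); last by rewrite mulrC divfK ?gt_eqF.
  apply: (@le_trans _ _ (nm K * ((nm L + 1) * `|h|))).
    by rewrite ler_wpM2l ?nm_ge0.
  rewrite mulrA; apply: ler_pM => //; rewrite ?mulr_ge0 ?addr_ge0 ?nm_ge0//.
    rewrite /C; have := nm_ge0 K; have := nm_ge0 L; nra.
  exact: ltW.
rewrite (le_trans (nmD _ _))// lerD// (le_trans (nmM _ _))//.
  apply: (@le_trans _ _ (e / 3 / A * `|h| * A)).
    by apply: ler_pM; rewrite ?nm_ge0.
  by rewrite mulrAC divfK ?gt_eqF.
apply: (@le_trans _ _ (B * (e / 3 / B * `|h|))).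
  by apply: ler_pM; rewrite ?nm_ge0// /B lerDl.
by rewrite mulrA (mulrC B) divfK ?gt_eqF.
Qed.

(** From [S^-1 = T^-1 - S^-1 (S - T) T^-1], whose last term is at most half of [|S^-1|]. *)
Lemma inverse_bound (S T : endo V) : invertible S -> invertible T ->
  nm (S - T) * nm (inverse T) <= 2^-1 -> nm (inverse S) <= 2 * nm (inverse T).
Proof.
move=> /inverseP[S1 S2] /inverseP[T1 T2] ST.
have E : inverse S = inverse T - inverse S * (S - T) * inverse T.
  rewrite mulrBr mulrBl S1 mul1r -[X in _ - (_ - X)]mulrA T2 mulr1.
  by rewrite opprB addrC subrK.
have : nm (inverse S) <= nm (inverse T) + nm (inverse S) * 2^-1.
  rewrite {1}E (le_trans (nmB _ _))// lerD2l -mulrA (le_trans (nmM _ _))//.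
  by rewrite ler_wpM2l ?nm_ge0// (le_trans (nmM _ _)).
lra.
Qed.

Lemma has_rd_inverse P z w L (r : R) : 0 < r ->
  (forall h, `|h| < r -> invertible (P (z + h%:C * w))) -> has_rd P z w L ->
  has_rd (fun x => inverse (P x)) z w (- (inverse (P z) * L * inverse (P z))).
Proof.
move=> r0 Pi PL e e0.
have [I1 I2] : inverse (P z) * P z = 1 /\ P z * inverse (P z) = 1.
  by apply: inverseP; have := Pi 0; rewrite mul0r addr0; apply; rewrite normr0.
set I := inverse (P z) in I1 I2 *.
have [a3 a30 h3] := has_rd_lip PL.
pose K := nm I + 1; have K0 : 0 < K by rewrite ltr_wpDl ?nm_ge0.
pose D := nm L + 1; have D0 : 0 < D by rewrite ltr_wpDl ?nm_ge0.
have e1 : 0 < e / 2 / (2 * K * K) by rewrite !divr_gt0 ?mulr_gt0.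
have [a1 a10 h1] := PL _ e1.
pose a := Num.min (Num.min a1 a3) (Num.min r
  (Num.min (2^-1 / (D * K)) (e / 2 / (2 * K * D * K * D * K)))).
have a0 : 0 < a by rewrite !lt_min a10 a30 r0 !divr_gt0 ?mulr_gt0// invr_gt0.
exists a => // h; rewrite /a !lt_min => /andP[/andP[l1 l3] /and3P[lr l4 l5]].
have {}h3 := h3 _ l3; have {}h1 := h1 _ l1; have Ji := Pi _ lr.
move: h1 h3 Ji; set x := z + h%:C * w => h1 h3 Ji.
have [J1 J2] := inverseP Ji; set J := inverse (P x) in J1 J2 *.
have hn := normr_ge0 h.
have DhK : D * `|h| * K <= 2^-1.
  by rewrite mulrAC mulrC -ler_pdivlMr ?mulr_gt0// ltW.
have JK : nm J <= 2 * K.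
  apply: (@le_trans _ _ (2 * nm I)); last by rewrite ler_wpM2l// /K lerDl.
  apply: inverse_bound => //; first by exists I.
  apply: le_trans DhK; apply: ler_pM; rewrite ?nm_ge0//.
  by rewrite /K lerDl.
have JI : J - I = - (J * (P x - P z) * I).
  by rewrite mulrBr mulrBl J1 mul1r -(mulrA J (P z) I) I2 mulr1 opprB.
have JIn : nm (J - I) <= 2 * K * (D * `|h|) * K.
  rewrite JI nmN (le_trans (nmM _ _))//; apply: ler_pM; rewrite ?nm_ge0//.
    rewrite (le_trans (nmM _ _))//; apply: ler_pM; rewrite ?nm_ge0//.
  by rewrite /K lerDl.
have -> : J - I - h%:C *: - (I * L * I) =
    - (J * (P x - P z - h%:C *: L) * I) - h%:C *: ((J - I) * L * I).
  rewrite {1}JI; endo_ring.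
rewrite (le_trans (nmB _ _))// nmN nmZ cabs_real.
have -> : e * `|h| = e / 2 * `|h| + `|h| * (e / 2) by field.
apply: lerD.
  apply: (@le_trans _ _ (2 * K * (e / 2 / (2 * K * K) * `|h|) * K)).
    rewrite (le_trans (nmM _ _))//; apply: ler_pM; rewrite ?nm_ge0//.
      rewrite (le_trans (nmM _ _))//; apply: ler_pM; rewrite ?nm_ge0//.
    by rewrite /K lerDl.
  by rewrite le_eqVlt; apply/orP; left; apply/eqP; field; rewrite lt0r_neq0.
rewrite ler_wpM2l//.
apply: (@le_trans _ _ (2 * K * (D * `|h|) * K * D * K)).
  rewrite (le_trans (nmM _ _))//; apply: ler_pM; rewrite ?nm_ge0//.
    rewrite (le_trans (nmM _ _))//; apply: ler_pM; rewrite ?nm_ge0//.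
    by rewrite /D lerDl.
  by rewrite /K lerDl.
have -> : 2 * K * (D * `|h|) * K * D * K = `|h| * (2 * K * D * K * D * K) by ring.
by rewrite -ler_pdivlMr ?mulr_gt0// ltW.
Qed.

End RealDerivatives.

(** * Mean value bound and second order expansions along real lines *)

Section MeanValue.
Context {R : realType}.

Lemma is_derive_eps (f : R -> R) (x l : R) :
  (forall e : R, 0 < e -> exists2 a : R, 0 < a &
    forall t, `|t| < a -> `|f (x + t) - f x - t * l| <= e * `|t|) ->
  is_derive x (1 : R) f l.
Proof.
move=> h.
have fl : (fun t : R => t^-1 *: (f (t *: (1 : R) + x) - f x)) @ 0^' --> l.
  apply/cvgrPdist_le => e e0; have [a a0 ha] := h e e0.
  have : \forall t \near (0 : R)^', t != 0 by exact: nbhs_dnbhs_neq.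
  have : \forall t \near (0 : R)^', `|t| < a by apply: dnbhs0_lt.
  apply: filterS2 => t tlt t0.
  have := ha t tlt; rewrite /GRing.scale/= mulr1 (addrC t x).
  have -> : f (x + t) - f x - t * l = - t * (l - t^-1 * (f (x + t) - f x)).
    by field.
  by rewrite normrM normrN mulrC ler_pM2r ?normr_gt0.
by apply: DeriveDef; [apply/cvg_ex; exists l|exact: cvg_lim].
Qed.

Context {V : hilbertType R}.
Implicit Types (g : R -> endo V) (P : R[i] -> endo V).

Definition has_cd g (s : R) (L : endo V) := forall e : R, 0 < e ->
  exists2 a : R, 0 < a &
  forall t, `|t| < a -> nm (g (s + t) - g s - t%:C *: L) <= e * `|t|.

(** Reduces to the scalar mean value theorem for [ip (g s v) W], tested against the increment
    [W = (g 1 - g 0) v] itself. *)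
Lemma mean_value_bound g (dg : R -> endo V) (B : R) :
  (forall s, 0 <= s <= 1 -> has_cd g s (dg s)) ->
  (forall s, 0 <= s <= 1 -> nm (dg s) <= B) -> nm (g 1 - g 0) <= B.
Proof.
move=> gd dB.
have B0 : 0 <= B by rewrite (le_trans (nm_ge0 _) (dB 0 _))// lexx ler01.
apply: nm_endo_le => // v; set W := (g 1 - g 0) v.
pose f s := ip (g s v) W.
have fd (s : R) : 0 <= s <= 1 -> is_derive s (1 : R) f (ip (dg s v) W).
  move=> s01; apply: is_derive_eps => e e0.
  pose K := nm v * nm W + 1.
  have K0 : 0 < K by rewrite ltr_wpDl ?mulr_ge0 ?nm_ge0.
  have [a a0 ha] := gd s s01 _ (divr_gt0 e0 K0).
  exists a => // t ta; rewrite /f -ipBl -ipZl -ipBl.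
  rewrite (_ : _ - _ - _ = (g (s + t) - g s - t%:C *: dg s) v)//.
  rewrite (le_trans (ip_norm_le _ _))//.
  apply: (@le_trans _ _ (e / K * `|t| * nm v * nm W)).
    rewrite ler_wpM2r ?nm_ge0// (le_trans (nm_app _ _))// ler_wpM2r ?nm_ge0//.
    exact: ha.
  have -> : e / K * `|t| * nm v * nm W = e * `|t| * (nm v * nm W / K) by field; exact: lt0r_neq0.
  rewrite ler_piMr ?mulr_ge0 ?(ltW e0)// ler_pdivrMr// mul1r /K.
  by rewrite lerDl.
have [||c c01 fc] := @MVT R f (fun s => ip (dg s v) W) 0 1 ltr01.
- move=> s; rewrite in_itv/= => /andP[s0 s1]; apply: fd.
  by rewrite !ltW.
- apply: derivable_within_continuous => s; rewrite in_itv/= => s01.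
  by have [] := fd s s01.
have c01' : 0 <= c <= 1.
  by move: c01; rewrite in_itv/= => /andP[? ?]; rewrite !ltW.
have : nm W ^+ 2 <= B * nm v * nm W.
  rewrite -ipvv {1}/W endo_subE ipBl -/(f 1) -/(f 0) fc subr0 mulr1.
  rewrite (le_trans (ip_le _ _))// ler_wpM2r ?nm_ge0// (le_trans (nm_app _ _))//.
  by rewrite ler_wpM2r ?nm_ge0// dB.
have [->|W0] := eqVneq (nm W) 0; first by rewrite mulr_ge0 ?nm_ge0.
have Wp : 0 < nm W by rewrite lt_neqAle eq_sym W0 nm_ge0.
by rewrite expr2 ler_pM2r.
Qed.

Definition taylor2 P (z w : R[i]) (L K : endo V) := forall e : R, 0 < e ->
  exists2 a : R, 0 < a & forall h : R, `|h| < a ->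
    nm (P (z + h%:C * w) - P z - h%:C *: L - (h ^+ 2 / 2)%:C *: K) <= e * h ^+ 2.

(** The remainder along the segment has derivative [h (dP (z + s h w) - dP z - s h K)], which is
    small by differentiability of [dP] at [z]. *)
Lemma taylor2P P (dP : R[i] -> endo V) z w K (r : R) : 0 < r ->
  (forall h : R, `|h| < r -> has_rd P (z + h%:C * w) w (dP (z + h%:C * w))) ->
  has_rd dP z w K -> taylor2 P z w (dP z) K.
Proof.
move=> r0 Pd dPd e e0; have [a a0 ha] := dPd e e0.
exists (Num.min r a); first by rewrite lt_min r0.
move=> h; rewrite lt_min => /andP[hr hlt].
pose g s := P (z + (s * h)%:C * w) - (s * h)%:C *: dP z -
  ((s * h) ^+ 2 / 2)%:C *: K.
pose dg s := h%:C *: (dP (z + (s * h)%:C * w) - dP z - (s * h)%:C *: K).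
have sh s : 0 <= s <= 1 -> `|s * h| <= `|h|.
  by move=> /andP[s0 s1]; rewrite normrM ger0_norm// ler_piMl.
have -> : P (z + h%:C * w) - P z - h%:C *: dP z - (h ^+ 2 / 2)%:C *: K = g 1 - g 0.
  by rewrite /g !mul1r !mul0r addr0; endo_ring.
apply: (mean_value_bound (dg := dg)) => s s01; last first.
  rewrite /dg nmZ cabs_real.
  apply: (@le_trans _ _ (`|h| * (e * `|h|))).
    rewrite ler_wpM2l// (le_trans (ha _ _)) ?(le_lt_trans (sh _ s01))//.
    by rewrite ler_wpM2l ?(ltW e0)// sh.
  by rewrite mulrCA -expr2 real_normK ?num_real.
move=> d d0.
pose C := `|h| * d / 2 ; have [h0|h0] := eqVneq h 0.
  exists 1 => // t _; rewrite /g /dg h0 !mulr0 !scale0r scaler0 !subr0.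
  by rewrite subrr nm0 mulr_ge0// ltW.
have hp : 0 < `|h| by rewrite normr_gt0.
have d1 : 0 < d / (2 * `|h|) by rewrite divr_gt0// mulr_gt0.
have [b b0 hb] := Pd (s * h) (le_lt_trans (sh _ s01) hr) _ d1.
pose D := h ^+ 2 * nm K + 1.
have D0 : 0 < D by rewrite ltr_wpDl// mulr_ge0 ?sqr_ge0 ?nm_ge0.
exists (Num.min (b / `|h|) (d / D)); first by rewrite lt_min !divr_gt0.
move=> t; rewrite lt_min => /andP[tb td].
have thb : `|t * h| < b by rewrite normrM -ltr_pdivlMr.
have {hb} := hb _ thb.
have -> : z + (s * h)%:C * w + (t * h)%:C * w = z + ((s + t) * h)%:C * w.
  by rewrite -addrA -mulrDl -rmorphD -mulrDl.
set P1 := P (z + ((s + t) * h)%:C * w); set P0 := P (z + (s * h)%:C * w).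
set dPs := dP (z + (s * h)%:C * w) => hb.
have -> : g (s + t) - g s - t%:C *: dg s =
    (P1 - P0 - (t * h)%:C *: dPs) - (t ^+ 2 * h ^+ 2 / 2)%:C *: K.
  by rewrite /g /dg -/P1 -/P0 -/dPs; endo_ring.
rewrite (le_trans (nmB _ _))//.
have -> : d * `|t| = d / (2 * `|h|) * `|t * h| + d / 2 * `|t|.
  by rewrite normrM; field; exact: lt0r_neq0.
have th0 : 0 <= t ^+ 2 * h ^+ 2 / 2 by rewrite -exprMn divr_ge0// sqr_ge0.
rewrite lerD// nmZ cabs_pos//.
have -> : t ^+ 2 * h ^+ 2 / 2 * nm K = `|t| * (`|t| * (h ^+ 2 * nm K)) / 2.
  by rewrite mulrA -expr2 real_normK ?num_real//; ring.
have : `|t| * (h ^+ 2 * nm K) <= d.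
  apply: (@le_trans _ _ (d / D * D)); last by rewrite divfK ?gt_eqF.
  apply: ler_pM => //; [by rewrite mulr_ge0 ?sqr_ge0 ?nm_ge0|exact: ltW|].
  by rewrite /D lerDl.
move=> hd; have -> : d / 2 * `|t| = `|t| * d / 2 by ring.
by rewrite ler_pM2r// ler_wpM2l.
Qed.

(* Sum of [qf (P x) s(x)] over [x = z + h w, z - h w] for the affine section
   [s (z + h w) = v + h u]: the odd terms cancel. *)
Lemma two_point P z w L K (M : R) : taylor2 P z w L K -> 0 <= M ->
  forall e : R, 0 < e -> exists2 a : R, 0 < a & forall h : R, `|h| < a ->
    forall v u, nm u <= M * nm v ->
    `|qf (P (z + h%:C * w)) (v + h%:C *: u) + qf (P (z - h%:C * w)) (v - h%:C *: u)
      - 2 * qf (P z) v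
      - h ^+ 2 * (qf K v + 2 * (ip (L v) u + ip (L u) v) + 2 * qf (P z) u)|
    <= e * h ^+ 2 * nm v ^+ 2.
Proof.
move=> PLK M0 e e0.
pose N := 2 * (1 + M) ^+ 2; have N0 : 0 < N.
  by rewrite mulr_gt0// exprn_gt0// ltr_pwDl.
have e20 : 0 < e / 2 by rewrite divr_gt0.
have [a a0 ha] := PLK _ (divr_gt0 e20 N0).
pose D := nm K * M ^+ 2 + 1.
have D0 : 0 < D by rewrite ltr_wpDl// mulr_ge0 ?sqr_ge0 ?nm_ge0.
pose b := Num.min a (Num.min 1 (e / 2 / D)).
exists b; first by rewrite !lt_min a0 ltr01 divr_gt0.
move=> h; rewrite /b !lt_min => /and3P[hlt h1 hD] v u uv.
pose r1 := P (z + h%:C * w) - P z - h%:C *: L - (h ^+ 2 / 2)%:C *: K.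
pose r2 := P (z - h%:C * w) - P z + h%:C *: L - (h ^+ 2 / 2)%:C *: K.
have n1 : nm r1 <= e / 2 / N * h ^+ 2 by exact: ha.
have n2 : nm r2 <= e / 2 / N * h ^+ 2.
  have := ha (- h); rewrite normrN => /(_ hlt).
  by rewrite rmorphN mulNr scaleNr opprK sqrrN.
have sv x : `|x| <= 1 -> nm (v + x%:C *: u) <= (1 + M) * nm v.
  move=> x1; rewrite (le_trans (nmD _ _))// mulrDl mul1r lerD2l nmZ cabs_real.
  by rewrite (le_trans _ uv)// ler_piMl ?nm_ge0.
have s1 : nm (v + h%:C *: u) <= (1 + M) * nm v by rewrite sv// ltW.
have s2 : nm (v - h%:C *: u) <= (1 + M) * nm v.
  by rewrite -scaleNr -rmorphN sv// normrN ltW.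
have q1 (r : endo V) s : nm r <= e / 2 / N * h ^+ 2 -> nm s <= (1 + M) * nm v ->
    `|qf r s| <= e / 4 * h ^+ 2 * nm v ^+ 2.
  move=> nr ns; apply: le_trans (qf_norm_le _ _) _.
  apply: (@le_trans _ _ (e / 2 / N * h ^+ 2 * ((1 + M) * nm v) ^+ 2)).
    apply: ler_pM; rewrite ?nm_ge0 ?sqr_ge0// lerXn2r ?nnegrE ?nm_ge0//.
    by rewrite mulr_ge0 ?nm_ge0// addr_ge0.
  rewrite le_eqVlt; apply/orP; left; apply/eqP; rewrite /N; field.
  by rewrite lt0r_neq0// ltr_pwDl.
have m1 := q1 r1 _ n1 s1; have m2 := q1 r2 _ n2 s2.
set X := (X in `|X|).
(* All terms of order at most 2 cancel; what is left are the two Taylor remainders and one exact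
   term of order 4. *)
have XE : X = qf r1 (v + h%:C *: u) + qf r2 (v - h%:C *: u) + h ^+ 4 * qf K u.
  rewrite /X /r1 /r2 /qf.
  do 5! rewrite ?endo_subE ?endo_addE ?endo_oppE ?endo_scaleE ?endoB ?endoD ?endoN ?endoZ.
  rewrite !(ipDl, ipBl, ipNl, ipZl, ipDr, ipBr, ipNr, ipZr).
  by field.
have hK : `|h ^+ 4 * qf K u| <= e / 2 * h ^+ 2 * nm v ^+ 2.
  rewrite normrM normrX (_ : `|h| ^+ 4 = `|h| ^+ 2 * `|h| ^+ 2); last by ring.
  rewrite real_normK ?num_real//.
  have h2 : h ^+ 2 <= e / 2 / D.
    rewrite -(real_normK (num_real h)) expr2 (le_trans _ (ltW hD))// ler_piMl//.
    exact: ltW.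
  have : `|qf K u| <= D * nm v ^+ 2.
    rewrite (le_trans (qf_norm_le _ _))//.
    apply: (@le_trans _ _ (nm K * (M * nm v) ^+ 2)).
      by rewrite ler_wpM2l ?nm_ge0// lerXn2r ?nnegrE ?mulr_ge0 ?nm_ge0.
    by rewrite exprMn mulrA ler_wpM2r ?sqr_ge0// /D lerDl.
  have -> : e / 2 * h ^+ 2 * nm v ^+ 2 = h ^+ 2 * (e / 2 * nm v ^+ 2) by ring.
  move=> qK; rewrite -[X in X <= _]mulrA ler_wpM2l ?sqr_ge0//.
  apply: (@le_trans _ _ (e / 2 / D * (D * nm v ^+ 2))).
    by apply: ler_pM; rewrite ?sqr_ge0.
  by rewrite mulrA divfK ?gt_eqF.
rewrite XE (le_trans (ler_normD _ _))//.
have -> : e * h ^+ 2 * nm v ^+ 2 = (e / 4 * h ^+ 2 * nm v ^+ 2 + e / 4 * h ^+ 2 * nm v ^+ 2)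
   + e / 2 * h ^+ 2 * nm v ^+ 2 by field.
by rewrite lerD// (le_trans (ler_normD _ _))// lerD.
Qed.

End MeanValue.

(** * The comparison principle for flat metrics *)

(** The sum of the four comparisons. The bowl gains [2 e H N]; the choice of [d] makes the total
    Taylor error exactly [e H N], so half the gain survives. *)
Lemma four_point_arith {R : realType} (s e d H N p0 q0 b0 p1 p2 p3 p4 q1 q2 q3 q4
    b1 b2 b3 b4 ep1 ep2 eq1 eq2 eb1 eb2 : R) :
  0 < s -> 0 < e -> 2 * d * (s + 1 + e) = e -> 0 < H -> 0 <= N ->
  p1 + p2 - 2 * p0 - H * ep1 <= d * H * N ->
  p3 + p4 - 2 * p0 - H * ep2 <= d * H * N ->
  - (d * H * N) <= q1 + q2 - 2 * q0 - H * eq1 ->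
  - (d * H * N) <= q3 + q4 - 2 * q0 - H * eq2 ->
  - (d * H * N) <= b1 + b2 - 2 * b0 - H * eb1 ->
  - (d * H * N) <= b3 + b4 - 2 * b0 - H * eb2 ->
  ep1 + ep2 = 0 -> 0 <= eq1 + eq2 -> 2 * N <= eb1 + eb2 ->
  q1 + e * b1 <= s * p1 -> q2 + e * b2 <= s * p2 ->
  q3 + e * b3 <= s * p3 -> q4 + e * b4 <= s * p4 ->
  e * H / 4 * N <= s * p0 - q0 - e * b0.
Proof.
move=> s0 e0 dE H0 N0 h1 h2 h3 h4 h5 h6 EP EQ EB m1 m2 m3 m4.
have sP : p1 + p2 + p3 + p4 <= 4 * p0 + 2 * (d * H * N).
  have : H * ep1 + H * ep2 = 0 by rewrite -mulrDr EP mulr0.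
  by move: h1 h2; clear; lra.
have sQ : 4 * q0 - 2 * (d * H * N) <= q1 + q2 + q3 + q4.
  have : 0 <= H * eq1 + H * eq2 by rewrite -mulrDr mulr_ge0// ltW.
  by move: h3 h4; clear; lra.
have sB : 4 * b0 + 2 * (H * N) - 2 * (d * H * N) <= b1 + b2 + b3 + b4.
  have : H * (2 * N) <= H * eb1 + H * eb2 by rewrite -mulrDr ler_pM2l.
  by move: h5 h6; clear; lra.
have sP' : s * (p1 + p2 + p3 + p4) <= s * (4 * p0 + 2 * (d * H * N)).
  by rewrite ler_pM2l.
have sB' : e * (4 * b0 + 2 * (H * N) - 2 * (d * H * N)) <= e * (b1 + b2 + b3 + b4).
  by rewrite ler_pM2l.
have eE : e * (H * N) = 2 * s * (d * H * N) + 2 * (d * H * N) + 2 * e * (d * H * N).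
  by rewrite -{1}dE; ring.
by move: sP' sB' eE sQ m1 m2 m3 m4; clear; lra.
Qed.

Section FlatMetrics.
Context {R : realType} {V : hilbertType R}.
Implicit Types (P Q : R[i] -> endo V) (z w : R[i]) (u v : V).

Definition flat_metric P :=
  [/\ {within closed_unit_disc, continuous P},
      forall z, closed_unit_disc z -> posdef (P z),
      smooth_on unit_disc P
    & forall z, unit_disc z -> curvature P z = 0].

Lemma unit_disc_line z w : unit_disc z -> cabs w = 1 ->
  exists2 r : R, 0 < r & forall h : R, `|h| < r -> unit_disc (z + h%:C * w).
Proof.
move=> /unit_discP z1 w1; exists (1 - cabs z); first by rewrite subr_gt0.
move=> h hr; apply/unit_discP; rewrite (le_lt_trans (cabsD _ _))//.
by rewrite cabsM cabs_real w1 mulr1 -ltrBrDl.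
Qed.

Lemma has_rd_sym P z w L : unit_disc z -> cabs w = 1 ->
  (forall x, unit_disc x -> (P x)^H = P x) -> has_rd P z w L -> L^H = L.
Proof.
move=> z1 w1 PH PL; have [r r0 hr] := unit_disc_line z1 w1.
apply: (has_rd_uniq (P := P) (z := z) (w := w)) => //.
apply: has_rd_ext r0 _ (has_rd_adj PL) => h /hr; exact: PH.
Qed.

Lemma ip_i_sym (T : endo V) v : T^H = T -> ip (T v) ('i *: v) = 0.
Proof.
move=> TT; have := Im_inner (T v) v; rewrite inner_real//= => <-.
Qed.

Lemma ip_i_l u v : ip ('i *: u) v = - ip u ('i *: v).
Proof.
by rewrite -[LHS]ip_iZ scalerA -expr2 sqrCi scaleN1r ipNl.
Qed.

(** The left side is the Laplacian of [<P s, s>] at [h = 0] for the holomorphic section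
    [s (z + h) = v + h u]. Flatness, entering as [B1 + 'i *: B2 = 0] for the derivatives of
    [P^-1 P_z], leaves the complete square [4 <P^-1 (P_z v + P u), P_z v + P u>]: nonnegative
    always, and zero for [u = - P^-1 P_z v]. *)
Lemma second_order_arith (P0 J A0 X1 X2 Pxx Pxy Pyx Pyy B1 B2 Z0 : endo V) :
  P0^H = P0 -> X1^H = X1 -> X2^H = X2 -> Pxy^H = Pxy -> Pyx^H = Pyx ->
  J * P0 = 1 -> P0 * J = 1 -> Z0 = 2^-1 *: (X1 - 'i *: X2) -> A0 = J * Z0 ->
  B1 + 'i *: B2 = 0 ->
  X1 * A0 + P0 * B1 = 2^-1 *: (Pxx - 'i *: Pyx) ->
  X2 * A0 + P0 * B2 = 2^-1 *: (Pxy - 'i *: Pyy) ->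
  forall v u,
    (qf Pxx v + 2 * (ip (X1 v) u + ip (X1 u) v) + 2 * qf P0 u) +
    (qf Pyy v + 2 * (ip (X2 v) ('i *: u) + ip (X2 ('i *: u)) v) +
      2 * qf P0 ('i *: u)) =
    4 * qf J (Z0 v + P0 u).
Proof.
move=> P0H X1H X2H PxyH PyxH J1 J2 ZE AE BE e1 e2 v u.
pose zt := Z0 v.
have ztE : zt + zt = X1 v - 'i *: X2 v.
  rewrite /zt ZE endo_scaleE endo_subE endo_scaleE -scalerDl.
  by rewrite -[X in (X + X) *: _]mul1r -splitr scale1r.
(* Add the first product rule identity to ['i] times the second. The [B] terms cancel by flatness,
   and the mixed derivatives drop out because [ip (T v) ('i *: v) = 0] for self-adjoint [T]. *)
have key : qf Pxx v + qf Pyy v = 4 * qf J zt.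
  have Av : A0 v = J zt by rewrite AE endo_mulE.
  have h2 : ip (zt + zt) (J zt) = 2 * qf J zt by rewrite ipDl (ipC zt) /qf; ring.
  have e3 : ip ((X1 * A0 + P0 * B1) v) v + ip ('i *: (X2 * A0 + P0 * B2) v) v =
      2 * qf J zt.
    have -> : ip ((X1 * A0 + P0 * B1) v) v + ip ('i *: (X2 * A0 + P0 * B2) v) v =
       ip (X1 (J zt)) v + ip ('i *: X2 (J zt)) v + ip (P0 ((B1 + 'i *: B2) v)) v.
      rewrite !endo_addE !endo_mulE Av scalerDr endo_scaleE endoD endoZ !ipDl.
      by ring.
    rewrite BE linear0 ip0l addr0 -h2 ztE ipBl adjP X1H (ipC (X1 v)); congr (_ + _).
    by rewrite ip_i_l adjP X2H endoZ (ipC (J zt)).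
  move: e3; rewrite e1 e2 => e3.
  have : ip ((2^-1 *: (Pxx - 'i *: Pyx)) v) v + ip ('i *: (2^-1 *: (Pxy - 'i *: Pyy)) v) v =
     2^-1 * (qf Pxx v + qf Pyy v).
    have r2' : (2^-1 : R[i]) = (2^-1 : R)%:C by rewrite fmorphV/= rmorph_nat.
    rewrite !endo_scaleE scalerA (mulrC 'i) -scalerA r2' !ipZl endo_subE endo_scaleE.
    rewrite [(Pxy - _) v]endo_subE endo_scaleE scalerBr scalerA -expr2 sqrCi scaleN1r opprK.
    rewrite !(ipDl, ipNl) !ip_i_l !ip_i_sym// /qf; ring.
  rewrite e3 => e4; lra.
have qi : qf P0 ('i *: u) = qf P0 u by rewrite /qf endoZ ip_iZ.
have ztu : 2 * ip zt u = ip (X1 v) u + ip (X2 v) ('i *: u).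
  have : ip (zt + zt) u = 2 * ip zt u by rewrite ipDl; ring.
  by rewrite ztE ipBl ip_i_l opprK => <-.
have -> : qf J (Z0 v + P0 u) = qf J zt + 2 * ip zt u + qf P0 u.
  rewrite /qf -/zt endoD ipDl !ipDr.
  have -> : J (P0 u) = u by rewrite -endo_mulE J1.
  have -> : ip (J zt) (P0 u) = ip zt u.
    by rewrite adjPr P0H -endo_mulE J2.
  rewrite (ipC u zt) (ipC u); ring.
have s1 : ip (X1 u) v = ip (X1 v) u by rewrite adjP X1H ipC.
have s2 : ip (X2 ('i *: u)) v = ip (X2 v) ('i *: u) by rewrite adjP X2H ipC.
rewrite s1 s2 qi.
by move: ztu key; clear; lra.
Qed.

Lemma flat_second_order P z : unit_disc z ->
  (forall x, unit_disc x -> posdef (P x)) -> smooth_on unit_disc P ->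
  curvature P z = 0 -> exists Z L1 L2 K1 K2 : endo V,
  [/\ taylor2 P z 1 L1 K1, taylor2 P z 'i L2 K2 &
    forall v u,
      (qf K1 v + 2 * (ip (L1 v) u + ip (L1 u) v) + 2 * qf (P z) u) +
      (qf K2 v + 2 * (ip (L2 v) ('i *: u) + ip (L2 ('i *: u)) v) +
        2 * qf (P z) ('i *: u)) =
      4 * qf (inverse (P z)) (Z v + P z u)].
Proof.
move=> z1 Ppos Psm Pc.
have [_ [Pd [_ [Pxd _ _]] [_ [Pyd _ _]]]] := Psm 2%N.
have c1 : cabs (1 : R[i]) = 1 := cabs1.
have ci : cabs ('i : R[i]) = 1 := cabsi.
have PH x : unit_disc x -> (P x)^H = P x by move=> /Ppos[].
have Px x : unit_disc x -> has_rd P x 1 (partial_x P x).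
  by move=> /Pd[h _]; exact: real_derive_has.
have Py x : unit_disc x -> has_rd P x 'i (partial_y P x).
  by move=> /Pd[_ h]; exact: real_derive_has.
have PxH x : unit_disc x -> (partial_x P x)^H = partial_x P x.
  by move=> x1; exact: has_rd_sym (Px _ x1).
have PyH x : unit_disc x -> (partial_y P x)^H = partial_y P x.
  by move=> x1; exact: has_rd_sym (Py _ x1).
have [dxx dxy] := Pxd z z1; have [dyx dyy] := Pyd z z1.
have [Pxx xx] : exists K, has_rd (partial_x P) z 1 K.
  by eexists; exact: real_derive_has dxx.
have [Pxy xy] : exists K, has_rd (partial_x P) z 'i K.
  by eexists; exact: real_derive_has dxy.
have [Pyx yx] : exists K, has_rd (partial_y P) z 1 K.
  by eexists; exact: real_derive_has dyx.
have [Pyy yy] : exists K, has_rd (partial_y P) z 'i K.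
  by eexists; exact: real_derive_has dyy.
have Z1 : has_rd (partial_z P) z 1 (2^-1 *: (Pxx - 'i *: Pyx)).
  by apply/has_rdZ/has_rdD => //; apply/has_rdN/has_rdZ.
have Z2 : has_rd (partial_z P) z 'i (2^-1 *: (Pxy - 'i *: Pyy)).
  by apply/has_rdZ/has_rdD => //; apply/has_rdN/has_rdZ.
have Pinv x : unit_disc x -> invertible (P x) by move=> /Ppos/posdef_invertible.
have [A AE] : exists A, A = (fun x => inverse (P x) * partial_z P x) by eexists.
have PA x : unit_disc x -> P x * A x = partial_z P x.
  by move=> /Pinv/inverseP[_ h]; rewrite AE mulrA h mul1r.
have [r1 r10 hr1] := unit_disc_line z1 c1.
have [r2 r20 hr2] := unit_disc_line z1 ci.
have I1 := has_rd_inverse r10 (fun h hh => Pinv _ (hr1 h hh)) (Px _ z1).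
have I2 := has_rd_inverse r20 (fun h hh => Pinv _ (hr2 h hh)) (Py _ z1).
have A1 := has_rdM I1 Z1; have A2 := has_rdM I2 Z2; rewrite -AE in A1 A2.
(* The explicit derivatives of the inverse are forgotten: differentiating [P A = P_z] below gives
   the needed relations. *)
have {I1 I2} [B1 [B2 [{}A1 {}A2]]] : exists B1 B2, has_rd A z 1 B1 /\ has_rd A z 'i B2.
  by eexists; eexists; split; [exact: A1|exact: A2].
have BE : B1 + 'i *: B2 = 0.
  move: Pc; rewrite /curvature /partial_zbar /partial_x /partial_y.
  rewrite -AE (has_rd_derive A1) (has_rd_derive A2) => /eqP.
  by rewrite oppr_eq0 scaler_eq0 invr_eq0 pnatr_eq0/= => /eqP.
have e1 := has_rd_uniq (has_rd_ext r10 (fun h hh => PA _ (hr1 h hh)) (has_rdM (Px _ z1) A1)) Z1.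
have e2 := has_rd_uniq (has_rd_ext r20 (fun h hh => PA _ (hr2 h hh)) (has_rdM (Py _ z1) A2)) Z2.
pose X1 := partial_x P z; pose X2 := partial_y P z.
exists (partial_z P z), X1, X2, Pxx, Pyy; split.
- exact: (taylor2P (dP := partial_x P) r10 (fun h hh => Px _ (hr1 h hh)) xx).
- exact: (taylor2P (dP := partial_y P) r20 (fun h hh => Py _ (hr2 h hh)) yy).
have X1H : X1^H = X1 := PxH _ z1.
have X2H : X2^H = X2 := PyH _ z1.
have PxyH : Pxy^H = Pxy by exact: has_rd_sym xy.
have PyxH : Pyx^H = Pyx by exact: has_rd_sym yx.
have [J1 J2] := inverseP (Pinv _ z1).
apply: (second_order_arith (PH _ z1) X1H X2H PxyH PyxH J1 J2 erefl _ BE e1 e2).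
by rewrite AE.
Qed.

(** The Laplacian of [<bowl s, s>] along an affine section is [4 |u|^2 + 4 |v + z u|^2], with one
    square from each summand. For [|z| <= 1] this is at least [2 |v|^2] whatever [u] is. *)
Definition bowl z : endo V := (1 + cabs z ^+ 2)%:C *: (1 : endo V).

Lemma cabs_sq z : cabs z ^+ 2 = complex.Re z ^+ 2 + complex.Im z ^+ 2.
Proof. by apply: complexI; rewrite rmorphXn/= cabsE -add_Re2_Im2. Qed.

Lemma bowl_taylor z w (l : R) :
  (forall h : R, cabs (z + h%:C * w) ^+ 2 = cabs z ^+ 2 + l * h + h ^+ 2) ->
  taylor2 bowl z w (l%:C *: (1 : endo V)) (2%:C *: (1 : endo V)).
Proof.
move=> zw e e0; exists 1 => // h _; set X := (X in nm X).
suff -> : X = 0 by rewrite nm0 mulr_ge0 ?sqr_ge0 ?ltW.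
rewrite /X /bowl zw !scalerA -!rmorphM -!scalerBl -!rmorphB.
have E (r : R) : r = 0 -> r%:C *: (1 : endo V) = 0 by move=> ->; rewrite scale0r.
by apply: E; field.
Qed.

Lemma bowl_second_order z v u : cabs z <= 1 ->
  2 * nm v ^+ 2 <= (qf (2%:C *: (1 : endo V)) v + 2 * (ip (((2 * complex.Re z)%:C *: (1 : endo V)) v) u +
      ip (((2 * complex.Re z)%:C *: (1 : endo V)) u) v) + 2 * qf (bowl z) u) +
    (qf (2%:C *: (1 : endo V)) v + 2 * (ip (((2 * complex.Im z)%:C *: (1 : endo V)) v) ('i *: u) +
      ip (((2 * complex.Im z)%:C *: (1 : endo V)) ('i *: u)) v) + 2 * qf (bowl z) ('i *: u)).
Proof.
move=> z1; rewrite /bowl !qfZ !qf1 !endo_scaleE !ipZl.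
change ((1 : endo V) v) with v; change ((1 : endo V) u) with u.
change ((1 : endo V) ('i *: u)) with ('i *: u).
have -> : nm ('i *: u) = nm u by rewrite nmZ cabsi mul1r.
have zu : ip v (z *: u) = complex.Re z * ip v u + complex.Im z * ip v ('i *: u).
  rewrite {1}(complexE z) scalerDl ipDr ipZr (mulrC 'i%C) -scalerA ipZr.
  by [].
have h1 : nm (v + z *: u) ^+ 2 = nm v ^+ 2 + 2 * ip v (z *: u) + cabs z ^+ 2 * nm u ^+ 2.
  by rewrite nm_sqD nmZ exprMn.
rewrite (ipC u v) (ipC ('i *: u) v).
have h3 : nm v ^+ 2 <= 2 * (nm (v + z *: u) ^+ 2) + 2 * (cabs z ^+ 2 * nm u ^+ 2).
  have h2 : nm v <= nm (v + z *: u) + cabs z * nm u.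
    by rewrite -nmZ -{1}[v](addrK (z *: u)) nmB.
  have := sqr_ge0 (nm (v + z *: u) - cabs z * nm u).
  by have := nm_ge0 v; nra.
have h4 : cabs z ^+ 2 * nm u ^+ 2 <= nm u ^+ 2.
  by rewrite ler_piMl ?sqr_ge0// expr_le1 ?cabs_ge0.
move: zu h1 h3 h4; move: (ip v (z *: u)) (ip v u) (ip v ('i *: u)) => p a b.
by move: (nm v ^+ 2) (nm u ^+ 2) => C D; lra.
Qed.

(* At an interior point the sums over [z + h, z - h, z + i h, z - i h] of
   [qf (X _) (v + _ u)], with [u] annihilating the second order term of [P],
   turn [s P - Q - e bowl >= 0] into a strict inequality at [z]. *)
Lemma interior_strict P Q (s e : R) z : flat_metric P -> flat_metric Q ->
  0 < s -> 0 < e -> unit_disc z ->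
  (forall x, unit_disc x -> forall v,
     qf (Q x) v + e * qf (bowl x) v <= s * qf (P x) v) ->
  exists2 a : R, 0 < a & forall v,
    a * nm v ^+ 2 <= s * qf (P z) v - qf (Q z) v - e * qf (bowl z) v.
Proof.
move=> flatP flatQ s0 e0 z1 QsP.
have [_ Ppos Psm Pc] := flatP; have [_ Qpos Qsm Qc] := flatQ.
have sub := @unit_disc_closed R.
have c1 : cabs (1 : R[i]) = 1 := cabs1.
have [Z [L1 [L2 [K1 [K2 [PT1 PT2 PE]]]]]] :=
  flat_second_order z1 (fun x x1 => Ppos x (sub x x1)) Psm (Pc z z1).
have [Z' [L1' [L2' [K1' [K2' [QT1 QT2 QE]]]]]] :=
  flat_second_order z1 (fun x x1 => Qpos x (sub x x1)) Qsm (Qc z z1).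
have pP := Ppos z (sub z z1); have pQ := Qpos z (sub z z1).
have [J1 J2] := inverseP (posdef_invertible pP).
pose U : endo V := - (inverse (P z) * Z).
have ZU v : Z v + P z (U v) = 0.
  by rewrite /U endo_oppE endoN -!endo_mulE mulrA J2 mul1r subrr.
pose d := e / (2 * (s + 1 + e)).
have s1e : 0 < s + 1 + e by rewrite !addr_gt0.
have d0 : 0 < d by rewrite divr_gt0// mulr_gt0.
have U0 := nm_ge0 U.
have [a1 a10 h1] := two_point PT1 U0 d0; have [a2 a20 h2] := two_point PT2 U0 d0.
have [a3 a30 h3] := two_point QT1 U0 d0; have [a4 a40 h4] := two_point QT2 U0 d0.
have bt1 := @bowl_taylor z 1 (2 * complex.Re z).
have [|a5 a50 h5] := two_point (bt1 _) U0 d0.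
  by move=> h; rewrite !cabs_sq; case: (z) => x y /=; ring.
have bti := @bowl_taylor z 'i (2 * complex.Im z).
have [|a6 a60 h6] := two_point (bti _) U0 d0.
  by move=> h; rewrite !cabs_sq; case: (z) => x y /=; ring.
have [r1 r10 l1] := unit_disc_line z1 c1.
have [r2 r20 l2] := unit_disc_line z1 (cabsi : cabs ('i : R[i]) = 1).
pose a := Num.min (Num.min (Num.min a1 a2) (Num.min a3 a4))
  (Num.min (Num.min a5 a6) (Num.min r1 r2)).
have a0 : 0 < a by rewrite !lt_min a10 a20 a30 a40 a50 a60 r10 r20.
(* One step size serves every [v], because the errors in [two_point] are proportional to
   [nm v ^+ 2]; this makes the resulting constant uniform. *)
pose h := a / 2; have h0 : 0 < h by rewrite divr_gt0.
have : `|h| < a by rewrite gtr0_norm// ltr_pdivrMr// ltr_pMr// ltr1n.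
rewrite /a !lt_min => /andP[/andP[/andP[g1 g2] /andP[g3 g4]] /andP[/andP[g5 g6] /andP[g7 g8]]].
exists (e * h ^+ 2 / 4); first by rewrite divr_gt0// mulr_gt0 ?exprn_gt0.
move=> v; pose u := U v; pose iu : V := 'i *: u.
have un : nm u <= nm U * nm v by exact: nm_app.
have iun : nm iu <= nm U * nm v by rewrite /iu nmZ cabsi mul1r.
have {}h1 := h1 h g1 v u un; have {}h2 := h2 h g2 v iu iun.
have {}h3 := h3 h g3 v u un; have {}h4 := h4 h g4 v iu iun.
have {}h5 := h5 h g5 v u un; have {}h6 := h6 h g6 v iu iun.
have hN : `|- h| = `|h| := normrN h.
have m1 := QsP _ (l1 h g7) (v + h%:C *: u).
have m2 : qf (Q (z - h%:C * 1)) (v - h%:C *: u) + e * qf (bowl (z - h%:C * 1)) (v - h%:C *: u)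
    <= s * qf (P (z - h%:C * 1)) (v - h%:C *: u).
  by apply: QsP; have := l1 (- h); rewrite hN rmorphN mulNr; exact.
have m3 := QsP _ (l2 h g8) (v + h%:C *: iu).
have m4 : qf (Q (z - h%:C * 'i)) (v - h%:C *: iu) + e * qf (bowl (z - h%:C * 'i)) (v - h%:C *: iu)
    <= s * qf (P (z - h%:C * 'i)) (v - h%:C *: iu).
  by apply: QsP; have := l2 (- h); rewrite hN rmorphN mulNr; exact.
have EP := PE v u; have EQ := QE v u.
have EB := @bowl_second_order z v u (ltW (proj1 (unit_discP z) z1)).
have JP0 : qf (inverse (P z)) (Z v + P z u) = 0 by rewrite ZU /qf ip0r.
have JQ0 : 0 <= qf (inverse (Q z)) (Z' v + Q z u).
  exact/posdef_gt0/posdef_inverse_posdef.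
rewrite JP0 mulr0 in EP.
have dE : 2 * d * (s + 1 + e) = e by rewrite /d; field; exact: lt0r_neq0.
have hh : 0 < h ^+ 2 by rewrite exprn_gt0.
move: h1 h2 h3 h4 h5 h6 m1 m2 m3 m4 EP EQ EB.
rewrite -/iu.
set p1 := qf (P (z + h%:C * 1)) _; set p2 := qf (P (z - h%:C * 1)) _.
set p3 := qf (P (z + h%:C * 'i)) _; set p4 := qf (P (z - h%:C * 'i)) _.
set q1 := qf (Q (z + h%:C * 1)) _; set q2 := qf (Q (z - h%:C * 1)) _.
set q3 := qf (Q (z + h%:C * 'i)) _; set q4 := qf (Q (z - h%:C * 'i)) _.
set b1 := qf (bowl (z + h%:C * 1)) _; set b2 := qf (bowl (z - h%:C * 1)) _.
set b3 := qf (bowl (z + h%:C * 'i)) _; set b4 := qf (bowl (z - h%:C * 'i)) _.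
set EP1 := (X in h ^+ 2 * X); move=> h1.
set EP2 := (X in h ^+ 2 * X); move=> h2.
set EQ1 := (X in h ^+ 2 * X); move=> h3.
set EQ2 := (X in h ^+ 2 * X); move=> h4.
set EB1 := (X in h ^+ 2 * X); move=> h5.
set EB2 := (X in h ^+ 2 * X); move=> h6.
move=> m1 m2 m3 m4 EP EQ EB.
move: h1 h2 h3 h4 h5 h6; rewrite !ler_norml.
move=> /andP[_ h1] /andP[_ h2] /andP[h3 _] /andP[h4 _] /andP[h5 _] /andP[h6 _].
set N := nm v ^+ 2 in h1 h2 h3 h4 h5 h6 EB *.
set H := h ^+ 2 in hh h1 h2 h3 h4 h5 h6 *.
have N0 : 0 <= N by exact: sqr_ge0.
have eQ : 0 <= EQ1 + EQ2 by rewrite EQ mulr_ge0.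
exact: (four_point_arith s0 e0 dE hh N0 h1 h2 h3 h4 h5 h6 EP eQ EB m1 m2 m3 m4).
Qed.

End FlatMetrics.

(** * Comparison on the closed disc and uniqueness *)

Section MaximumPrinciple.
Context {R : realType} {V : hilbertType R}.
Implicit Types (P Q : R[i] -> endo V) (z w : R[i]) (u v : V).

Lemma bowl_continuous : {within closed_unit_disc, continuous (@bowl R V)}.
Proof.
apply/within_continuousP => z /closed_discP z1 e e0.
exists (e / 2); first by rewrite divr_gt0.
move=> w /closed_discP w1 wz.
rewrite /bowl -scalerBl -rmorphB nmZ cabs_real.
have -> : 1 + cabs w ^+ 2 - (1 + cabs z ^+ 2) = (cabs w - cabs z) * (cabs w + cabs z) by ring.
have h : `|cabs w - cabs z| <= cabs (w - z).
  rewrite ler_norml; apply/andP; split.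
    by have := cabsD (z - w) w; rewrite subrK cabsC; lra.
  by have := cabsD (w - z) z; rewrite subrK; lra.
rewrite normrM (ger0_norm (addr_ge0 (cabs_ge0 w) (cabs_ge0 z))).
have c0 := cabs_ge0 w; have d0 := cabs_ge0 z.
apply: (@le_lt_trans _ _ (cabs (w - z) * 2 * 1)); last by rewrite mulr1; lra.
apply: ler_pM; [by rewrite mulr_ge0// addr_ge0|exact: nm_ge0| |exact: nm_endo1].
by apply: ler_pM => //; [rewrite addr_ge0|lra].
Qed.

Lemma within_continuousD K P Q : {within K, continuous P} ->
  {within K, continuous Q} -> {within K, continuous (fun z => P z + Q z)}.
Proof.
move=> /within_continuousP Pc /within_continuousP Qc; apply/within_continuousP.
move=> z Kz e e0; have e20 : 0 < e / 2 by rewrite divr_gt0.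
have [a a0 ha] := Pc z Kz _ e20; have [b b0 hb] := Qc z Kz _ e20.
exists (Num.min a b); first by rewrite lt_min a0.
move=> w Kw; rewrite lt_min => /andP[wa wb].
rewrite opprD addrACA (le_lt_trans (nmD _ _))// [ltRHS](splitr e) ltrD//.
  exact: ha.
exact: hb.
Qed.

Lemma within_continuousZ K P (c : R[i]) : {within K, continuous P} ->
  {within K, continuous (fun z => c *: P z)}.
Proof.
move=> /within_continuousP Pc; apply/within_continuousP.
move=> z Kz e e0; have c1 : 0 < cabs c + 1 by rewrite ltr_wpDl ?cabs_ge0.
have [a a0 ha] := Pc z Kz _ (divr_gt0 e0 c1); exists a => // w Kw /(ha _ Kw).
rewrite ltr_pdivlMr// -scalerBr nmZ => h; rewrite (le_lt_trans _ h)// mulrC.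
by rewrite ler_wpM2l ?nm_ge0// lerDl.
Qed.

Lemma flat_compare P Q (t : R) : flat_metric P -> flat_metric Q -> 0 <= t ->
  (forall z, unit_circle z -> forall v, qf (Q z) v <= t * qf (P z) v) ->
  forall z, closed_unit_disc z -> forall v, qf (Q z) v <= t * qf (P z) v.
Proof.
move=> fP fQ t0 QP.
have [Pcont Ppos _ _] := fP; have [Qcont Qpos _ _] := fQ.
have [c c0 Pge] : exists2 c : R, 0 < c & forall z, closed_unit_disc z -> bounded_below c (P z).
  by apply: compact_bounded_below closed_disc_compact Pcont _ => z /Ppos[_].
have [M M0 PM] := compact_bounded closed_disc_compact Pcont.
have [MQ MQ0 QM] := compact_bounded closed_disc_compact Qcont.
have sub := @unit_disc_closed R.
have bowl_le z v : closed_unit_disc z -> qf (bowl z) v <= 2 * nm v ^+ 2.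
  move=> /closed_discP z1; rewrite /bowl qfZ qf1 ler_wpM2r ?sqr_ge0//.
  have : cabs z ^+ 2 <= 1 by rewrite expr_le1 ?cabs_ge0.
  lra.
have bowl_ge z v : 0 <= qf (bowl z) v.
  by rewrite /bowl qfZ qf1 mulr_ge0 ?addr_ge0 ?sqr_ge0.
suff main (e : R) : 0 < e -> forall z, closed_unit_disc z -> forall v,
    qf (Q z) v + e * qf (bowl z) v <= (t + 3 * e / c) * qf (P z) v.
  move=> z z1 v; apply/ler_addgt0Pl => d d0.
  have Pv : 0 <= qf (P z) v by apply: posdef_gt0; exact: Ppos.
  pose D := 3 * qf (P z) v / c + 1.
  have D0 : 0 < D by rewrite ltr_wpDl// !mulr_ge0// invr_ge0 ltW.
  have := main (d / D) (divr_gt0 d0 D0) z z1 v.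
  have := mulr_ge0 (ltW (divr_gt0 d0 D0)) (bowl_ge z v).
  have : 3 * (d / D) / c * qf (P z) v <= d.
    have -> : 3 * (d / D) / c * qf (P z) v = d / D * (3 * qf (P z) v / c) by ring.
    apply: (@le_trans _ _ (d / D * D)); last by rewrite divfK ?gt_eqF.
    by rewrite ler_wpM2l ?divr_ge0 ?(ltW d0) ?(ltW D0)// /D lerDl.
  by rewrite mulrDl; clear; lra.
(* The slack is worth at least [3 e |v|^2] since [P >= c], and the bowl costs at most [2 e |v|^2];
   so [te P - Q - e bowl >= e] on the circle. *)
move=> e0; pose te := t + 3 * e / c.
have te0 : 0 < te by rewrite ltr_wpDl// divr_gt0// mulr_gt0.
(* The least admissible factor [s0] is attained. If it exceeded [te], the form at [s0] would be
   strictly positive at every point, interior or boundary, and [s0] could be lowered. *)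
pose S : set R := [set s | te <= s /\ forall z, closed_unit_disc z -> forall v,
    qf (Q z) v + e * qf (bowl z) v <= s * qf (P z) v].
have S0 : S (Num.max te ((MQ + 2 * e) / c)).
  split; first by rewrite le_max lexx.
  move=> z z1 v; apply: (@le_trans _ _ ((MQ + 2 * e) / c * (c * nm v ^+ 2))).
    have -> : (MQ + 2 * e) / c * (c * nm v ^+ 2) = MQ * nm v ^+ 2 + e * (2 * nm v ^+ 2).
      by field; exact: lt0r_neq0.
    apply: lerD; last by rewrite ler_wpM2l ?(ltW e0)// bowl_le.
    by rewrite (le_trans (qf_le _ _))// ler_wpM2r ?sqr_ge0// QM.
  apply: ler_pM.
  - by rewrite divr_ge0 ?(ltW c0)// addr_ge0 ?(ltW MQ0)// mulr_ge0// ltW.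
  - by rewrite mulr_ge0 ?sqr_ge0 ?(ltW c0).
  - by rewrite le_max lexx orbT.
  - exact: Pge.
have Sinf : has_inf S by split; [eexists; exact: S0|exists te => s []].
pose s0 := inf S.
have tes0 : te <= s0 by apply: lb_le_inf; [exact: Sinf.1|move=> s []].
have Ss0 z : closed_unit_disc z -> forall v,
    qf (Q z) v + e * qf (bowl z) v <= s0 * qf (P z) v.
  move=> z1 v; apply/ler_addgt0Pl => d d0.
  have Pv : 0 <= qf (P z) v by apply: posdef_gt0; exact: Ppos.
  have P1 : 0 < qf (P z) v + 1 by rewrite ltr_wpDl.
  have [s [_ Ss] ss0] := inf_adherent (divr_gt0 d0 P1) Sinf.
  apply: le_trans (Ss z z1 v) _.
  apply: (@le_trans _ _ ((s0 + d / (qf (P z) v + 1)) * qf (P z) v)).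
    by rewrite ler_wpM2r// ltW.
  rewrite mulrDl addrC lerD2r.
  rewrite mulrAC ler_pdivrMr// ler_wpM2l ?(ltW d0)// lerDl//.
have [s0te|tes0'] := leP s0 te.
  move=> z z1 v; apply: le_trans (Ss0 z z1 v) _; rewrite ler_wpM2r//.
  by apply: posdef_gt0; exact: Ppos.
exfalso.
pose D z := s0%:C *: P z + (- 1)%:C *: Q z + (- e)%:C *: bowl z.
have DE z v : qf (D z) v = s0 * qf (P z) v - qf (Q z) v - e * qf (bowl z) v.
  by rewrite /D !qfD !qfZ; ring.
have Dc : {within closed_unit_disc, continuous D}.
  apply: within_continuousD; first apply: within_continuousD.
  - exact: within_continuousZ.
  - exact: within_continuousZ.
  - by apply: within_continuousZ; exact: bowl_continuous.
have s00 : 0 < s0 by exact: lt_le_trans tes0.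
have [|d d0 Dd] := compact_bounded_below closed_disc_compact Dc.
  move=> z z1; have [zlt|zge] := ltP (cabs z) 1.
    have zd : unit_disc z by apply/unit_discP.
    have [|a a0 ha] := interior_strict fP fQ s00 e0 zd.
      by move=> x /sub; exact: Ss0.
    by exists a => // v; rewrite DE.
  have zc : unit_circle z.
    by apply/unit_circleP/le_anti; rewrite zge andbT; apply/closed_discP.
  exists e => // v; rewrite DE.
  have h1 := QP z zc v; have h2 := bowl_le z v z1; have h3 := Pge z z1 v.
  have h4 : te * qf (P z) v <= s0 * qf (P z) v.
    by rewrite ler_wpM2r//; apply: posdef_gt0; exact: Ppos.
  have h5 : 3 * e / c * (c * nm v ^+ 2) <= 3 * e / c * qf (P z) v.
    by rewrite ler_wpM2l// divr_ge0 ?(ltW c0)// mulr_ge0// ltW.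
  have h6 : 3 * e / c * (c * nm v ^+ 2) = 3 * (e * nm v ^+ 2).
    by field; exact: lt0r_neq0.
  have h7 : e * qf (bowl z) v <= 2 * (e * nm v ^+ 2).
    by rewrite mulrCA ler_wpM2l// ltW.
  by move: h4; rewrite /te mulrDl; lra.
(* The uniform margin [d] pays for lowering the factor by [d / M], as [P <= M]. *)
pose s1 := Num.max te (s0 - d / M).
have s1s0 : s1 < s0 by rewrite /s1 gt_max tes0' ltrBlDr ltrDl divr_gt0.
have : S s1.
  split; first by rewrite /s1 le_max lexx.
  move=> z z1 v; have := Dd z z1 v; rewrite DE => h.
  have Pv : 0 <= qf (P z) v by apply: posdef_gt0; exact: Ppos.
  apply: (@le_trans _ _ ((s0 - d / M) * qf (P z) v)); last first.
    by rewrite ler_wpM2r// /s1 le_max lexx orbT.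
  have : d / M * qf (P z) v <= d * nm v ^+ 2.
    rewrite mulrAC ler_pdivrMr// -mulrA ler_wpM2l ?(ltW d0)// mulrC.
    by rewrite (le_trans (qf_le _ _))// ler_wpM2r ?sqr_ge0// PM.
  by rewrite mulrBl; lra.
move=> /(ge_inf Sinf.2); rewrite -/s0; lra.
Qed.

Lemma flat_metric_unique P Q : flat_metric P -> flat_metric Q ->
  (forall z, unit_circle z -> P z = Q z) ->
  forall z, closed_unit_disc z -> P z = Q z.
Proof.
move=> fP fQ PQ z z1.
have [_ Ppos _ _] := fP; have [_ Qpos _ _] := fQ.
apply: qf_ext; [by have [] := Ppos z z1|by have [] := Qpos z z1|move=> v].
apply/le_anti/andP; split.
  rewrite -[leRHS]mul1r; apply: (flat_compare fQ fP ler01) => // x x1 w.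
  by rewrite mul1r PQ.
rewrite -[leRHS]mul1r; apply: (flat_compare fP fQ ler01) => // x x1 w.
by rewrite mul1r PQ.
Qed.

End MaximumPrinciple.

(** * Power series *)

Section PowerSeries.
Context {R : realType} {V : hilbertType R}.
Implicit Types (a b : nat -> endo V) (z w h : R[i]) (f : R[i] -> endo V).

Definition unit_radius a := forall r : R, 0 < r < 1 ->
  exists M : R, forall k, nm (a k) * r ^+ k <= M.

(** A default value where the partial sums diverge. For a polynomial they are eventually constant,
    so [pser] is also correct on the circle. *)
Definition pser a z : endo V := lim (peval a n z @[n --> \oo]).

Lemma geometric_sum_le (q : R) n : 0 <= q < 1 -> \sum_(k < n) q ^+ k <= (1 - q)^-1.
Proof.
move=> /andP[q0 q1]; have q10 : 0 < 1 - q by rewrite subr_gt0.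
rewrite -[leRHS]mul1r ler_pdivlMr// mulrC.
have -> : (1 - q) * \sum_(k < n) q ^+ k = 1 - q ^+ n.
  by rewrite -[LHS]opprK -mulNr opprB -subrX1 opprB.
by rewrite lerBlDr lerDl exprn_ge0.
Qed.

Lemma unit_radius_bound a (s : R) : unit_radius a -> 0 <= s < 1 ->
  exists M t : R, [/\ 0 <= M, 0 < t < 1, s < t &
    forall k, nm (a k) <= M * (t ^+ k)^-1].
Proof.
move=> ar /andP[s0 s1]; pose t := (1 + s) / 2.
have t01 : 0 < t < 1 by rewrite /t; apply/andP; split; lra.
have [M hM] := ar t t01; have /andP[t0 t1] := t01.
exists M, t; split=> //; last by move=> k; rewrite ler_pdivlMr ?exprn_gt0.
  by have := hM 0%N; rewrite expr0 mulr1; apply: le_trans; exact: nm_ge0.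
by rewrite /t; lra.
Qed.

Lemma pser_cvg a z : unit_radius a -> cabs z < 1 ->
  peval a n z @[n --> \oo] --> pser a z.
Proof.
move=> ar z1; have z01 : 0 <= cabs z < 1 by rewrite cabs_ge0.
have [M [t [M0 /andP[t0 t1] zt aM]]] := unit_radius_bound ar z01.
have q01 : 0 <= cabs z / t < 1.
  by rewrite divr_ge0 ?cabs_ge0 ?(ltW t0)//= ltr_pdivrMr// mul1r.
have uS n : nm (peval a n.+1 z - peval a n z) <= M * (cabs z / t) ^+ n.
  rewrite /peval big_ord_recr/= addrAC subrr add0r nmZ cabsX expr_div_n mulrCA.
  by rewrite ler_wpM2l ?exprn_ge0 ?cabs_ge0.
have [_ /endo_complete[l ul]] := geometric_ncauchy q01 uS.
by rewrite /pser (cvg_lim _ ul).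
Qed.

Lemma pser_lim a z l : peval a n z @[n --> \oo] --> l -> pser a z = l.
Proof. by move=> al; apply: cvg_lim. Qed.

Lemma pser_poly a d z : (forall k, (d < k)%N -> a k = 0) -> pser a z = peval a d.+1 z.
Proof.
move=> a0; apply: pser_lim; apply/cvg_nmP => e e0; exists d.+1 => // n /= dn.
by rewrite (peval_widen _ dn)// subrr nm0.
Qed.

Lemma poly_unit_radius a d : (forall k, (d < k)%N -> a k = 0) -> unit_radius a.
Proof.
move=> a0 r /andP[r0 r1]; exists (\sum_(k < d.+1) nm (a k)) => k.
have s0 (j : 'I_d.+1) : 0 <= nm (a j) by exact: nm_ge0.
have [dk|kd] := ltnP d k; first by rewrite a0// nm0 mul0r sumr_ge0.
have kd' : (k < d.+1)%N by [].
rewrite (bigD1 (Ordinal kd'))//= ler_wpDr ?sumr_ge0//.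
by rewrite ler_piMr ?nm_ge0// exprn_ile1// ltW.
Qed.

Lemma unit_radiusM (T : endo V) a : unit_radius a -> unit_radius (fun k => T * a k).
Proof.
move=> ar r r01; have [M hM] := ar r r01; exists (nm T * M) => k.
have /andP[r0 _] := r01.
apply: (@le_trans _ _ (nm T * (nm (a k) * r ^+ k))).
  by rewrite mulrA ler_wpM2r ?nmM// exprn_ge0// ltW.
by rewrite ler_wpM2l ?nm_ge0.
Qed.

Lemma unit_radiusZ (c : R[i]) a : unit_radius a -> unit_radius (fun k => c *: a k).
Proof.
move=> ar r r01; have [M hM] := ar r r01; exists (cabs c * M) => k.
by rewrite nmZ -mulrA ler_wpM2l ?cabs_ge0.
Qed.

Lemma pserM (T : endo V) a z : unit_radius a -> cabs z < 1 ->
  pser (fun k => T * a k) z = T * pser a z.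
Proof.
move=> ar z1; apply: pser_lim.
rewrite (_ : (fun n => _) = fun n => T * peval a n z); last first.
  apply/funext => n; rewrite /peval mulr_sumr.
  by apply: eq_bigr => k _; rewrite endoZr.
by apply: cvg_endoM; [exact: cvg_cst|exact: pser_cvg].
Qed.

Lemma pserZ (c : R[i]) a z : unit_radius a -> cabs z < 1 ->
  pser (fun k => c *: a k) z = c *: pser a z.
Proof.
move=> ar z1; apply: pser_lim.
rewrite (_ : (fun n => _) = fun n => c *: peval a n z); last first.
  apply/funext => n; rewrite /peval scaler_sumr.
  by apply: eq_bigr => k _; rewrite !scalerA mulrC.
by apply: cvgZr; exact: pser_cvg.
Qed.

Definition dcoef a k : endo V := k.+1%:R *: a k.+1.

Lemma dcoef_unit_radius a : unit_radius a -> unit_radius (dcoef a).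
Proof.
move=> ar r /andP[r0 r1]; have r01 : 0 <= r < 1 by rewrite ltW.
have [M [t [M0 /andP[t0 t1] rt aM]]] := unit_radius_bound ar r01.
pose q := r / t; have q0 : 0 < q by rewrite divr_gt0.
have q1 : q < 1 by rewrite ltr_pdivrMr// mul1r.
exists (M * (q / (1 - q)) / r) => k.
rewrite /dcoef nmZ ler_pdivlMr// -[X in X <= _]mulrA -exprSr.
have -> : cabs (k.+1%:R : R[i]) = k.+1%:R.
  by rewrite -[k.+1%:R](rmorph_nat (real_complex R)) cabs_pos.
apply: (@le_trans _ _ (M * (k.+1%:R * q ^+ k.+1))).
  rewrite expr_div_n -[X in X <= _]mulrA [leRHS]mulrCA ler_wpM2l ?ler0n//.
  rewrite [leRHS]mulrCA [X in X <= _]mulrC.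
  by rewrite ler_wpM2l ?exprn_ge0 ?(ltW r0).
rewrite ler_wpM2l//.
by have := natmul_expr_le k.+1 q0 q1; rewrite expr1n mulr1.
Qed.

(** Multiplying by [s ^+ 2] avoids the exponent [k - 2], which truncated subtraction would spoil for
    small [k]. *)
Lemma expr_remainder z h (s : R) k : 0 < s -> cabs z <= s -> cabs (z + h) <= s ->
  cabs ((z + h) ^+ k - z ^+ k - k%:R * h * z ^+ k.-1) * s ^+ 2 <=
    k%:R ^+ 2 * cabs h ^+ 2 * s ^+ k.
Proof.
move=> s0 zs zhs; elim: k => [|k ih].
  by rewrite !expr0 subrr mul0r mul0r subr0 cabs0 mul0r expr0n/= !mul0r.
set e := (z + h) ^+ k - z ^+ k - k%:R * h * z ^+ k.-1 in ih.
have -> : (z + h) ^+ k.+1 - z ^+ k.+1 - k.+1%:R * h * z ^+ k.+1.-1 =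
    (z + h) * e + k%:R * h ^+ 2 * z ^+ k.-1.
  rewrite /e /= -natr1; case: k {ih e} => [|k] /=; first by rewrite !expr0 !expr1; ring.
  by rewrite !exprS; ring.
apply: (@le_trans _ _ ((s * cabs e + k%:R * cabs h ^+ 2 * cabs z ^+ k.-1) * s ^+ 2)).
  rewrite ler_wpM2r ?sqr_ge0// (le_trans (cabsD _ _))// lerD//.
    by rewrite cabsM ler_wpM2r ?cabs_ge0.
  by rewrite !cabsM !cabsX -[k%:R](rmorph_nat (real_complex R)) cabs_pos.
rewrite mulrDl -mulrA.
have h1 : s * (cabs e * s ^+ 2) <= s * (k%:R ^+ 2 * cabs h ^+ 2 * s ^+ k).
  by rewrite ler_wpM2l// ltW.
have h2 : k%:R * cabs h ^+ 2 * cabs z ^+ k.-1 * s ^+ 2 <= k%:R * cabs h ^+ 2 * s ^+ k.+1.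
  case: k {ih e h1} => [|k] /=; first by rewrite !mul0r.
  rewrite (_ : s ^+ k.+2 = s ^+ k * s ^+ 2); last by rewrite -exprD addn2.
  rewrite -!mulrA ler_wpM2l ?ler0n// !(ler_wpM2l (cabs_ge0 h))// ler_wpM2r ?sqr_ge0//.
  by rewrite lerXn2r ?nnegrE ?cabs_ge0// ltW.
apply: le_trans (lerD h1 h2) _.
have -> : s * (k%:R ^+ 2 * cabs h ^+ 2 * s ^+ k) = k%:R ^+ 2 * (cabs h ^+ 2 * s ^+ k.+1).
  by rewrite [s ^+ k.+1]exprS; ring.
rewrite -[X in _ + X]mulrA -mulrDl -[leRHS]mulrA.
rewrite ler_wpM2r ?(mulr_ge0 (sqr_ge0 _) (exprn_ge0 _ (ltW s0)))//.
by rewrite -natr1; have := ler0n R k; move: (k%:R : R) => x; nra.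
Qed.

Lemma sqr_geometric_sum_le (q : R) : 0 < q < 1 ->
  exists K : R, forall n, \sum_(k < n) k%:R ^+ 2 * q ^+ k <= K.
Proof.
move=> /andP[q0 q1]; pose s := (1 + q) / 2; pose t := (1 + s) / 2.
have qs : q < s by rewrite /s; lra.
have s0 : 0 < s by exact: lt_trans qs.
have st : s < t by rewrite /t /s; lra.
have t01 : 0 <= t < 1 by rewrite /t /s; apply/andP; split; lra.
pose A := q / (s - q); pose B := s / (t - s).
have A0 : 0 <= A by rewrite divr_ge0 ?subr_ge0 ?(ltW q0) ?(ltW qs).
have B0 : 0 <= B by rewrite divr_ge0 ?subr_ge0 ?(ltW s0) ?(ltW st).
exists (A * B * (1 - t)^-1) => n.
apply: (@le_trans _ _ (A * B * \sum_(k < n) t ^+ k)); last first.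
  by rewrite (ler_wpM2l (mulr_ge0 A0 B0))// geometric_sum_le.
rewrite mulr_sumr; apply: ler_sum => k _.
rewrite expr2 -mulrA.
apply: (@le_trans _ _ (k%:R * (A * s ^+ k))).
  by rewrite ler_wpM2l ?ler0n// natmul_expr_le// q0.
by rewrite mulrCA -[leRHS]mulrA ler_wpM2l// natmul_expr_le// s0.
Qed.

(** A complex derivative with quadratic remainder; it implies both the library's complex
    derivability and [has_rd] in every unit direction. *)
Definition has_cderiv f z (L : endo V) := exists C a : R, [/\ 0 <= C, 0 < a &
  forall h, cabs h < a -> nm (f (z + h) - f z - h *: L) <= C * cabs h ^+ 2].

Lemma pser_derive a z : unit_radius a -> cabs z < 1 ->
  has_cderiv (pser a) z (pser (dcoef a) z).
Proof.
move=> ar z1; pose s := (1 + cabs z) / 2; have z0 := cabs_ge0 z.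
have s0 : 0 < s by rewrite /s; lra.
have zs : cabs z < s by rewrite /s; lra.
have s1 : s < 1 by rewrite /s; lra.
have s01 : 0 <= s < 1 by rewrite ltW.
have [M [t [M0 /andP[t0 t1] st aM]]] := unit_radius_bound ar s01.
have q01 : 0 < s / t < 1 by rewrite divr_gt0//= ltr_pdivrMr// mul1r.
have [K hK] := sqr_geometric_sum_le q01.
have K0 : 0 <= K by have := hK 0%N; rewrite big_ord0.
have s2 : 0 < s ^+ 2 by rewrite exprn_gt0.
exists (M * K / s ^+ 2), (s - cabs z); split.
- exact: divr_ge0 (mulr_ge0 M0 K0) (ltW s2).
- by rewrite subr_gt0.
move=> h hs; have zhs : cabs (z + h) <= s.
  by rewrite (le_trans (cabsD _ _))// -lerBrDl ltW.
have zh1 : cabs (z + h) < 1 by exact: le_lt_trans zhs s1.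
have l1 := pser_cvg ar zh1; have l2 := pser_cvg ar z1.
have l3 := pser_cvg (dcoef_unit_radius ar) z1.
(* The derivative of a polynomial with [n.+1] coefficients has [n] of them. *)
have lim : (peval a n.+1 (z + h) - peval a n.+1 z - h *: peval (dcoef a) n z)
    @[n --> \oo] --> pser a (z + h) - pser a z - h *: pser (dcoef a) z.
  have m1 : peval a n.+1 (z + h) @[n --> \oo] --> pser a (z + h).
    by move: l1; rewrite -cvg_shiftS.
  have m2 : peval a n.+1 z @[n --> \oo] --> pser a z.
    by move: l2; rewrite -cvg_shiftS.
  have m3 : h *: peval (dcoef a) n z @[n --> \oo] --> h *: pser (dcoef a) z.
    by apply: cvgZr; exact: l3.
  exact: cvgB (cvgB m1 m2) m3.
apply: (cvg_nm_bound lim); apply: nearW => n.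
have -> : peval a n.+1 (z + h) - peval a n.+1 z - h *: peval (dcoef a) n z =
    \sum_(k < n.+1) ((z + h) ^+ k - z ^+ k - k%:R * h * z ^+ k.-1) *: a k.
  under [RHS]eq_bigr do rewrite !scalerBl.
  rewrite !sumrB; congr (_ - _ - _).
  rewrite [RHS]big_ord_recl/= mul0r mul0r scale0r add0r /peval scaler_sumr.
  apply: eq_bigr => k _; rewrite /dcoef !scalerA /bump/= add1n ?add0n; congr (_ *: _).
  by ring.
rewrite (le_trans (nm_sum _ _ _))//.
apply: (@le_trans _ _ (\sum_(k < n.+1) M * cabs h ^+ 2 / s ^+ 2 * (k%:R ^+ 2 * (s / t) ^+ k))).
  apply: ler_sum => k _; rewrite nmZ.
  have := expr_remainder k s0 (ltW zs) zhs; rewrite -ler_pdivlMr// => h1.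
  apply: (@le_trans _ _ (k%:R ^+ 2 * cabs h ^+ 2 * s ^+ k / s ^+ 2 * (M * (t ^+ k)^-1))).
    by apply: ler_pM; rewrite ?cabs_ge0 ?nm_ge0.
  rewrite le_eqVlt; apply/orP; left; apply/eqP; rewrite (expr_div_n s t k).
  move: (s ^+ k) (t ^+ k)^-1 (s ^+ 2)^-1 (cabs h) (k%:R : R); clear=> x1 x2 x3 x4 x5.
  by ring.
rewrite -mulr_sumr.
have -> : M * K / s ^+ 2 * cabs h ^+ 2 = M * cabs h ^+ 2 / s ^+ 2 * K by ring.
by rewrite (ler_wpM2l _ (hK _))// divr_ge0 ?(ltW s2)// mulr_ge0 ?sqr_ge0.
Qed.

Lemma has_cderiv_rd f z w L : cabs w = 1 -> has_cderiv f z L -> has_rd f z w (w *: L).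
Proof.
move=> w1 [C [a [C0 a0 ha]]] e e0.
have C1 : 0 < C + 1 by rewrite ltr_wpDl.
exists (Num.min a (e / (C + 1))); first by rewrite lt_min a0 divr_gt0.
move=> h; rewrite lt_min => /andP[h1 h2].
have hw : cabs (h%:C * w) = `|h| by rewrite cabsM cabs_real w1 mulr1.
have := ha (h%:C * w); rewrite hw scalerA => /(_ h1) hle.
rewrite (le_trans hle)// expr2 mulrA ler_wpM2r//.
apply: (@le_trans _ _ ((C + 1) * (e / (C + 1)))).
  by apply: ler_pM => //; [rewrite lerDl|exact: ltW].
by rewrite mulrC divfK ?gt_eqF.
Qed.

Lemma has_cderiv_derivable f z L : has_cderiv f z L -> derivable f z 1.
Proof.
move=> [C [a [C0 a0 ha]]]; apply/cvg_ex; exists L.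
apply/cvg_nmP => e e0.
have C1 : 0 < C + 1 by rewrite ltr_wpDl.
have : \forall h \near (0 : R[i])^', h != 0 by exact: nbhs_dnbhs_neq.
have hnear : \forall h \near (0 : R[i]), cabs h < Num.min a (e / (C + 1)).
  apply/nbhs_nmP; exists (Num.min a (e / (C + 1))); first by rewrite lt_min a0 divr_gt0.
  by move=> h; rewrite subr0.
have : \forall h \near (0 : R[i])^', cabs h < Num.min a (e / (C + 1)).
  exact: nbhs_dnbhs hnear.
apply: filterS2 => h; rewrite lt_min => /andP[h1 h2] h0.
have hp : 0 < cabs h.
  rewrite lt_neqAle cabs_ge0 andbT eq_sym; apply: contra_neq h0 => hc.
  by apply/eqP; rewrite -normr_eq0 -cabsE hc.
have := ha h h1; rewrite [z + h]addrC => hle.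
have -> : h^-1 *: (f (h *: 1 + z) - f z) - L = h^-1 *: (f (h + z) - f z - h *: L).
  by rewrite [RHS]scalerBr scalerA mulVf// scale1r /GRing.scale/= mulr1.
rewrite nmZ cabsV mulrC ltr_pdivrMr// (le_lt_trans hle)// expr2 mulrA ltr_pM2r//.
apply: (@le_lt_trans _ _ ((C + 1) * cabs h)).
  by rewrite ler_wpM2r ?cabs_ge0// lerDl.
by rewrite mulrC -ltr_pdivlMr.
Qed.

Lemma has_cderiv_continuous f z L : has_cderiv f z L -> {for z, continuous f}.
Proof.
move=> /has_cderiv_derivable fd; apply: differentiable_continuous.
exact/derivable1_diffP.
Qed.

End PowerSeries.

(** * Smoothness and flatness of metrics built from power series *)

Section Factorization.
Context {R : realType} {V : hilbertType R}.
Implicit Types (a b g : nat -> endo V) (z w : R[i]) (f P : R[i] -> endo V).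

Lemma continuous_nmP f z : {for z, continuous f} <-> forall e : R, 0 < e ->
  exists2 a : R, 0 < a & forall w, cabs (w - z) < a -> nm (f w - f z) < e.
Proof.
have key (W W' : normedModType R[i]) (k : W' -> W) (x : W') : k @ x --> k x <->
    forall e : R, 0 < e -> exists2 a : R, 0 < a & forall y : W', nm (y - x) < a -> nm (k y - k x) < e.
  rewrite cvg_nmP; split=> kx e e0; first by apply/nbhs_nmP; exact: kx.
  by apply/nbhs_nmP; exact: kx.
exact: (key _ R[i]).
Qed.

Lemma continuous_endoM (T : topologicalType) (f1 f2 : T -> endo V) x :
  {for x, continuous f1} -> {for x, continuous f2} ->
  {for x, continuous (fun y => f1 y * f2 y)}.
Proof. by move=> c1 c2; exact: (cvg_endoM c1 c2). Qed.

Lemma continuous_adj (T : topologicalType) (f : T -> endo V) x :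
  {for x, continuous f} -> {for x, continuous (fun y => (f y)^H)}.
Proof. by move=> c; exact: (cvg_adj c). Qed.

Lemma unit_disc_continuous_ext f P z : unit_disc z -> (forall w, unit_disc w -> f w = P w) ->
  {for z, continuous f} -> {for z, continuous P}.
Proof.
move=> zd fP /continuous_nmP fc; apply/continuous_nmP => e e0.
have [a a0 ha] := fc e e0; have /unit_discP z1 := zd.
exists (Num.min a (1 - cabs z)); first by rewrite lt_min a0 subr_gt0.
move=> w; rewrite lt_min => /andP[wa wz].
rewrite -!fP//; first exact: ha.
by apply/unit_discP; have := cabsD (w - z) z; rewrite subrK; lra.
Qed.

(* The class of functions on the disc closed under the partial derivatives of
   products [A^* B] of antiholomorphic and holomorphic power series. *)
Inductive sesqui_series : (R[i] -> endo V) -> Prop :=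
| sesqui_term a b f : unit_radius a -> unit_radius b ->
    (forall z, unit_disc z -> f z = (pser a z)^H * pser b z) -> sesqui_series f
| sesqui_add f1 f2 f : sesqui_series f1 -> sesqui_series f2 ->
    (forall z, unit_disc z -> f z = f1 z + f2 z) -> sesqui_series f.

Lemma sesqui_ext f P : sesqui_series f ->
  (forall z, unit_disc z -> f z = P z) -> sesqui_series P.
Proof.
move=> sf; case: f / sf => [a b f ar br fE|f1 f2 f s1 s2 fE] fP.
  by apply: (sesqui_term ar br) => z zd; rewrite -fP// fE.
by apply: (sesqui_add s1 s2) => z zd; rewrite -fP// fE.
Qed.

Lemma pser_continuous a z : unit_radius a -> unit_disc z -> {for z, continuous (pser a)}.
Proof.
by move=> ar /unit_discP z1; apply: has_cderiv_continuous; exact: pser_derive.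
Qed.

Lemma pser_rd a z w : unit_radius a -> unit_disc z -> cabs w = 1 ->
  has_rd (pser a) z w (w *: pser (dcoef a) z).
Proof.
by move=> ar /unit_discP z1 w1; apply: has_cderiv_rd => //; exact: pser_derive.
Qed.

Lemma sesqui_continuous f z : sesqui_series f -> unit_disc z -> {for z, continuous f}.
Proof.
move=> sf zd; elim: f / sf => [a b f ar br fE|f1 f2 f _ c1 _ c2 fE].
  apply: (@unit_disc_continuous_ext (fun z => (pser a z)^H * pser b z)) => //.
    by move=> w /fE.
  by apply: continuous_endoM; [apply: continuous_adj|]; exact: pser_continuous.
apply: (@unit_disc_continuous_ext (fun z => f1 z + f2 z)) => //; first by move=> w /fE.
exact: (@continuousD _ (endo V) R[i] f1 f2 z c1 c2).
Qed.

Lemma has_rd_disc_ext f P z w L : unit_disc z -> cabs w = 1 ->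
  (forall x, unit_disc x -> f x = P x) -> has_rd f z w L -> has_rd P z w L.
Proof.
move=> zd w1 fP; have [r r0 hr] := unit_disc_line zd w1.
by apply: has_rd_ext r0 _ => h /hr; exact: fP.
Qed.

Lemma sesqui_rd f w : sesqui_series f -> cabs w = 1 ->
  exists2 df, sesqui_series df & forall z, unit_disc z -> has_rd f z w (df z).
Proof.
move=> sf w1; elim: f / sf => [a b f ar br fE|f1 f2 f _ [d1 s1 h1] _ [d2 s2 h2] fE].
  have ar' := dcoef_unit_radius ar; have br' := dcoef_unit_radius br.
  exists (fun z => (pser (fun k => w *: dcoef a k) z)^H * pser b z +
    (pser a z)^H * pser (fun k => w *: dcoef b k) z).
    apply: (@sesqui_add (fun z => (pser (fun k => w *: dcoef a k) z)^H * pser b z)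
      (fun z => (pser a z)^H * pser (fun k => w *: dcoef b k) z)) => //.
      by apply: (@sesqui_term (fun k => w *: dcoef a k) b) => //; exact: unit_radiusZ.
    by apply: (@sesqui_term a (fun k => w *: dcoef b k)) => //; exact: unit_radiusZ.
  move=> z zd; apply: (@has_rd_disc_ext (fun z => (pser a z)^H * pser b z)) => //.
    by move=> x /fE.
  have /unit_discP z1 := zd; rewrite !pserZ//.
  by apply: has_rdM; [apply: has_rd_adj|]; exact: pser_rd.
exists (fun z => d1 z + d2 z); first exact: sesqui_add s1 s2 _.
move=> z zd; apply: (@has_rd_disc_ext (fun z => f1 z + f2 z)) => //.
  by move=> x /fE.
by apply: has_rdD; [exact: h1|exact: h2].
Qed.

Lemma sesqui_smooth f : sesqui_series f -> smooth_on unit_disc f.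
Proof.
move=> sf k; elim: k f sf => [|k ih] f sf /=.
  by split=> // z; exact: sesqui_continuous.
split=> [z|]; first exact: sesqui_continuous.
have i1 : cabs ('i : R[i]) = 1 := cabsi.
have [d1 s1 h1] := sesqui_rd sf cabs1; have [d2 s2 h2] := sesqui_rd sf i1.
split.
- by move=> z zd; split; [exact: has_rd_derivable (h1 z zd)|exact: has_rd_derivable (h2 z zd)].
- by apply: ih; apply: sesqui_ext s1 _ => z /h1/has_rd_derive.
- by apply: ih; apply: sesqui_ext s2 _ => z /h2/has_rd_derive.
Qed.

Lemma invertible_adj (T : endo V) : invertible T -> invertible T^H.
Proof.
by move=> [S [ST TS]]; exists S^H; rewrite -!adjM ST TS adj1.
Qed.

Lemma posdef_conj (C G : endo V) : posdef C -> invertible G -> posdef (G^H * C * G).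
Proof.
move=> pC iG; apply/posdefP.
have GH : (G^H * C * G)^H = G^H * C * G by rewrite !adjM adjK pC.1 mulrA.
split=> // [v|]; first by rewrite inner_real// ler0c -/(qf _ v) qf_conj posdef_gt0.
by apply: invertibleM => //; apply: invertibleM;
  [exact: invertible_adj|exact: posdef_invertible].
Qed.

(** The antiholomorphic factor cancels: [P^-1 P_z = G^-1 G'] is holomorphic, so its [zbar]
    derivative vanishes. *)
Lemma factor_flat P C g : posdef C -> unit_radius g ->
  (forall z, unit_disc z -> invertible (pser g z)) ->
  (forall z, unit_disc z -> P z = (pser g z)^H * C * pser g z) ->
  smooth_on unit_disc P /\ forall z, unit_disc z -> curvature P z = 0.
Proof.
move=> pC gr Gi PE; split.
  apply: sesqui_smooth; apply: (@sesqui_term g (fun k => C * g k)) => //.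
    exact: unit_radiusM.
  by move=> z zd; have /unit_discP z1 := zd; rewrite PE// pserM// mulrA.
have i1 : cabs ('i : R[i]) = 1 := cabsi.
pose G := pser g; pose dG := pser (dcoef g).
have Prd z w : unit_disc z -> cabs w = 1 ->
    has_rd P z w ((w *: dG z)^H * C * G z + (G z)^H * C * (w *: dG z)).
  move=> zd w1; apply: (@has_rd_disc_ext (fun z => (G z)^H * C * G z)) => //.
    by move=> x /PE.
  have -> : (w *: dG z)^H * C * G z = ((w *: dG z)^H * C + (G z)^H * 0) * G z.
    by rewrite mulr0 addr0.
  apply: has_rdM; last exact: pser_rd.
  by apply: has_rdM; [apply: has_rd_adj; exact: pser_rd|exact: has_rd_cst].
have Pz z : unit_disc z -> partial_z P z = (G z)^H * C * dG z.
  move=> zd; rewrite /partial_z /partial_x /partial_y.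
  rewrite (has_rd_derive (Prd z 1 zd cabs1)) (has_rd_derive (Prd z 'i zd i1)).
  rewrite !scale1r adjZ conjCi !endoZl !endoZr [X in _ - X]scalerDr !scalerA mulrN -expr2 sqrCi.
  rewrite opprK scale1r scaleN1r opprD opprK addrACA subrr add0r -mulr2n.
  by rewrite -[X in _ *: X]scaler_nat scalerA mulVf ?scale1r// pnatr_eq0.
move=> z zd.
have Xrd w : cabs w = 1 ->
    has_rd (fun x => inverse (P x) * partial_z P x) z w
      (w *: (inverse (G z) * pser (dcoef (dcoef g)) z
        - inverse (G z) * dG z * inverse (G z) * dG z)).
  move=> w1.
  apply: (@has_rd_disc_ext (fun x => inverse (G x) * dG x)) => //.
    move=> x xd; have [iG1 iG2] := inverseP (Gi x xd).
    have pP : posdef (P x) by rewrite PE//; apply: posdef_conj => //; exact: Gi.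
    have [iP1 iP2] := inverseP (posdef_invertible pP).
    rewrite Pz// -[LHS]mul1r -iP1 -mulrA; congr (_ * _).
    by rewrite PE// !mulrA -[_ * inverse _]mulrA iG2 mulr1.
  have [r r0 hr] := unit_disc_line zd w1.
  have -> : w *: (inverse (G z) * pser (dcoef (dcoef g)) z
        - inverse (G z) * dG z * inverse (G z) * dG z) =
      - (inverse (G z) * (w *: dG z) * inverse (G z)) * dG z +
      inverse (G z) * (w *: pser (dcoef (dcoef g)) z).
    by rewrite scalerBr !(mulNr, endoZr, endoZl) [RHS]addrC.
  apply: has_rdM; last by apply: pser_rd => //; exact: dcoef_unit_radius.
  apply: (has_rd_inverse r0); last exact: pser_rd.
  by move=> h /hr; exact: Gi.
rewrite /curvature /partial_zbar /partial_x /partial_y.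
rewrite (has_rd_derive (Xrd 1 cabs1)) (has_rd_derive (Xrd 'i i1)) scale1r scalerA -expr2 sqrCi scaleN1r.
by rewrite subrr scaler0 oppr0.
Qed.

Lemma factor_holomorphic P C g : posdef C -> unit_radius g ->
  (forall z, unit_disc z -> invertible (pser g z)) ->
  (forall z, unit_disc z -> P z = (pser g z)^H * C * pser g z) ->
  exists2 H, holomorphic_factor P H & forall A, unital_Cstar_subalgebra A ->
    A C -> (forall k, A (g k)) -> forall z, unit_disc z -> A (H z).
Proof.
move=> pC gr Gi PE; have [S [SH SC Si SA]] := posdef_sqrt pC.
have Sr : unit_radius (fun k => S * g k) by exact: unit_radiusM.
exists (pser (fun k => S * g k)); first split.
- move=> z /unit_discP z1; apply: has_cderiv_derivable; exact: pser_derive.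
- by move=> z zd; have /unit_discP z1 := zd; rewrite pserM//; apply: invertibleM => //; exact: Gi.
- move=> z zd; have /unit_discP z1 := zd.
  by rewrite pserM// adjM SH mulrA -(mulrA _ S S) SC PE.
move=> A AP AC Ag z /unit_discP z1; apply: (salg_lim AP (pser_cvg Sr z1)) => n.
apply: (salg_sum AP) => k _; apply: (salgZ AP); apply: (salgM AP) => //.
exact: SA.
Qed.

End Factorization.

(** * Limits of factorized metrics *)

Section SpectralMetric.
Context {R : realType} {V : hilbertType R}.
Implicit Types (g h : nat -> endo V) (z w : R[i]) (F : R[i] -> endo V) (C : endo V).

Lemma peval_continuous g n z : {for z, continuous (peval g n)}.
Proof.
elim: n g => [|n ih] g.
  have -> : peval g 0 = fun=> 0 by apply/funext => w; rewrite /peval big_ord0.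
  exact: cst_continuous.
have -> : peval g n.+1 = fun w => g 0%N + w *: (1 : endo V) * peval (fun k => g k.+1) n w.
  apply/funext => w; rewrite /peval big_ord_recl expr0 scale1r; congr (_ + _).
  by rewrite endoZl mul1r scaler_sumr; apply: eq_bigr => k _; rewrite scalerA -exprS.
apply: continuousD; first exact: cst_continuous.
apply: continuous_endoM => //; apply/continuous_nmP => e e0; exists e => // w wz.
rewrite -scalerBl nmZ (le_lt_trans _ wz)// ler_piMr ?cabs_ge0//; exact: nm_endo1.
Qed.

Definition series_metric C g z := (pser g z)^H * C * pser g z.

Lemma spectral_pserE F d C g h z : spectral F d C g h -> pser g z = peval g d.+1 z.
Proof. by move=> [[_ _ g0] _]; exact: pser_poly. Qed.

Lemma spectral_unit_radius F d C g h : spectral F d C g h -> unit_radius g.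
Proof. by move=> [[_ _ g0] _]; exact: poly_unit_radius g0. Qed.

Lemma spectral_invertible F d C g h z : spectral F d C g h ->
  closed_unit_disc z -> invertible (pser g z).
Proof.
move=> s /closed_discP z1; rewrite (spectral_pserE z s).
by have [[_ _ g0] [gh hg hnull _]] := s; exact: peval_invertible gh hg hnull z1.
Qed.

Lemma spectral_flat F d C g h : spectral F d C g h -> flat_metric (series_metric C g).
Proof.
move=> s; have [[pC _ g0] [_ _ _ _]] := s.
have sub := @unit_disc_closed R.
have [||//|smooth curv] := @factor_flat _ _ (series_metric C g) C g pC.
- exact: spectral_unit_radius s.
- by move=> z /sub; exact: spectral_invertible s.
split=> //; last first.
  by move=> z z1; apply: posdef_conj => //; exact: spectral_invertible s z1.
suff cont z : {for z, continuous (series_metric C g)}.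
  by apply: continuous_subspaceT => z; exact: cont.
have -> : series_metric C g = fun w => (peval g d.+1 w)^H * C * peval g d.+1 w.
  by apply/funext => w; rewrite /series_metric (spectral_pserE w s).
apply: continuous_endoM; last exact: peval_continuous.
apply: (@continuous_endoM _ _ _ (fun w => (peval g d.+1 w)^H)); last exact: cst_continuous.
by apply: continuous_adj; exact: peval_continuous.
Qed.

Lemma spectral_circle F d C g h w : spectral F d C g h -> unit_circle w ->
  series_metric C g w = F w.
Proof.
move=> s /unit_circleP w1; have [_ [_ _ _ FE]] := s.
by rewrite FE// /series_metric (spectral_pserE _ s).
Qed.

Lemma spectral_metric0 F d C g h : spectral F d C g h -> series_metric C g 0 = C.
Proof.
move=> s; have [[_ g1 _] _] := s; rewrite /series_metric (spectral_pserE _ s).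
rewrite /peval big_ord_recl expr0 scale1r big1 ?addr0 => [|k _].
  by rewrite g1 adj1 mul1r mulr1.
by rewrite expr0n scale0r.
Qed.

Lemma const_metricE (c : R) z : 0 < c ->
  series_metric (c%:C *: (1 : endo V)) delta z = c%:C *: (1 : endo V).
Proof.
move=> c0; rewrite /series_metric (spectral_pserE _ (spectral_const c0)).
by rewrite /peval big_ord1 expr0 scale1r adj1 mul1r mulr1.
Qed.

Section Bounds.
Context (F : R[i] -> endo V) (d : nat) (C : endo V) (g h : nat -> endo V) (a b : R).
Hypotheses (s : spectral F d C g h) (a0 : 0 < a) (ab : a <= b).
Hypothesis Fge : forall w, cabs w = 1 -> bounded_below a (F w).
Hypothesis Fle : forall w, cabs w = 1 -> forall v, qf (F w) v <= b * nm v ^+ 2.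

(** Constant metrics are flat, so the bound on the circle propagates inside by the comparison
    principle; likewise for the upper bound. *)
Lemma series_metric_ge z : closed_unit_disc z -> bounded_below a (series_metric C g z).
Proof.
move=> z1 v; have c1 := spectral_flat (spectral_const ltr01).
have ai : 0 <= a^-1 by rewrite invr_ge0 ltW.
have := @flat_compare _ _ _ _ a^-1 (spectral_flat s) c1 ai.
move=> /(_ _ z z1 v); rewrite !const_metricE// qfZ qf1 mul1r ler_pdivlMl//; apply.
move=> w w1 u; rewrite const_metricE// qfZ qf1 mul1r ler_pdivlMl// (spectral_circle s w1).
by apply: Fge; apply/unit_circleP.
Qed.

Lemma series_metric_le z v : closed_unit_disc z ->
  qf (series_metric C g z) v <= b * nm v ^+ 2.
Proof.
move=> z1; have c1 := spectral_flat (spectral_const ltr01).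
have b0 : 0 <= b by apply: le_trans ab; exact: ltW.
have := @flat_compare _ _ _ _ b c1 (spectral_flat s) b0.
move=> /(_ _ z z1 v); rewrite !const_metricE// qfZ qf1 mul1r; apply.
move=> w w1 u; rewrite const_metricE// qfZ qf1 mul1r (spectral_circle s w1).
by apply: Fle; apply/unit_circleP.
Qed.

Let zero_disc : closed_unit_disc (0 : R[i]).
Proof. by apply/closed_discP; rewrite cabs0. Qed.

Lemma spectral_mid_ge : bounded_below a C.
Proof. by rewrite -(spectral_metric0 s); exact: series_metric_ge. Qed.

Lemma spectral_mid_le v : qf C v <= b * nm v ^+ 2.
Proof. by rewrite -(spectral_metric0 s); exact: series_metric_le. Qed.

(** The crude constant [b / a + 1] replaces the square root of [b / a], since
    [r <= (r + 1) ^+ 2]. *)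
Lemma le_ratio (u v : V) : a * nm u ^+ 2 <= b * nm v ^+ 2 ->
  nm u <= (b / a + 1) * nm v.
Proof.
move=> uv; have r0 : 0 <= b / a + 1.
  by rewrite addr_ge0// divr_ge0 ?(ltW a0)// (le_trans _ ab)// ltW.
rewrite -(@ler_pXn2r _ 2)// ?nnegrE ?nm_ge0 ?mulr_ge0 ?nm_ge0//.
apply: (@le_trans _ _ (b / a * nm v ^+ 2)); first by rewrite mulrAC ler_pdivlMr// mulrC.
rewrite exprMn ler_wpM2r ?sqr_ge0//.
have : 0 <= b / a by rewrite divr_ge0 ?(ltW a0)// (le_trans _ ab)// ltW.
by move: (b / a) => r ?; nra.
Qed.

(** Parseval comparison of [F] with [b] times the identity bounds the sum of all [<C g_j v, g_j v>]
    by [b |v|^2], and [C >= a]. *)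
Lemma spectral_coef_bound j : nm (g j) <= b / a + 1.
Proof.
have b0 : 0 <= b by apply: le_trans ab; exact: ltW.
apply: nm_endo_le => [|v].
  by rewrite addr_ge0// divr_ge0 ?(ltW a0).
apply: le_ratio.
have := @spectral_compare _ _ _ _ _ _ _ _ _ _ _ _ b s (spectral_const ltr01) b0.
move=> /(_ _ j.+1 v); rewrite conv_delta_r qfZ qf1 mul1r => cmp.
apply: le_trans (spectral_mid_ge _) _; apply: le_trans (cmp _).
  rewrite big_ord_recr/= lerDr sumr_ge0// => k _; apply: posdef_gt0.
  by have [[]] := s.
by move=> w w1 u; rewrite qfZ qf1 mul1r; exact: Fle.
Qed.

(** Put [u = G^-1 v] in [a |u|^2 <= <P u, u> = <C v, v> <= b |v|^2]. *)
Lemma spectral_inverse_bound z : closed_unit_disc z ->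
  nm (inverse (pser g z)) <= b / a + 1.
Proof.
move=> z1; have b0 : 0 <= b by apply: le_trans ab; exact: ltW.
apply: nm_endo_le => [|v].
  by rewrite addr_ge0// divr_ge0 ?(ltW a0).
have [_ i2] := inverseP (spectral_invertible s z1).
apply: le_ratio; apply: le_trans (series_metric_ge z1 _) _.
by rewrite qf_conj -endo_mulE i2; exact: spectral_mid_le.
Qed.

End Bounds.

End SpectralMetric.

(** Adding [k] makes [T] nonnegative with form at most [2 k], where [nm_pos_le] applies; removing it
    costs another [k]. *)
Lemma nm_sym_le {R : realType} {V : hilbertType R} (T : endo V) (k : R) :
  T^H = T -> 0 <= k -> (forall v, `|qf T v| <= k * nm v ^+ 2) -> nm T <= 3 * k.
Proof.
move=> TT k0 Tk.
have -> : T = (T + k%:C *: (1 : endo V)) - k%:C *: (1 : endo V) by rewrite addrK.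
apply: le_trans (nmB _ _) _; have -> : 3 * k = 2 * k + k by ring.
apply: lerD; last first.
  by rewrite nmZ cabs_pos// ler_piMr//; exact: nm_endo1.
apply: nm_pos_le; rewrite ?mulr_ge0//.
- by rewrite adjD adjZ adj1 TT conj_real.
- by move=> v; have := Tk v; rewrite qfD qfZ qf1 ler_norml => /andP[]; lra.
- by move=> v; have := Tk v; rewrite qfD qfZ qf1 ler_norml => /andP[]; lra.
Qed.

(** * Convergence of metrics and of their holomorphic factors *)

Section SpectralLimit.
Context {R : realType} {V : hilbertType R}.
Context (Fs : nat -> R[i] -> endo V) (d : nat -> nat) (C : nat -> endo V)
  (g h : nat -> nat -> endo V) (F : R[i] -> endo V) (a b : R).
Hypotheses (s : forall n, spectral (Fs n) (d n) (C n) (g n) (h n))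
  (a0 : 0 < a) (ab : a <= b)
  (Fge : forall n w, cabs w = 1 -> bounded_below a (Fs n w))
  (Fle : forall n w, cabs w = 1 -> forall v, qf (Fs n w) v <= b * nm v ^+ 2)
  (Fcmp : forall e : R, 0 < e -> exists N, forall m n, (N <= m)%N -> (N <= n)%N ->
     forall w, cabs w = 1 -> forall v, qf (Fs m w) v <= (1 + e) * qf (Fs n w) v)
  (Fcvg : forall w, cabs w = 1 -> Fs n w @[n --> \oo] --> F w).

Implicit Types (z w : R[i]) (v : V).

Let b0 : 0 < b. Proof. exact: lt_le_trans ab. Qed.
Let B := b / a + 1.
Let B0 : 0 < B. Proof. by rewrite ltr_wpDl// divr_ge0// ltW. Qed.
Let P n : R[i] -> endo V := series_metric (C n) (g n).
Let Pflat n : flat_metric (P n). Proof. exact: spectral_flat (s n). Qed.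
Let Ppos n z (z1 : closed_unit_disc z) : posdef (P n z).
Proof. by have [_ Pp _ _] := Pflat n; exact: Pp. Qed.
Let Pge n z (z1 : closed_unit_disc z) : bounded_below a (P n z).
Proof. exact: series_metric_ge (s n) a0 (@Fge n) z z1. Qed.
Let Ple n z (z1 : closed_unit_disc z) v : qf (P n z) v <= b * nm v ^+ 2.
Proof. exact: (series_metric_le (s n) a0 ab (@Fle n)). Qed.

Let zero_disc : closed_unit_disc (0 : R[i]).
Proof. by apply/closed_discP; rewrite cabs0. Qed.

Lemma series_metric_compare (e : R) : 0 < e -> exists N, forall m n,
  (N <= m)%N -> (N <= n)%N -> forall z, closed_unit_disc z ->
  forall v, qf (P m z) v <= (1 + e) * qf (P n z) v.
Proof.
move=> e0; have [N hN] := Fcmp e0; exists N => m n Nm Nn.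
apply: flat_compare => //; first by rewrite addr_ge0// ltW.
move=> z zc v; rewrite /P (spectral_circle (s m) zc) (spectral_circle (s n) zc).
by apply: hN => //; apply/unit_circleP.
Qed.

Lemma series_metric_cauchy (e : R) : 0 < e -> exists N, forall m n,
  (N <= m)%N -> (N <= n)%N -> forall z, closed_unit_disc z ->
  nm (P m z - P n z) <= e.
Proof.
(* The common upper bound [b] turns the multiplicative comparison into an additive one; the 3
   anticipates [nm_sym_le]. *)
move=> e0; have e1 : 0 < e / (3 * b) by rewrite divr_gt0// mulr_gt0.
have [N hN] := series_metric_compare e1; exists N => m n Nm Nn z z1.
have -> : e = 3 * (e / 3) by field.
apply: nm_sym_le; first by rewrite adjB (Ppos m z1).1 (Ppos n z1).1.
  by rewrite divr_ge0// ltW.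
have le1 k l : (N <= k)%N -> (N <= l)%N -> forall v,
    qf (P k z) v - qf (P l z) v <= e / 3 * nm v ^+ 2.
  move=> Nk Nl v; have := hN k l Nk Nl z z1 v.
  have : e / (3 * b) * qf (P l z) v <= e / (3 * b) * (b * nm v ^+ 2).
    by rewrite ler_wpM2l ?(ltW e1)// Ple.
  have -> : e / (3 * b) * (b * nm v ^+ 2) = e / 3 * nm v ^+ 2.
    by field; exact: lt0r_neq0.
  by rewrite mulrDl mul1r; lra.
move=> v; rewrite qfB ler_norml; have := le1 m n Nm Nn v; have := le1 n m Nn Nm v.
by move=> h1 h2; apply/andP; split; lra.
Qed.

Let Q z := lim (P n z @[n --> \oo]).

Lemma limit_metric_cvg z : closed_unit_disc z -> P n z @[n --> \oo] --> Q z.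
Proof.
move=> z1; have [T PT] : exists T : endo V, P n z @[n --> \oo] --> T.
  apply: endo_complete => e e0; have e20 : 0 < e / 2 by rewrite divr_gt0.
  have [N hN] := series_metric_cauchy e20; exists N => m n Nm Nn.
  by have := hN m n Nm Nn z z1; lra.
by rewrite /Q (cvg_lim _ PT).
Qed.

Lemma limit_metric_uniform (e : R) : 0 < e -> exists N, forall n, (N <= n)%N ->
  forall z, closed_unit_disc z -> nm (P n z - Q z) <= e.
Proof.
move=> e0; have [N hN] := series_metric_cauchy e0; exists N => n Nn z z1.
have lim : P n z - P m z @[m --> \oo] --> P n z - Q z.
  by apply: cvgB; [exact: cvg_cst|exact: limit_metric_cvg].
by apply: (cvg_nm_bound lim); exists N => // m /= Nm; exact: hN.
Qed.

Lemma limit_metric_posdef z : closed_unit_disc z -> posdef (Q z).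
Proof.
move=> z1; have PQ := limit_metric_cvg z1; split.
  have PH : P n z @[n --> \oo] --> (Q z)^H.
    have E : (fun n => P n z) = (fun n => (P n z)^H).
      by apply/funext => n; rewrite (Ppos n z1).1.
    by rewrite [X in X @ _]E; exact: cvg_adj.
  exact: cvg_unique_seq PH PQ.
exists a => // v; have := @cvg_qf _ _ _ _ v PQ => PQv.
by apply: (cvgr_to_ge PQv); apply: nearW => n; exact: Pge.
Qed.

Lemma limit_metric_continuous : {within closed_unit_disc, continuous Q}.
Proof.
apply/within_continuousP => z z1 e e0; have e40 : 0 < e / 4 by rewrite divr_gt0.
have [N hN] := limit_metric_uniform e40; have [Pc _ _ _] := Pflat N.
move/within_continuousP : Pc => /(_ z z1 _ e40)[r r0 hr].
exists r => // w w1 wz; have := hr w w1 wz.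
have := hN N (leqnn N) w w1; have := hN N (leqnn N) z z1.
move: (P N z) (P N w) (Q z) (Q w) => p p' q q' h1 h2 h3.
have -> : q' - q = (p - q) + (p' - p) - (p' - q').
  by endo_ring.
have := nmB ((p - q) + (p' - p)) (p' - q'); have := nmD (p - q) (p' - p); lra.
Qed.

Lemma limit_metric_circle w : unit_circle w -> Q w = F w.
Proof.
move=> wc; have w1 : cabs w = 1 by apply/unit_circleP.
have wd : closed_unit_disc w by apply/closed_discP; rewrite w1.
apply: cvg_unique_seq (limit_metric_cvg wd) _.
have -> : (fun n => P n w) = (fun n => Fs n w).
  by apply/funext => n; rewrite /P (spectral_circle (s n)).
exact: Fcvg.
Qed.

Let h0 n : h n 0%N = 1.
Proof.
have [[_ g1 _] [gh _ _ _]] := s n.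
by have := congr1 (fun f => f 0%N) gh; rewrite /conv big_ord1 subn0 g1 mul1r.
Qed.

Let trans0 m n : conv (g m) (h n) 0 = 1.
Proof. by have [[_ g1 _] _] := s m; rewrite /conv big_ord1 subn0 g1 mul1r h0. Qed.

(* The power series [G_m G_n^-1] has constant term 1, so its other
   coefficients are controlled by the excess over 1 of the constant in
   [F_m <= (1 + e) F_n]. *)
Lemma transition_small (e : R) : 0 < e -> exists N, forall m n,
  (N <= m)%N -> (N <= n)%N -> forall j, nm (conv (g m) (h n) j.+1) <= e.
Proof.
(* The two comparisons leave an excess [((1 + t) ^+ 2 - 1) <C_m v, v>], at most [3 t b |v|^2] for
   [t <= 1]; it dominates [a |u|^2] for each higher coefficient [u]. *)
move=> e0; pose t := Num.min 1 (a * e ^+ 2 / (3 * b)).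
have t0 : 0 < t by rewrite lt_min ltr01 divr_gt0// mulr_gt0// exprn_gt0.
have t1 : t <= 1 by rewrite ge_min lexx.
have tb : 3 * t * b <= a * e ^+ 2.
  have : t <= a * e ^+ 2 / (3 * b) by rewrite ge_min lexx orbT.
  by rewrite ler_pdivlMr ?mulr_gt0//; lra.
have [N hN] := Fcmp t0; exists N => m n Nm Nn j.
have t10 : 0 <= 1 + t by lra.
apply: nm_endo_le => [|v]; first exact: ltW.
have c1 := spectral_compare (s m) (s n) t10 (hN m n Nm Nn) j.+2 v.
have := spectral_compare (s n) (s m) t10 (hN n m Nn Nm) 1 v.
rewrite big_ord1 trans0 => c2.
have Cp k u : 0 <= qf (C k) u by apply: posdef_gt0; have [[]] := s k.
have c3 : qf (C m) v + qf (C m) (conv (g m) (h n) j.+1 v) <= (1 + t) * qf (C n) v.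
  apply: le_trans c1; rewrite big_ord_recr/= lerD2r big_ord_recl trans0.
  by rewrite lerDl sumr_ge0.
have c4 := spectral_mid_ge (s m) a0 (@Fge m) (conv (g m) (h n) j.+1 v).
have c5 := spectral_mid_le (s m) a0 ab (@Fle m) v.
rewrite -(@ler_pXn2r _ 2)// ?nnegrE ?nm_ge0 ?mulr_ge0 ?nm_ge0 ?(ltW e0)//.
rewrite -(ler_pM2l a0) exprMn [leRHS]mulrA; apply: le_trans c4 _.
apply: (@le_trans _ _ (3 * t * b * nm v ^+ 2)); last by rewrite ler_wpM2r ?sqr_ge0.
rewrite -[leRHS]mulrA; apply: (@le_trans _ _ (3 * t * qf (C m) v)); last first.
  by rewrite ler_wpM2l// mulr_ge0// ltW.
have c6 := Cp m v; move: (qf (C m) v) (qf (C n) v) (qf (C m) (conv _ _ _ _)) c2 c3 c6.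
move=> x y k c2 c3 c6; have := ler_wpM2l t10 c2.
have : t * (t * x) <= 1 * (t * x) by exact: ler_wpM2r (mulr_ge0 (ltW t0) c6) _ _ t1.
by move: c3; rewrite !mulrDl !mulrDr !mul1r; lra.
Qed.

(** Write [G_m = (G_m G_n^-1) G_n]: the constant term 1 reproduces [g n l], and the other terms are
    small coefficients times bounded ones. *)
Lemma coef_cauchy l : ncauchy (fun n => g n l).
Proof.
move=> e e0; have lp : 0 < l.+1%:R * B by rewrite mulr_gt0// ltr0n.
have [N hN] := transition_small (divr_gt0 e0 lp); exists N => m n Nm Nn.
have [_ [_ hg _ _]] := s n.
have gE : g m l = \sum_(k < l.+1) conv (g m) (h n) (l - k) * g n k.
  by rewrite -/(conv _ _ _) -convA hg conv_delta_r.
rewrite gE big_ord_recr/= subnn trans0 mul1r addrK.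
apply: le_lt_trans (nm_sum _ _ _) _.
apply: (@le_lt_trans _ _ (\sum_(k < l) (e / (l.+1%:R * B) * B))).
  apply: ler_sum => k _; rewrite (le_trans (nmM _ _))//.
  have -> : (l - k = (l - k).-1.+1)%N by rewrite prednK// subn_gt0.
  apply: ler_pM; rewrite ?nm_ge0 ?hN//.
  exact: (spectral_coef_bound (s n) a0 ab (@Fge n) (@Fle n)).
rewrite sumr_const card_ord -[X in X < _]mulr_natl.
have -> : l%:R * (e / (l.+1%:R * B) * B) = e * (l%:R / l.+1%:R).
  have l0 : l.+1%:R != 0 :> R by rewrite pnatr_eq0.
  have B1 := lt0r_neq0 B0; move: (l%:R : R) (l.+1%:R : R) B l0 B1 => x y k y0 k0.
  by field; rewrite y0.
by rewrite gtr_pMr// ltr_pdivrMr ?ltr0n// mul1r ltr_nat.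
Qed.

Let c l := lim (g n l @[n --> \oo]).

Lemma limit_coef_cvg l : g n l @[n --> \oo] --> c l.
Proof.
by have [T gT] := endo_complete (@coef_cauchy l); rewrite /c (cvg_lim _ gT).
Qed.

Let cB l : nm (c l) <= B.
Proof.
apply: (cvg_nm_bound (@limit_coef_cvg l)); apply: nearW => n.
exact: (spectral_coef_bound (s n) a0 ab (@Fge n) (@Fle n)).
Qed.

Lemma pser_tail (x : nat -> endo V) z K : unit_radius x -> (forall k, nm (x k) <= B) ->
  cabs z < 1 -> nm (pser x z - peval x K z) <= B / (1 - cabs z) * cabs z ^+ K.
Proof.
move=> xr xB z1; have q01 : 0 <= cabs z < 1 by rewrite cabs_ge0.
have [|bound _] := @geometric_ncauchy _ _ (fun n => peval x n z) (cabs z) B q01.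
  move=> n; rewrite /peval big_ord_recr/= addrAC subrr add0r nmZ cabsX mulrC.
  by rewrite ler_wpM2r ?exprn_ge0 ?cabs_ge0.
have lim : peval x n z - peval x K z @[n --> \oo] --> pser x z - peval x K z.
  by apply: cvgB; [exact: pser_cvg|exact: cvg_cst].
apply: (cvg_nm_bound lim); exists K => // n /= Kn.
by have := bound (n - K)%N K; rewrite subnKC.
Qed.

Let c_radius : unit_radius c.
Proof.
move=> r /andP[r0 r1]; exists B => k; rewrite -[leRHS]mulr1.
by apply: ler_pM; rewrite ?nm_ge0 ?exprn_ge0 ?exprn_ile1// ltW.
Qed.

(** The coefficient bound [B] is independent of [n], so the tails are small uniformly and only
    finitely many coefficients need to converge. *)
Lemma limit_series_cvg z : unit_disc z -> pser (g n) z @[n --> \oo] --> pser c z.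
Proof.
move=> /unit_discP z1; apply/cvg_nmP_seq => e e0.
have e40 : 0 < e / 4 by rewrite divr_gt0.
have q01 : 0 <= cabs z < 1 by rewrite cabs_ge0.
have /cvgrPdist_lt/(_ _ e40)[K _ hK] := expr_lt_cvg0 (B / (1 - cabs z)) q01.
have {}hK : B / (1 - cabs z) * cabs z ^+ K < e / 4.
  by have := hK K (leqnn K); rewrite /= sub0r normrN; exact: le_lt_trans (ler_norm _).
have : peval (g n) K z @[n --> \oo] --> peval c K z.
  apply: (@cvg_seq_sum _ _ _ (fun k n => z ^+ k *: g n k) (fun k => z ^+ k *: c k)).
  by move=> k; apply: cvgZr; exact: limit_coef_cvg.
move=> /cvg_nmP_seq/(_ _ e40)[N hN]; exists N => n /hN h1.
have h2 := pser_tail K c_radius cB z1.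
have h3 := pser_tail K (spectral_unit_radius (s n))
  (spectral_coef_bound (s n) a0 ab (@Fge n) (@Fle n)) z1.
have tri (x p p' y : endo V) : nm (x - y) <= nm (x - p) + nm (p - p') + nm (y - p').
  have -> : x - y = (x - p) + (p - p') - (y - p') by endo_ring.
  by rewrite (le_trans (nmB _ _))// lerD2r nmD.
apply: le_lt_trans (tri _ (peval (g n) K z) (peval c K z) _) _.
have := le_trans h2 (ltW hK).
have := le_trans h3 (ltW hK); move: (nm _) (nm _) (nm _) h1 => p q r; lra.
Qed.

(** A limit of invertible operators may fail to be invertible; the bound [B] on the inverses,
    independent of [n], rules this out by a Neumann series. *)
Lemma limit_series_invertible z : unit_disc z -> invertible (pser c z).
Proof.
move=> zd; have z1 := unit_disc_closed zd.
have e0 : 0 < (2 * B)^-1 by rewrite invr_gt0 mulr_gt0.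
have /cvg_nmP_seq/(_ _ e0)[N /(_ N (leqnn N)) hN] := limit_series_cvg zd.
have Gi := spectral_invertible (s N) z1; have [i1 i2] := inverseP Gi.
have iB := spectral_inverse_bound (s N) a0 ab (@Fge N) (@Fle N) z1.
pose E := inverse (pser (g N) z) * (pser (g N) z - pser c z).
have E2 : nm E <= 2^-1.
  apply: le_trans (nmM _ _) _; have -> : 2^-1 = B * (2 * B)^-1.
    by field; exact: lt0r_neq0.
  by apply: ler_pM; rewrite ?nm_ge0// ltW.
have h21 : (2^-1 : R) < 1 by rewrite invf_lt1// ltr1n.
have [L [L1 L2 _]] := neumann E2 h21.
have -> : pser c z = pser (g N) z * (1 - E).
  by rewrite mulrBr mulr1 /E mulrA i2 mul1r subKr.
by apply: invertibleM => //; exists L.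
Qed.

Lemma limit_factor z : unit_disc z -> Q z = (pser c z)^H * Q 0 * pser c z.
Proof.
move=> zd; apply: cvg_unique_seq (limit_metric_cvg (unit_disc_closed zd)) _.
(* The normalization at the origin gives [P n 0 = C n], so the middle factors converge as values of
   the metrics. *)
have C0 : C n @[n --> \oo] --> Q 0.
  rewrite (_ : (fun n => C n) = fun n => P n 0); first exact: limit_metric_cvg.
  by apply/funext => n; rewrite /P (spectral_metric0 (s n)).
have G := limit_series_cvg zd.
exact: cvg_endoM (cvg_endoM (cvg_adj G) C0) G.
Qed.

Lemma spectral_limit : exists P : R[i] -> endo V,
  [/\ flat_metric P, forall w, unit_circle w -> P w = F w &
    exists2 H, holomorphic_factor P H & forall A, unital_Cstar_subalgebra A ->
      (forall n, A (C n) /\ forall j, A (g n j)) ->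
      (forall z, closed_unit_disc z -> A (P z)) /\ forall z, unit_disc z -> A (H z)].
Proof.
have Q0 := limit_metric_posdef zero_disc.
have [smooth curv] := factor_flat Q0 c_radius limit_series_invertible limit_factor.
exists Q; split.
- exact: (And4 limit_metric_continuous limit_metric_posdef smooth curv).
- exact: limit_metric_circle.
have [H QH HA] := factor_holomorphic Q0 c_radius limit_series_invertible limit_factor.
exists H => // A AP AC.
have AQ z : closed_unit_disc z -> A (Q z).
  move=> z1; apply: (salg_lim AP (limit_metric_cvg z1)) => n; have [AC1 Ag] := AC n.
  rewrite /P /series_metric (spectral_pserE _ (s n)).
  have Ap : A (peval (g n) (d n).+1 z).
    by apply: (salg_sum AP) => k _; exact: (salgZ AP).
  by apply: (salgM AP) => //; apply: (salgM AP) => //; exact: salg_adj.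
split=> //; apply: HA => //; first exact: AQ.
move=> k; apply: (salg_lim AP (@limit_coef_cvg k)) => n; exact: (AC n).2.
Qed.

End SpectralLimit.

(** * Approximation of the boundary values and conclusion *)

Lemma qf_near {R : realType} {V : hilbertType R} (S T : endo V) (e : R) v :
  nm (S - T) <= e -> `|qf S v - qf T v| <= e * nm v ^+ 2.
Proof.
by move=> h; rewrite -qfB (le_trans (qf_norm_le _ _))// ler_wpM2r ?sqr_ge0.
Qed.

Lemma spectral_approx {R : realType} {V : hilbertType R} (F : R[i] -> endo V)
    (c M e : R) :
  (forall w, cabs w = 1 -> adjoint (F w) = F w) ->
  (forall w, cabs w = 1 -> nm (F w) <= M) ->
  (forall r : R, 0 < r -> exists2 a : R, 0 < a & forall z w,
     cabs z = 1 -> cabs w = 1 -> cabs (z - w) < a -> nm (F z - F w) < r) ->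
  (forall w, cabs w = 1 -> bounded_below c (F w)) ->
  0 < c -> 0 < M -> 0 < e -> e <= c / 2 ->
  exists F' d C g h, [/\ spectral F' d C g h,
    forall w, cabs w = 1 -> nm (F' w - F w) <= e,
    forall w, cabs w = 1 -> bounded_below (c / 2) (F' w),
    forall w, cabs w = 1 -> forall v, qf (F' w) v <= (M + c) * nm v ^+ 2 &
    forall A, unital_Cstar_subalgebra A -> (forall w, cabs w = 1 -> A (F w)) ->
      A C /\ forall j, A (g j)].
Proof.
move=> FH FM Funif Fc c0 M0 e0 ec.
have [n [phi [phi0 phiH symF Fn phiA]]] := trig_approx FH FM Funif e0.
have Fe w v : cabs w = 1 -> `|qf (trig_poly phi n w) v - qf (F w) v| <= c / 2 * nm v ^+ 2.
  by move=> w1; apply: qf_near; apply: le_trans ec; exact: Fn.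
have Fge w : cabs w = 1 -> bounded_below (c / 2) (trig_poly phi n w).
  move=> w1 v; have := Fe w v w1; have := Fc w w1 v; rewrite ler_norml.
  by move: (qf _ _) (qf _ _) (nm v ^+ 2) => x y k h1 /andP[]; lra.
have Fle w : cabs w = 1 -> forall v, qf (trig_poly phi n w) v <= (M + c) * nm v ^+ 2.
  move=> w1 v; have : qf (F w) v <= M * nm v ^+ 2.
    by rewrite (le_trans (qf_le _ _))// ler_wpM2r ?sqr_ge0 ?FM.
  have : 0 <= c * nm v ^+ 2 by rewrite mulr_ge0 ?sqr_ge0// ltW.
  have := Fe w v w1; rewrite ler_norml.
  by move: (qf _ _) (qf _ _) (nm v ^+ 2) => x y k /andP[]; lra.
have [||C [g [h [s sA]]]] := spectral_exists phi0 phiH symF Fge Fle.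
- by rewrite divr_gt0.
- lra.
exists (trig_poly phi n), n, C, g, h; split=> // A AP AF.
by apply: sA => //; exact: phiA.
Qed.

Theorem theorem1p1 (R : realType) (V : hilbertType R) (F : R[i] -> endo V)
    (F_continuous : {within unit_circle, continuous F})
    (F_positive : forall z, unit_circle z -> positive_invertible (F z)) :
  exists P : R[i] -> endo V,
    [/\ flat_extension F P,
        forall Q : R[i] -> endo V, flat_extension F Q ->
          forall z, closed_unit_disc z -> Q z = P z,
        exists H : R[i] -> endo V, holomorphic_factor P H
      & forall A : set (endo V), unital_Cstar_subalgebra A ->
          (forall z, unit_circle z -> A (F z)) ->
          (forall z, closed_unit_disc z -> A (P z)) /\
          exists H : R[i] -> endo V,
            holomorphic_factor P H /\ forall z, unit_disc z -> A (H z)].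
Proof.
have pF w : cabs w = 1 -> posdef (F w) by move=> /unit_circleP/F_positive/posdefP.
have [M M0 FM] := compact_bounded unit_circle_compact F_continuous.
have [|c c0 Fc] := compact_bounded_below unit_circle_compact F_continuous.
  by move=> w /unit_circleP/pF[].
have Funif (r : R) : 0 < r -> exists2 a : R, 0 < a & forall z w,
    cabs z = 1 -> cabs w = 1 -> cabs (z - w) < a -> nm (F z - F w) < r.
  move=> /(compact_uniform unit_circle_compact F_continuous)[a a0 ha].
  by exists a => // z w z1 w1; apply: ha; apply/unit_circleP.
pose e n := c / 2 * 2^-1 ^+ n.
have h01 : 0 <= (2^-1 : R) < 1 by rewrite invr_ge0 ler0n invf_lt1 ?ltr1n.
have ec n : e n <= c / 2.
  by rewrite ler_piMr ?divr_ge0 ?(ltW c0)// exprn_ile1//; have [] := andP h01; lra.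
have e0 n : 0 < e n by rewrite mulr_gt0 ?divr_gt0// exprn_gt0.
have elim (r : R) : 0 < r -> exists N, forall n, (N <= n)%N -> e n < r.
  move=> r0; have /cvgrPdist_lt/(_ _ r0)[N _ hN] := expr_lt_cvg0 (c / 2) h01.
  exists N => n /hN; rewrite /= sub0r normrN; exact: le_lt_trans (ler_norm _).
have [|f fP] := @choice nat ((R[i] -> endo V) * nat * endo V * (nat -> endo V) *
    (nat -> endo V)) (fun n x => [/\ spectral x.1.1.1.1 x.1.1.1.2 x.1.1.2 x.1.2 x.2,
      forall w, cabs w = 1 -> nm (x.1.1.1.1 w - F w) <= e n,
      forall w, cabs w = 1 -> bounded_below (c / 2) (x.1.1.1.1 w),
      forall w, cabs w = 1 -> forall v, qf (x.1.1.1.1 w) v <= (M + c) * nm v ^+ 2 &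
      forall A, unital_Cstar_subalgebra A -> (forall w, cabs w = 1 -> A (F w)) ->
        A x.1.1.2 /\ forall j, A (x.1.2 j)]).
  move=> n; have [|||F' [d [C [g [h hP]]]]] :=
      @spectral_approx _ _ F c M (e n) _ _ Funif _ c0 M0 (e0 n) (ec n).
  - by move=> w /pF[].
  - by move=> w /unit_circleP/FM.
  - by move=> w /unit_circleP/Fc.
  - by exists (F', d, C, g, h).
pose Fs n := (f n).1.1.1.1; pose C n := (f n).1.1.2; pose g n := (f n).1.2.
have s n : spectral (Fs n) (f n).1.1.1.2 (C n) (g n) (f n).2 by have [] := fP n.
have FsF n w : cabs w = 1 -> nm (Fs n w - F w) <= e n by have [_ + _ _ _] := fP n; exact.
have Fge n w : cabs w = 1 -> bounded_below (c / 2) (Fs n w) by have [_ _ + _ _] := fP n; exact.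
have Fle n w : cabs w = 1 -> forall v, qf (Fs n w) v <= (M + c) * nm v ^+ 2.
  by have [_ _ _ + _] := fP n; exact.
have a0 : 0 < c / 2 by rewrite divr_gt0.
have ab : c / 2 <= M + c by lra.
(* Additive closeness becomes a multiplicative comparison because all [Fs n] are bounded below by
   the same [c / 2]. *)
have Fcmp (r : R) : 0 < r -> exists N, forall m n, (N <= m)%N -> (N <= n)%N ->
    forall w, cabs w = 1 -> forall v, qf (Fs m w) v <= (1 + r) * qf (Fs n w) v.
  move=> r0; have r1 : 0 < r * (c / 2) / 2 by rewrite divr_gt0// mulr_gt0.
  have [N hN] := elim _ r1; exists N => m n Nm Nn w w1 v.
  have close : nm (Fs m w - Fs n w) <= r * (c / 2).
    have -> : Fs m w - Fs n w = (Fs m w - F w) - (Fs n w - F w).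
      by rewrite opprB addrA subrK.
    have h1 := le_lt_trans (FsF m w w1) (hN m Nm).
    have h2 := le_lt_trans (FsF n w w1) (hN n Nn).
    apply: le_trans (nmB _ _) _; rewrite [leRHS]splitr.
    exact: lerD (ltW h1) (ltW h2).
  have := ler_wpM2l (ltW r0) (Fge n w w1 v); have := qf_near v close.
  rewrite ler_norml mulrDl mul1r !mulrA.
  by move: (qf _ _) (qf _ _) (nm v ^+ 2) => x y k /andP[]; lra.
have Fcvg w : cabs w = 1 -> Fs n w @[n --> \oo] --> F w.
  move=> w1; apply/cvg_nmP_seq => r /elim[N hN]; exists N => n /hN.
  by apply: le_lt_trans; exact: FsF.
have [P [flatP PF [H PH HA]]] := spectral_limit s a0 ab Fge Fle Fcmp Fcvg.
have flat_ext Q : flat_extension F Q <-> flat_metric Q /\ forall w, unit_circle w -> Q w = F w.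
  split=> [[Qc Qp Qs QF Q0]|[[Qc Qp Qs Q0] QF]].
    exact: conj (And4 Qc (fun z z1 => (posdefP _).1 (Qp z z1)) Qs Q0) QF.
  exact: And5 Qc (fun z z1 => (posdefP _).2 (Qp z z1)) Qs QF Q0.
exists P; split.
- by apply/flat_ext; exact: conj flatP PF.
- move=> Q /flat_ext[flatQ QF]; apply: flat_metric_unique => // w w1.
  by rewrite QF// PF.
- by exists H.
move=> A AP AF; have [|AQ AH] := HA A AP.
  move=> n; have [_ _ _ _ +] := fP n; apply=> // w w1.
  by apply: AF; apply/unit_circleP.
by split=> //; exists H.
Qed.
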